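(* Let $T$ be a complete $\mathrm{NTP}_2$ theory and let $p(x)$ be a partial type over a small set $C$. The following are equivalent: (1) $p$ is NIP. (2) Every type $p'\supseteq p$, i.e. every complete type $p'(x)\in S(D)$ over a small set $D\supseteq C$ with $p'\supseteq p$, has boundedly many global non-forking extensions.
   Context: We work in a monster model $\mathbb{M}$ of $T$. A formula $\phi(x,y)$ has $\mathrm{TP}_2$ if there is an array $(a_{\alpha,i})_{\alpha,i<\omega}$ such that $\{\phi(x,a_{\alpha,i})\}_{i<\omega}$ is $2$-inconsistent for every $\alpha$ and $\{\phi(x,a_{\alpha,f(\alpha)})\}_{\alpha<\omega}$ is consistent for every $f:\omega\to\omega$; $T$ is $\mathrm{NTP}_2$ if no formula has $\mathrm{TP}_2$. A partial type $p(x)$ over $C$ is NIP if there are no formula $\phi(x,y)$, sequence $(a_i)_{i\in\omega}$ with $a_i\models p(x)$ and $(b_s)_{s\subseteq\omega}$ such that $\models\phi(a_i,b_s)\Leftrightarrow i\in s$. A global non-forking extension of $p'\in S(D)$ is a type $q\in S(\mathbb{M})$ extending $p'$ and containing no formula that forks over $D$. ''Boundedly many'' means that their number is bounded by a small cardinal, where $\mathbb{M}$ is $\bar\kappa$-saturated and strongly $\bar\kappa$-homogeneous for a large strong limit cardinal $\bar\kappa$ and small means $<\bar\kappa$. *)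

(* Defs.v *)
From mathcomp Require Import all_boot.
From mathcomp Require Import boolp classical_sets functions cardinality.

Set Implicit Arguments.
Unset Strict Implicit.
Unset Printing Implicit Defensive.

Local Open Scope classical_set_scope.
Local Open Scope card_scope.

(* First-order logic with equality. *)

Record language := Language {
  fsym : Type; farity : fsym -> nat;
  rsym : Type; rarity : rsym -> nat }.

Inductive term (L : language) (V : Type) : Type :=
| Var of V
| App (f : fsym L) of 'I_(farity f) -> term L V.

(* [formula L V]: first-order [L]-formulas whose free variables are in [V];
   in [Ex phi] the bound variable is [None]. *)
Inductive formula (L : language) (V : Type) : Type :=
| Eq of term L V & term L V
| Rel (r : rsym L) of 'I_(rarity r) -> term L V
| Neg of formula L V
| And of formula L V & formula L V
| Ex of formula L (option V).

Record structure (L : language) := Structure {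
  carrier :> Type;
  carrier_inhabited : inhabited carrier;
  finterp : forall f : fsym L, ('I_(farity f) -> carrier) -> carrier;
  rinterp : forall r : rsym L, ('I_(rarity r) -> carrier) -> Prop }.

Fixpoint eval (L : language) (M : structure L) (V : Type) (e : V -> M)
    (t : term L V) : M :=
  match t with
  | Var v => e v
  | App f ts => @finterp L M f (fun i => eval e (ts i))
  end.

Definition extend (V X : Type) (e : V -> X) (a : X) (o : option V) : X :=
  if o is Some v then e v else a.

Fixpoint sat (L : language) (M : structure L) (V : Type) (phi : formula L V)
    : (V -> M) -> Prop :=
  match phi with
  | Eq t u => fun e => eval e t = eval e u
  | Rel r ts => fun e => @rinterp L M r (fun i => eval e (ts i))
  | Neg psi => fun e => ~ sat psi e
  | And psi chi => fun e => sat psi e /\ sat chi e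
  | Ex psi => fun e => exists a : M, sat psi (extend e a)
  end.

Definition sentence (L : language) := formula L 'I_0.

Definition theory (L : language) := set (sentence L).

Definition holds (L : language) (M : structure L) (s : sentence L) : Prop :=
  forall e : 'I_0 -> M, sat s e.

Definition model (L : language) (T : theory L) (M : structure L) : Prop :=
  forall s, T s -> holds M s.

Definition entails (L : language) (T : theory L) (s : sentence L) : Prop :=
  forall M : structure L, model T M -> holds M s.

Definition complete_theory (L : language) (T : theory L) : Prop :=
  (exists M : structure L, model T M) /\
  forall s : sentence L, entails T s \/ entails T (Neg s).

(* A partitioned formula [phi(x, y)] with [|x| = n], [|y| = k] is a formula in
   the variables ['I_n + 'I_k]. *)
Definition join (L : language) (M : structure L) (n k : nat)
    (a : 'I_n -> M) (b : 'I_k -> M) (v : 'I_n + 'I_k) : M :=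
  match v with inl i => a i | inr j => b j end.

(* [PFormula phi b] is the formula [phi(x, b)], where [x] is an [n]-tuple of
   variables and [b] a finite tuple of parameters from [M]. *)
Record pformula (L : language) (M : structure L) (n : nat) := PFormula {
  pf_len : nat;
  pf_form : formula L ('I_n + 'I_pf_len);
  pf_par : 'I_pf_len -> M }.

Arguments PFormula {L M n pf_len} pf_form pf_par.
Arguments pf_len {L M n} p.
Arguments pf_form {L M n} p.
Arguments pf_par {L M n} p _.

Definition psat (L : language) (M : structure L) (n : nat)
    (a : 'I_n -> M) (phi : pformula M n) : Prop :=
  sat (pf_form phi) (join a (pf_par phi)).

Definition pneg (L : language) (M : structure L) (n : nat)
    (phi : pformula M n) : pformula M n :=
  PFormula (Neg (pf_form phi)) (pf_par phi).

Definition over (L : language) (M : structure L) (n : nat) (A : set M)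
    : set (pformula M n) :=
  [set phi | forall j, A (pf_par phi j)].

Definition realizes (L : language) (M : structure L) (n : nat)
    (a : 'I_n -> M) (p : set (pformula M n)) : Prop :=
  forall phi, p phi -> psat a phi.

Definition consistent (L : language) (M : structure L) (n : nat)
    (p : set (pformula M n)) : Prop :=
  forall F : set (pformula M n), finite_set F -> F `<=` p ->
  exists a : 'I_n -> M, realizes a F.

Definition partial_type (L : language) (M : structure L) (n : nat)
    (A : set M) (p : set (pformula M n)) : Prop :=
  p `<=` @over L M n A /\ consistent p.

(* Membership in [S_n(A)]; global types are obtained with [A := setT]. *)
Definition complete_type (L : language) (M : structure L) (n : nat)
    (A : set M) (p : set (pformula M n)) : Prop :=
  partial_type A p /\
  forall phi : pformula M n, over A phi -> p phi \/ p (pneg phi).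

Definition same_type (L : language) (M : structure L) (k : nat) (A : set M)
    (a b : 'I_k -> M) : Prop :=
  forall phi : pformula M k, over A phi -> (psat a phi <-> psat b phi).

(* The cardinal kappa-bar is represented by a type [K] of that cardinality;
   [small K A] means |A| < |K|. *)

Definition small (K X : Type) (A : set X) : Prop :=
  (A #<= [set: K]) /\ ~ ([set: K] #<= A).

Definition strong_limit (K : Type) : Prop :=
  infinite_set [set: K] /\
  forall A : set K, small K A -> small K [set B : set K | B `<=` A].

Definition saturated (L : language) (K : Type) (M : structure L) : Prop :=
  forall (A : set M) (n : nat) (p : set (pformula M n)),
  small K A -> complete_type A p -> exists a : 'I_n -> M, realizes a p.

Definition automorphism (L : language) (M : structure L) (g : M -> M) : Prop :=
  [/\ bijective g,
      forall (f : fsym L) (a : 'I_(farity f) -> M),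
        g (finterp a) = finterp (fun i => g (a i))
    & forall (r : rsym L) (a : 'I_(rarity r) -> M),
        rinterp a <-> rinterp (fun i => g (a i))].

Definition elementary_on (L : language) (M : structure L) (A : set M)
    (h : M -> M) : Prop :=
  forall (k : nat) (phi : formula L 'I_k) (a : 'I_k -> M),
  (forall i, A (a i)) -> (sat phi a <-> sat phi (fun i => h (a i))).

Definition strongly_homogeneous (L : language) (K : Type) (M : structure L)
    : Prop :=
  forall (A : set M) (h : M -> M), small K A -> elementary_on A h ->
  exists2 g : M -> M, automorphism g & forall a, A a -> g a = h a.

(* "Large" is read as kappa-bar > |L| + aleph_0. *)
Definition monster (L : language) (K : Type) (M : structure L) : Prop :=
  [/\ strong_limit K,
      [/\ small K [set: nat], small K [set: fsym L] & small K [set: rsym L]],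
      saturated K M
    & strongly_homogeneous K M].

(* Inconsistency is that of the indexed family: any [k] formulas with distinct
   indices are jointly unsatisfiable. *)
Definition k_inconsistent (L : language) (M : structure L) (n k : nat)
    (phi : nat -> pformula M n) : Prop :=
  forall s : seq nat, uniq s -> size s = k ->
  ~ exists a : 'I_n -> M, forall i, i \in s -> psat a (phi i).

Definition tp2 (L : language) (M : structure L) (n k : nat)
    (phi : formula L ('I_n + 'I_k)) : Prop :=
  exists a : nat -> nat -> 'I_k -> M,
    (forall alpha, k_inconsistent 2 (fun i => PFormula phi (a alpha i))) /\
    (forall f : nat -> nat,
       consistent [set PFormula phi (a alpha (f alpha)) | alpha in [set: nat]]).

Definition ntp2 (L : language) (M : structure L) : Prop :=
  forall (n k : nat) (phi : formula L ('I_n + 'I_k)), ~ tp2 M phi.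

Definition nip_type (L : language) (M : structure L) (n : nat)
    (p : set (pformula M n)) : Prop :=
  ~ exists (k : nat) (phi : formula L ('I_n + 'I_k))
           (a : nat -> 'I_n -> M) (b : set nat -> 'I_k -> M),
      (forall i, realizes (a i) p) /\
      (forall i s, sat phi (join (a i) (b s)) <-> s i).

Definition divides (L : language) (M : structure L) (n : nat) (D : set M)
    (phi : pformula M n) : Prop :=
  exists (k : nat) (b : nat -> 'I_(pf_len phi) -> M),
    (forall i, same_type D (b i) (pf_par phi)) /\
    k_inconsistent k (fun i => PFormula (pf_form phi) (b i)).

Definition forks (L : language) (M : structure L) (n : nat) (D : set M)
    (phi : pformula M n) : Prop :=
  exists (m : nat) (psi : 'I_m -> pformula M n),
    (forall i, divides D (psi i)) /\
    (forall a : 'I_n -> M, psat a phi -> exists i, psat a (psi i)).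

Definition global_nonforking_extension (L : language) (M : structure L)
    (n : nat) (D : set M) (p q : set (pformula M n)) : Prop :=
  [/\ complete_type [set: M] q, p `<=` q & forall phi, q phi -> ~ forks D phi].

(* Main.v *)
Require Import Defs.
From mathcomp Require Import all_boot.
From mathcomp Require Import boolp classical_sets functions cardinality.
From mathcomp Require filter wochoice.
From Stdlib Require List.

Set Implicit Arguments.
Unset Strict Implicit.
Unset Printing Implicit Defensive.

Local Open Scope classical_set_scope.

(* If p is NIP, a global non-forking extension q of p' is invariant over any model
   A containing D: were phi(x, a) & ~ phi(x, b) in q with a, b consecutive terms of
   a Morley sequence of a coheir over A, non-dividing would produce realizations of
   p alternating arbitrarily along that sequence.  So q is determined by a set of
   pairs of a formula and a type over A.

   Conversely, let phi(x, b_i) be shattered by p, let q be a non-principal average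
   of (b_i), and let A be a small model containing the b_i and realizing all types
   over them and finitely many elements of A, so that q is both an heir and a coheir
   over A.  The patterns of phi along a Morley sequence of q over A do not divide
   over A by Kim's lemma, which holds in NTP2 for heir-coheirs, and hence do not
   fork, because forking equals dividing over models in NTP2 theories (Chernikov and
   Kaplan, via the broom lemma).  Some p' over A is compatible with all these
   patterns, and arbitrarily long Morley sequences refute any bound on the number of
   its non-forking extensions.

   Dividing over A is handled through ideals: R(x, b) divides over A iff no
   A-definable set containing b is "thin", i.e. bounds the length of its
   k-inconsistent rows. *)

(** * Definable predicates *)

(** Kim's lemma needs a sequence each of whose terms keeps the formula dividing over everything
    before it: dividing rows can then be glued into an array whose paths are all conjugate, which
    NTP2 forbids. The coheir property makes the paths conjugate; the heir property keeps the formula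
    dividing. For a single formula some coheir always keeps dividing, since rows can be pulled into
    the model. For several formulas at once, which forking requires, the ideals to be avoided may
    jointly cover a type although none does alone; excluding this is the task of the broom lemma.
    The type p' comes from a maximal set of formulas over A no finite part of which, joined with p
    and a pattern, is covered by dividing formulas. It is complete because obstructions to a formula
    and to its negation involve two finite patterns, which fit side by side on one Morley sequence.
    No cardinal is computed in the end: the Morley sequence is indexed by the set of non-forking
    extensions plus one point, and Cantor's diagonal yields an extension outside that set. *)

Section Renaming.
Variable L : language.

Fixpoint tren V W (f : V -> W) (t : term L V) : term L W :=
  match t with
  | Var v => Var L (f v)
  | App g ts => App (fun i => tren f (ts i))
  end.

Fixpoint fren V W (f : V -> W) (phi : formula L V) : formula L W :=
  match phi with
  | Eq t u => Eq (tren f t) (tren f u)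
  | Rel r ts => Rel (fun i => tren f (ts i))
  | Neg psi => Neg (fren f psi)
  | And psi chi => And (fren f psi) (fren f chi)
  | Ex psi => Ex (fren (omap f) psi)
  end.

Variable M : structure L.

Lemma eval_tren V W (f : V -> W) (t : term L V) (e : W -> M) :
  eval e (tren f t) = eval (fun v => e (f v)) t.
Proof.
elim: t => [v|g ts IH] //=.
by congr finterp; apply: funext => i.
Qed.

Lemma sat_fren V W (f : V -> W) (phi : formula L V) (e : W -> M) :
  sat (fren f phi) e <-> sat phi (fun v => e (f v)).
Proof.
elim: phi W f e => {V}[V t u|V r ts|V psi IH|V psi IH1 chi IH2|V psi IH] W f e /=.
- by rewrite !eval_tren.
- suff -> : (fun i => eval e (tren f (ts i))) =
    (fun i => eval (fun v => e (f v)) (ts i)) by [].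
  by apply: funext => i; rewrite eval_tren.
- by rewrite IH.
- by rewrite IH1 IH2.
- suff E a : (fun v => extend e a (omap f v)) = extend (fun v => e (f v)) a.
    by split=> -[a Ha]; exists a; move: Ha; rewrite IH E.
  by apply: funext => -[].
Qed.

Lemma eval_support V (t : term L V) :
  exists s : seq V, forall e e' : V -> M,
    (forall v, List.In v s -> e v = e' v) -> eval e t = eval e' t.
Proof.
elim: t => [v|g ts IH].
  by exists [:: v] => e e' E /=; apply: E; left.
have [s Hs] := choice IH.
exists (flatten [seq s i | i <- enum 'I_(farity g)]) => e e' E /=.
congr finterp; apply: funext => i; apply: Hs => v vs; apply: E.
have : i \in enum 'I_(farity g) by rewrite mem_enum.
elim: (enum _) => //= j r IHr; rewrite inE => /orP[/eqP<-|/IHr H].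
  by apply: List.in_or_app; left.
by apply: List.in_or_app; right.
Qed.

Lemma sat_support V (phi : formula L V) :
  exists s : seq V, forall e e' : V -> M,
    (forall v, List.In v s -> e v = e' v) -> (sat phi e <-> sat phi e').
Proof.
elim: phi => {V}[V t u|V r ts|V psi [s IH]|V psi [s1 IH1] chi [s2 IH2]|V psi [s IH]].
- have [s1 H1] := eval_support t; have [s2 H2] := eval_support u.
  exists (s1 ++ s2) => e e' E /=.
  by rewrite (H1 e e') ?(H2 e e') // => v vs; apply: E; apply: List.in_or_app;
    [right|left].
- have [s Hs] := choice (fun i => eval_support (ts i)).
  exists (flatten [seq s i | i <- enum 'I_(rarity r)]) => e e' E /=.
  suff -> : (fun i => eval e (ts i)) = (fun i => eval e' (ts i)) by [].
  apply: funext => i; apply: Hs => v vs; apply: E.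
  have : i \in enum 'I_(rarity r) by rewrite mem_enum.
  elim: (enum _) => //= j l IHr; rewrite inE => /orP[/eqP<-|/IHr H].
    by apply: List.in_or_app; left.
  by apply: List.in_or_app; right.
- by exists s => e e' E /=; rewrite (IH e e').
- exists (s1 ++ s2) => e e' E /=.
  by rewrite (IH1 e e') ?(IH2 e e') // => v vs; apply: E; apply: List.in_or_app;
    [right|left].
- exists (pmap id s) => e e' E /=.
  suff E' a : sat psi (extend e a) <-> sat psi (extend e' a).
    by split=> -[a Ha]; exists a; move: Ha; rewrite E'.
  apply: IH => -[v|] //= vs; apply: E.
  elim: s vs => //= -[w|] l IHl [] //=; try by move=> ->; left.
  - by case=> ->; left.
  - by move=> /IHl; right.
Qed.

End Renaming.

Section Definable.
Variables (L : language) (M : structure L).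

Definition env V W (e : V -> M) (d : W -> M) (u : V + W) : M :=
  match u with inl v => e v | inr w => d w end.

Definition elt (A : set M) (a : {x | A x}) : M := sval a.

(** Definability is a property of predicates on assignments, with [V] arbitrary and possibly
    infinite, so that closure lemmas replace syntax. Parameters are extra variables, hence a change
    of variables or of parameters is a renaming. *)
Definition dfn (A : set M) (V : Type) (P : (V -> M) -> Prop) : Prop :=
  exists phi : formula L (V + {x | A x}),
    forall e, P e <-> sat phi (env e (@elt A)).

Lemma dfn_ext A V (P Q : (V -> M) -> Prop) :
  (forall e, P e <-> Q e) -> dfn A P -> dfn A Q.
Proof. by move=> E [phi H]; exists phi => e; rewrite -E. Qed.

Lemma dfn_not A V (P : (V -> M) -> Prop) : dfn A P -> dfn A (fun e => ~ P e).
Proof. by move=> [phi H]; exists (Neg phi) => e /=; rewrite H. Qed.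

Lemma dfn_and A V (P Q : (V -> M) -> Prop) :
  dfn A P -> dfn A Q -> dfn A (fun e => P e /\ Q e).
Proof.
by move=> [phi H] [psi H']; exists (And phi psi) => e /=; rewrite H H'.
Qed.

Lemma dfn_or A V (P Q : (V -> M) -> Prop) :
  dfn A P -> dfn A Q -> dfn A (fun e => P e \/ Q e).
Proof.
move=> HP HQ; apply: (@dfn_ext _ _ (fun e => ~ (~ P e /\ ~ Q e))).
  by move=> e; rewrite not_andP !notK.
by apply/dfn_not/dfn_and; exact: dfn_not.
Qed.

Lemma dfn_imp A V (P Q : (V -> M) -> Prop) :
  dfn A P -> dfn A Q -> dfn A (fun e => P e -> Q e).
Proof.
move=> HP HQ; apply: (@dfn_ext _ _ (fun e => ~ P e \/ Q e)).
  by move=> e; rewrite implyE.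
by apply/dfn_or => //; exact: dfn_not.
Qed.

Lemma dfn_iff A V (P Q : (V -> M) -> Prop) :
  dfn A P -> dfn A Q -> dfn A (fun e => P e <-> Q e).
Proof. by move=> HP HQ; apply: dfn_and; apply: dfn_imp. Qed.

Lemma dfn_true A V : dfn A (fun _ : V -> M => True).
Proof.
exists (Ex (Eq (Var L None) (Var L None))) => e /=; split => // _.
by have [a] := carrier_inhabited M; exists a.
Qed.

Lemma dfn_false A V : dfn A (fun _ : V -> M => False).
Proof.
by apply: dfn_ext (dfn_not (dfn_true A V)) => e; split=> //; apply.
Qed.

Lemma dfn_const A V (P : Prop) : dfn A (fun _ : V -> M => P).
Proof.
have [p|p] := pselect P; [apply: dfn_ext (dfn_true A V)
  |apply: dfn_ext (dfn_false A V)]; by move=> e; split.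
Qed.

Lemma dfn_ren A V W (f : W -> V) (P : (W -> M) -> Prop) :
  dfn A P -> dfn A (fun e : V -> M => P (fun w => e (f w))).
Proof.
move=> [phi H].
exists (fren (fun u => match u with inl w => inl (f w) | inr a => inr a end) phi).
move=> e; rewrite sat_fren H.
suff -> : (fun v => env e (@elt A) match v with inl w => inl (f w) | inr a => inr a end)
  = env (fun w => e (f w)) (@elt A) by [].
by apply: funext => -[].
Qed.

Lemma dfn_mono (A B : set M) V (P : (V -> M) -> Prop) :
  A `<=` B -> dfn A P -> dfn B P.
Proof.
move=> AB [phi H].
exists (fren (fun u => match u with inl w => inl w
   | inr a => inr (exist _ (sval a) (AB _ (svalP a))) end) phi).
move=> e; rewrite sat_fren H; set e' := (X in _ <-> sat phi X).
suff -> : e' = env e (@elt A) by [].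
by apply: funext => -[].
Qed.

Lemma dfn_subst A V W (P : (V + W -> M) -> Prop) (d : W -> M) :
  dfn A P -> (forall w, A (d w)) -> dfn A (fun e : V -> M => P (env e d)).
Proof.
move=> [phi H] Ad.
exists (fren (fun u : (V + W) + _ => match u with inl (inl v) => inl v
   | inl (inr w) => inr (exist _ (d w) (Ad w)) | inr a => inr a end) phi).
move=> e; rewrite sat_fren H; set e' := (X in _ <-> sat phi X).
suff -> : e' = env (env e d) (@elt A) by [].
by apply: funext => -[[]|].
Qed.

Lemma dfn_eq A V (v w : V) : dfn A (fun e : V -> M => e v = e w).
Proof. by exists (Eq (Var L (inl v)) (Var L (inl w))) => e. Qed.

Lemma dfn_eqa A V (v : V) a : A a -> dfn A (fun e : V -> M => e v = a).
Proof.
by move=> Aa; exists (Eq (Var L (inl v)) (Var L (inr (exist _ a Aa)))) => e.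
Qed.

Lemma dfn_ex1 A V (P : (option V -> M) -> Prop) :
  dfn A P -> dfn A (fun e : V -> M => exists a, P (extend e a)).
Proof.
move=> [phi H].
exists (Ex (fren (fun u : option V + _ => match u with inl (Some v) => Some (inl v)
   | inl None => None | inr a => Some (inr a) end) phi)).
move=> e /=.
suff E a : P (extend e a) <-> sat (fren (fun u : option V + _ =>
   match u with inl (Some v) => Some (inl v)
   | inl None => None | inr a => Some (inr a) end) phi)
  (extend (env e (@elt A)) a) by split=> -[a Ha]; exists a; apply/E.
rewrite sat_fren H; set e' := (X in _ <-> sat phi X).
suff -> : e' = env (extend e a) (@elt A) by [].
by apply: funext => -[[]|].
Qed.

Lemma dfn_exI A V m (P : (V + 'I_m -> M) -> Prop) :
  dfn A P -> dfn A (fun e : V -> M => exists y : 'I_m -> M, P (env e y)).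
Proof.
elim: m V P => [|m IH] V P HP.
  apply: dfn_ext (dfn_ren (fun u : V + 'I_0 => match u with inl v => v
     | inr i => match notF (ltn_ord i) with end end) HP) => e.
  have E (y : 'I_0 -> M) : env e y = (fun w : V + 'I_0 => e match w with inl v => v
     | inr i => match notF (ltn_ord i) with end end).
    by apply: funext => -[v|[]].
  split=> [H|[y]]; last by rewrite E.
  have [a] := carrier_inhabited M.
  by exists (fun=> a); rewrite E.
pose h (u : V + 'I_m.+1) : option (V + 'I_m) :=
  match u with inl v => Some (inl v)
  | inr i => omap (@inr _ _) (unlift ord0 i) end.
have /IH := dfn_ren (fun u : option (V + 'I_m) => match u with
   Some (inl v) => inl (Some v) | Some (inr i) => inr i | None => inl None end)
   (dfn_ren h HP).
move=> /dfn_ex1; apply: dfn_ext => e; split.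
  move=> [a [y H]].
  exists (fun i => if unlift ord0 i is Some j then y j else a).
  congr P: H; apply: funext => -[v|i] //=.
  by rewrite /h; case: (unlift ord0 i).
move=> [y H]; exists (y ord0), (fun j => y (lift ord0 j)).
congr P: H; apply: funext => -[v|i] //=.
by rewrite /h; case: unliftP => [j|] ->.
Qed.

Lemma dfn_ex A V (Y : finType) (P : (V -> M) -> (Y -> M) -> Prop) :
  dfn A (fun u : V + Y -> M => P (fun v => u (inl v)) (fun y => u (inr y))) ->
  dfn A (fun e : V -> M => exists y : Y -> M, P e y).
Proof.
move=> /(dfn_ren (fun u : V + Y => match u with inl v => inl v
  | inr y => inr (enum_rank y) end)) /dfn_exI.
apply: dfn_ext => e; split.
  by move=> [y H]; eexists; exact: H.
move=> [y H]; exists (fun i => y (enum_val i)); congr P: H.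
by apply: funext => w /=; rewrite enum_rankK.
Qed.

Lemma dfn_all A V (Y : finType) (P : (V -> M) -> (Y -> M) -> Prop) :
  dfn A (fun u : V + Y -> M => P (fun v => u (inl v)) (fun y => u (inr y))) ->
  dfn A (fun e : V -> M => forall y : Y -> M, P e y).
Proof.
move=> HP; apply: (@dfn_ext _ _ (fun e => ~ exists y, ~ P e y)).
  by move=> e; rewrite -forallNP; split=> H y; have := H y; rewrite notK.
by apply: dfn_not; apply: dfn_ex; apply: dfn_not.
Qed.

Lemma dfn_In A V T (s : seq T) (P : T -> (V -> M) -> Prop) :
  (forall t, List.In t s -> dfn A (P t)) ->
  dfn A (fun e => forall t, List.In t s -> P t e).
Proof.
elim: s => [|t s IH] H.
  by apply: dfn_ext (dfn_true A V) => e; split.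
have /dfn_and : dfn A (P t) by apply: H; left.
move=> /(_ _ (IH _)); have /[swap]/[apply] :
   forall t0 : T, List.In t0 s -> dfn A (P t0) by move=> u us; apply: H; right.
apply: dfn_ext => e /=; split.
  by move=> [H1 H2] u [<-|/H2].
by move=> K; split=> [|u us]; apply: K; [left|right].
Qed.

Lemma In_mem (T : eqType) (s : seq T) t : List.In t s <-> t \in s.
Proof.
elim: s => //= u s IH; rewrite inE; split.
  by move=> [->|/IH ->]; rewrite ?eqxx ?orbT.
by move=> /orP[/eqP->|/IH]; [left|right].
Qed.

Lemma dfn_mem A V (T : eqType) (s : seq T) (P : T -> (V -> M) -> Prop) :
  (forall t, t \in s -> dfn A (P t)) ->
  dfn A (fun e => forall t, t \in s -> P t e).
Proof.
move=> H; apply: (@dfn_ext _ _ (fun e => forall t, List.In t s -> P t e)).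
  by move=> e; split=> K t ts; apply: K; apply/In_mem.
by apply: dfn_In => t /In_mem; exact: H.
Qed.

Lemma dfn_fin A V (T : finType) (P : T -> (V -> M) -> Prop) :
  (forall t, dfn A (P t)) -> dfn A (fun e => forall t, P t e).
Proof.
move=> H; apply: (@dfn_ext _ _ (fun e => forall t, t \in enum T -> P t e)).
  by move=> e; split=> K t; have := K t; rewrite mem_enum //; apply.
by apply: dfn_mem.
Qed.

Lemma dfn_finE A V (T : finType) (P : T -> (V -> M) -> Prop) :
  (forall t, dfn A (P t)) -> dfn A (fun e => exists t, P t e).
Proof.
move=> H; apply: (@dfn_ext _ _ (fun e => ~ forall t, ~ P t e)).
  by move=> e; rewrite -existsNP; split=> -[t Ht]; exists t; move: Ht; rewrite notK.
by apply/dfn_not/dfn_fin => t; apply: dfn_not.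
Qed.

Lemma dfn_support A V (P : (V -> M) -> Prop) : dfn A P ->
  exists s : seq V, forall e e' : V -> M,
    (forall v, List.In v s -> e v = e' v) -> (P e <-> P e').
Proof.
move=> [phi H]; have [s Hs] := sat_support M phi.
exists (pmap (fun u => if u is inl v then Some v else None) s) => e e' E.
rewrite !H; apply: Hs => -[v|a] //= vs; apply: E.
elim: s vs => //= -[w|a] s IH /= [] //; try by move=> /IH; right.
- by case=> ->; left.
Qed.

(** A formula mentions finitely many parameters; those outside [A] lie in [B] and are traded for
    variables. *)
Lemma dfn_split A B V (P : (V -> M) -> Prop) : dfn (A `|` B) P ->
  exists m (d : 'I_m -> M) (Q : (V + 'I_m -> M) -> Prop),
    [/\ forall i, B (d i), dfn A Q & forall e, P e <-> Q (env e d)].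
Proof.
move=> [phi H]; have [s Hs] := sat_support M phi.
pose l : seq M := pmap (fun u : V + {x | (A `|` B) x} => if u is inr a then
  (if pselect (A (elt a)) then None else Some (elt a)) else None) s.
have [a0] := carrier_inhabited M.
have Bl i : i < size l -> B (nth a0 l i).
  rewrite /l; elim: s i {l Hs} => //= -[w|[a Aa]] s IH i //=.
  - exact: IH.
  - rewrite /elt /=; case: pselect => //= nA; first exact: IH.
    by case: i => [|i] /=; [case: Aa|exact: IH].
have Hl u : List.In u s -> forall a, u = inr a -> ~ A (elt a) ->
   exists i : 'I_(size l), nth a0 l i = elt a.
  move=> us a E nA; subst u; rewrite /l.
  elim: s us {l Hs Bl} => //= u s IH [->|/IH [i Hi]].
    by case: pselect => //= _; exists ord0.
  case: u => [w|b] /=; first by exists i.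
  case: pselect => /= nB; first by exists i.
  by exists (lift ord0 i).
(* A parameter outside [A] and outside the support has no index in [l]. It goes to the dummy
   variable [None], whose value is irrelevant and which [Ex] binds below. *)
pose g (u : V + {x | (A `|` B) x}) : option ((V + 'I_(size l)) + {x | A x}) :=
  match u with inl v => Some (inl (inl v))
  | inr a => match pselect (A (elt a)) with
     | left Aa => Some (inr (exist _ (elt a) Aa))
     | right _ => omap (fun i => inl (inr i))
         [pick i : 'I_(size l) | `[< nth a0 l i = elt a >]]
     end end.
have gs (e : V + 'I_(size l) -> M) a : (forall i, e (inr i) = nth a0 l i) ->
    (sat (fren g phi) (extend (env e (@elt A)) a) <->
     sat phi (env (fun v => e (inl v)) (@elt (A `|` B)))).
  move=> Ee; rewrite (sat_fren _ phi); apply: Hs => -[v|b] us //=.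
  case: pselect => //= nA.
  have [i Hi] := Hl _ us _ erefl nA.
  by case: pickP => [j /asboolP <- //=|/(_ i) /asboolP].
exists (size l), (fun i => nth a0 l i), (fun u => exists a,
  sat (fren g phi) (extend (env u (@elt A)) a)); split.
- by move=> i; apply: Bl.
- by exists (Ex (fren g phi)).
- move=> e; rewrite H; split; first by exists a0; apply/gs.
  by move=> [a /gs]; apply.
Qed.

Definition dfn2 A (V W : Type) (P : (V -> M) -> (W -> M) -> Prop) :=
  dfn A (fun u : V + W -> M => P (fun v => u (inl v)) (fun w => u (inr w))).

Lemma dfn_binary A V W (P : (V -> M) -> (W -> M) -> Prop) X (f : V -> X) (g : W -> X) :
  dfn2 A P -> dfn A (fun e : X -> M => P (fun v => e (f v)) (fun w => e (g w))).
Proof.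
exact: (dfn_ren (fun u : V + W => match u with inl v => f v | inr w => g w end)).
Qed.

End Definable.

(** * Small types *)

Definition leT (X Y : Type) := exists f : X -> Y, injective f.

Lemma leT_trans X Y Z : leT X Y -> leT Y Z -> leT X Z.
Proof. by move=> [f If] [g Ig]; exists (g \o f); apply: inj_comp. Qed.

Lemma leT_sig X (A : set X) : leT {x | A x} X.
Proof.
by exists (@sval _ _) => -[x Ax] [y Ay] /= E; subst y; congr exist; exact: Prop_irrelevance.
Qed.

Lemma leT_surj X Y (f : X -> Y) : (forall y, exists x, f x = y) -> leT Y X.
Proof. by move=> /choice [g Hg]; exists g => y y' E; rewrite -(Hg y) E. Qed.

(** Zorn's lemma on graphs of partial injections: a maximal one is total or onto, for otherwise a
    missing argument could be paired with a missing value. *)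
Lemma leT_total X Y : leT X Y \/ leT Y X.
Proof.
pose P (G : set (X * Y)) := (forall x y y', G (x, y) -> G (x, y') -> y = y') /\
  (forall x x' y, G (x, y) -> G (x', y) -> x = x').
have [F FP Ftot|G [[Gf Gi] Gmax]] := @Zorn_bigcup _ P.
  have common a b : (\bigcup_(H in F) H) a -> (\bigcup_(H in F) H) b ->
      exists2 H, F H & H a /\ H b.
    move=> [H FH Ha] [H' FH' Hb].
    have [HH|HH] := Ftot _ _ FH FH'; first by exists H' => //; split=> //; exact: HH.
    by exists H => //; split=> //; exact: HH.
  split=> [x y y'|x x' y] Ha Hb; have [H FH [Ga Gb]] := common _ _ Ha Hb.
    exact: (FP _ FH).1 Ga Gb.
  exact: (FP _ FH).2 Ga Gb.
have [tx|/existsNP[x /forallNP nx]] := pselect (forall x, exists y, G (x, y)).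
  by have [f Hf] := choice tx; left; exists f => x x' E;
    apply: Gi (Hf x) _; rewrite E.
have [ty|/existsNP[y /forallNP ny]] := pselect (forall y, exists x, G (x, y)).
  by have [f Hf] := choice ty; right; exists f => y y' E;
    apply: Gf (Hf y) _; rewrite E.
case: (Gmax (G `|` [set (x, y)])).
  split; first by left.
  by move=> /(_ (x, y) (or_intror erefl)); exact: nx.
split.
  move=> a b b' [Ga|[Ea Eb]] [Gb|[Ea' Eb']]; subst.
  - exact: Gf Ga Gb.
  - by case: (nx _ Ga).
  - by case: (nx _ Gb).
  - by [].
move=> a a' b [Ga|[Ea Eb]] [Gb|[Ea' Eb']]; subst.
- exact: Gi Ga Gb.
- by case: (ny _ Ga).
- by case: (ny _ Gb).
- by [].
Qed.

(** Kuratowski pairs. Power sets cost nothing below a strong limit, so no cardinal arithmetic of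
    products is required. *)
Lemma leT_prod_self X : leT (X * X) (set (set X)).
Proof.
exists (fun p => [set [set p.1]; [set p.1; p.2]]) => -[a b] [c d] /= E.
have : [set [set c]; [set c; d]] [set a; b] by rewrite -E; right.
have : [set [set a]; [set a; b]] [set c; d] by rewrite E; right.
have sub1 (A B : set X) : A = B -> forall x, A x -> B x by move=> ->.
have ac : a = c.
  have : [set [set a]; [set a; b]] [set c] by rewrite E; left.
  by move=> [|] /esym /sub1 H; apply: H; [|left].
subst c => H1 H2; congr pair.
have K1 : b = a \/ b = d.
  by case: H2 => /sub1/(_ b (or_intror erefl)); [left|move=> []; [left|right]].
have K2 : d = a \/ d = b.
  by case: H1 => /sub1/(_ d (or_intror erefl)); [left|move=> []; [left|right]].
by case: K1 => [?|//]; subst b; case: K2 => ->.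
Qed.

Section Small.
Variable K : Type.
Hypotheses (slK : strong_limit K) (natK : small K [set: nat]).

Lemma card_leTP X Y (A : set X) (B : set Y) :
  (A #<= B)%card <-> leT {x | A x} {y | B y}.
Proof.
split.
  move=> /card_leP[f].
  pose g (a : {x | A x}) : {y | B y} :=
    let b := f (SigSub (mem_set (svalP a))) in exist _ (val b) (set_mem (valP b)).
  exists g => a a' /(congr1 (@sval _ _)) /= /val_inj E.
  have /(congr1 val) /= := @inj _ _ setT f _ _ (mem_set I) (mem_set I) E.
  by move: a a' {E} => [x Ax] [y Ay] /= E; subst y; congr exist; exact: Prop_irrelevance.
move=> [f If]; apply/card_leP/injfunPex.
exists (fun a : A => (SigSub (mem_set (svalP (f (exist _ (val a) (set_mem (valP a)))))) : B)).
  by [].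
move=> a a' _ _ /(congr1 val) /= E; apply: val_inj.
suff /(congr1 (@sval _ _)) : exist A (val a) (set_mem (valP a)) =
  exist A (val a') (set_mem (valP a')) by [].
apply: If; move: E; move: (f _) (f _) => [x Bx] [y By] /= E.
by subst y; congr exist; exact: Prop_irrelevance.
Qed.

Definition smT X := leT X K /\ ~ leT K X.

Lemma leT_sigT X : leT X {x | [set: X] x}.
Proof. by exists (fun x => exist _ x I) => x y []. Qed.

Lemma small_smT X (A : set X) : small K A <-> smT {x | A x}.
Proof.
rewrite /small !card_leTP; split=> -[H1 H2]; split.
- exact: leT_trans H1 (leT_sig _).
- by move=> H; apply: H2; apply: leT_trans H; exact: leT_sig.
- exact: leT_trans H1 (leT_sigT _).
- by move=> H; apply: H2; apply: leT_trans H; exact: leT_sigT.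
Qed.

Lemma sm_le X Y : leT X Y -> smT Y -> smT X.
Proof.
move=> XY [YK nKY]; split; first exact: leT_trans YK.
by move=> KX; apply: nKY; exact: leT_trans XY.
Qed.

Lemma small_setT X : small K [set: X] <-> smT X.
Proof.
by rewrite small_smT; split; apply: sm_le; [exact: leT_sigT|exact: leT_sig].
Qed.

Lemma sm_nat : smT nat. Proof. exact/small_setT. Qed.

Lemma sm_set X : smT X -> smT (set X).
Proof.
move=> smX; have [f If] := smX.1.
have /slK.2/small_smT : small K (range f).
  apply/small_smT; apply: sm_le smX.
  have H (a : {x | range f x}) : exists x, f x = sval a.
    by case: a => y /= [x _ <-]; exists x.
  have [g Hg] := choice H; exists g => -[x Hx] [y Hy] /(congr1 f).
  by rewrite !Hg /= => E; subst y; congr exist; exact: Prop_irrelevance.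
apply: sm_le.
have sub (A : set X) : f @` A `<=` range f by move=> _ [x _ <-]; exists x.
exists (fun A => exist _ (f @` A) (sub A)) => A B [E].
have H (C : set X) x : (f @` C) (f x) <-> C x.
  by split=> [[y Cy /If <-]|Cx] //; exists x.
by apply/seteqP; split=> x; [rewrite -(H A) E H|rewrite -(H B) -E H].
Qed.

Lemma sm_prod X Y : smT X -> smT Y -> smT (X * Y).
Proof.
move=> sX sY; case: (leT_total X Y) => -[f If].
  apply: sm_le (sm_set (sm_set sY)); apply: leT_trans (leT_prod_self Y).
  by exists (fun p => (f p.1, p.2)) => -[a b] [c d] /= [/If -> ->].
apply: sm_le (sm_set (sm_set sX)); apply: leT_trans (leT_prod_self X).
by exists (fun p => (p.1, f p.2)) => -[a b] [c d] /= [-> /If ->].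
Qed.

Lemma sm_sum X Y : smT X -> smT Y -> smT (X + Y).
Proof.
move=> sX sY.
apply: sm_le (sm_prod (sm_set sX) (sm_set sY)).
exists (fun u => match u with inl x => ([set x], set0) | inr y => (set0, [set y]) end).
have H T (x : T) : [set x] = set0 -> False by move=> E; have : [set x] x by []; rewrite E.
have H' T (x y : T) : [set x] = [set y] -> x = y.
  by move=> E; have : [set x] x by []; rewrite E.
move=> [x|y] [x'|y'] [] //.
- by move=> E; rewrite (H' _ _ _ E).
- by move=> E _; case: (H _ _ E).
- by move=> E _; case: (H _ _ (esym E)).
- by move=> E; rewrite (H' _ _ _ E).
Qed.

Lemma sm_seq X : smT X -> smT (seq X).
Proof.
move=> sX; apply: sm_le (sm_set (sm_prod sm_nat sX)).
exists (fun s => [set p | onth s p.1 = Some p.2]) => s t E.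
have {}E i : onth s i = onth t i.
  have H j x : onth s j = Some x <-> onth t j = Some x.
    by have := congr1 (fun A => A (j, x)) E => /= ->.
  case Es : (onth s i) => [x|]; first by move/H: Es => ->.
  case Et : (onth t i) => [x|] //.
  by move/H: Et; rewrite Es.
elim: s t E => [|x s IH] [|y t] // E; try by have := E 0.
by have [->] := E 0; congr cons; apply: IH => i; exact: (E i.+1).
Qed.

Lemma sm_tree X : smT X -> smT (GenTree.tree X).
Proof.
move=> sX; apply: sm_le (sm_seq (sm_sum sm_nat sX)).
by exists (@GenTree.encode X); apply: pcan_inj (@GenTree.codeK X).
Qed.

Lemma sm_fin (X : finType) : smT X.
Proof.
by apply: sm_le sm_nat; exists (fun x => enum_rank x : nat) => x y /ord_inj/enum_rank_inj.
Qed.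

Section Formulas.
Variable L : language.
Hypotheses (smf : smT (Defs.fsym L)) (smr : smT (rsym L)).

Definition label (X : Type) := (nat + X + Defs.fsym L + rsym L)%type.

Fixpoint enct X V (g : V -> nat + X) (t : term L V) : GenTree.tree (label X) :=
  match t with
  | Var v => GenTree.Leaf (inl (inl (g v)))
  | App f ts => GenTree.Node 0 (GenTree.Leaf (inl (inr f)) ::
      [seq enct g (ts i) | i <- enum 'I_(farity f)])
  end.

Definition shift X V (g : V -> nat + X) (o : option V) : nat + X :=
  match o with
  | None => inl 0
  | Some v => match g v with inl n => inl n.+1 | inr x => inr x end
  end.

Fixpoint encf X V (g : V -> nat + X) (phi : formula L V) : GenTree.tree (label X) :=
  match phi with
  | Eq t u => GenTree.Node 0 [:: enct g t; enct g u]
  | Rel r ts => GenTree.Node 1 (GenTree.Leaf (inr r) ::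
      [seq enct g (ts i) | i <- enum 'I_(rarity r)])
  | Neg psi => GenTree.Node 2 [:: encf g psi]
  | And psi chi => GenTree.Node 3 [:: encf g psi; encf g chi]
  | Ex psi => GenTree.Node 4 [:: encf (shift g) psi]
  end.

Lemma map_enum_inj n X Y (h : X -> Y) (s t : 'I_n -> X) :
  (forall i y, h (s i) = h y -> s i = y) ->
  [seq h (s i) | i <- enum 'I_n] = [seq h (t i) | i <- enum 'I_n] -> s = t.
Proof.
move=> H E; apply: funext => i; apply: H.
have : i \in enum 'I_n by rewrite mem_enum.
elim: (enum _) E => //= j l IH [E1 E2]; rewrite inE => /orP[/eqP->//|].
exact: IH.
Qed.

Lemma enct_inj X V (g : V -> nat + X) : injective g -> injective (enct g).
Proof.
move=> Ig; elim=> [v|f ts IH] [w|f' ts'] //=.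
  by case=> /Ig ->.
case=> E; subst f' => E; congr App; apply: map_enum_inj E => i y; exact: IH.
Qed.

Lemma shift_inj X V (g : V -> nat + X) : injective g -> injective (shift g).
Proof.
move=> Ig [v|] [w|] //=.
- by case Ev : (g v); case Ew : (g w) => // -[] E; congr Some; apply: Ig; rewrite Ev Ew E.
- by case: (g v).
- by case: (g w).
Qed.

Lemma encf_inj X V (g : V -> nat + X) : injective g -> injective (encf g).
Proof.
move=> Ig phi; elim: phi g Ig =>
  {V}[V t u|V r ts|V psi IH|V psi IH1 chi IH2|V psi IH] g Ig [t' u'|r' ts'|psi'|psi' chi'|psi'] //=.
- by case=> /(enct_inj Ig) -> /(enct_inj Ig) ->.
- case=> E; subst r' => E; congr Rel; apply: map_enum_inj E => i y.
  exact: enct_inj.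
- by case=> /IH -> //.
- by case=> /IH1 -> // /IH2 ->.
- by case=> /IH -> //; exact: shift_inj.
Qed.

Lemma sm_formula V : smT V -> smT (formula L V).
Proof.
move=> sV; apply: sm_le (sm_tree (sm_sum (sm_sum (sm_sum sm_nat sV) smf) smr)).
by exists (encf (@inr nat V)); apply: encf_inj => v w [].
Qed.

End Formulas.

Lemma small_sub X (A B : set X) : A `<=` B -> small K B -> small K A.
Proof.
move=> AB /small_smT sB; apply/small_smT; apply: sm_le sB.
exists (fun a => exist _ (sval a) (AB _ (svalP a))) => -[x Ax] [y Ay] [E].
by subst y; congr exist; exact: Prop_irrelevance.
Qed.

Lemma small_range X Y (f : X -> Y) : smT X -> small K (range f).
Proof.
move=> sX; apply/small_smT; apply: sm_le sX.
apply: (@leT_surj _ _ (fun x => exist (range f) (f x) (ex_intro2 _ _ x I erefl))).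
by move=> [y [x xT E]]; exists x; subst y; congr exist; exact: Prop_irrelevance.
Qed.

Lemma small_setU X (A B : set X) : small K A -> small K B -> small K (A `|` B).
Proof.
move=> /small_smT sA /small_smT sB.
have : small K (range (fun u : {x | A x} + {x | B x} =>
  match u with inl a => sval a | inr b => sval b end)).
  by apply: small_range; apply: sm_sum.
apply: small_sub => x [Ax|Bx]; first by exists (inl (exist _ x Ax)).
by exists (inr (exist _ x Bx)).
Qed.

Lemma small_set0 X : small K (@set0 X).
Proof.
apply/small_smT; apply: sm_le sm_nat; by exists (fun=> 0) => -[].
Qed.

End Small.

(** * Compactness in the monster model *)

Section Ultra.
Variable T : Type.

Definition ultra (U : set (set T)) :=
  [/\ U setT, ~ U set0, (forall A B, U A -> U B -> U (A `&` B)),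
      (forall A B, A `<=` B -> U A -> U B) & forall A, U A \/ U (~` A)].

Lemma ultra_exists (F : set (set T)) :
  (forall s : seq (set T), (forall A, List.In A s -> F A) ->
     exists x, forall A, List.In A s -> A x) ->
  exists2 U, ultra U & F `<=` U.
Proof.
move=> fip.
pose G (B : set T) := exists2 s : seq (set T), (forall A, List.In A s -> F A) &
  (forall x, (forall A, List.In A s -> A x) -> B x).
have GF : filter.ProperFilter G.
  apply: filter.Build_ProperFilter_ex.
    by move=> B [s sF sB]; have [x Hx] := fip s sF; exists x; exact: sB.
  split.
  - by exists [::].
  - move=> B C [s sF sB] [t tF tC]; exists (s ++ t).
      by move=> A As; case: (List.in_app_or _ _ _ As) => [/sF|/tF].
    move=> x H; split; [apply: sB|apply: tC] => A As; apply: H; apply: List.in_or_app.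
      by left.
    by right.
  - by move=> B C BC [s sF sB]; exists s => // x /sB; exact: BC.
have [U [UU GU]] := @filter.ultraFilterLemma _ _ GF.
exists U; last first.
  move=> A FA; apply: GU; exists [:: A] => [B [<-|]//|x Hx].
  by apply: Hx; left.
split.
- exact: filter.filterT.
- by move=> U0; have [] := filter.filter_ex U0.
- by move=> A B UA UB; exact: (filter.filterI UA UB).
- by move=> A B AB UA; exact: (filter.filterS AB UA).
- by move=> A; exact: filter.in_ultra_setVsetC.
Qed.

Variable U : set (set T).
Hypothesis UU : ultra U.

Lemma ultraT : U setT. Proof. by case: UU. Qed.

Lemma ultraI A B : U A -> U B -> U (A `&` B).
Proof. by case: UU => _ _ H _ _; exact: H. Qed.

Lemma ultraS (A B : set T) : (forall x, A x -> B x) -> U A -> U B.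
Proof. by case: UU => _ _ _ H _; exact: H. Qed.

Lemma ultraVC A : U A \/ U (~` A).
Proof. by case: UU. Qed.

Lemma ultra_ex A : U A -> exists x, A x.
Proof.
case: UU => _ U0 _ US _ UA; apply: contrapT => /forallNP nA.
by apply: U0; apply: US UA => x /nA.
Qed.

Lemma ultra_not A : U (~` A) <-> ~ U A.
Proof.
split=> [UnA UA|]; last by have [|] := ultraVC A.
by have [x []] := ultra_ex (ultraI UA UnA).
Qed.

Lemma ultra_In I (s : seq I) (A : I -> set T) :
  (forall i, List.In i s -> U (A i)) -> U [set x | forall i, List.In i s -> A i x].
Proof.
elim: s => [|i s IH] H; first by apply: ultraS ultraT => x _.
have := ultraI (H i (or_introl erefl)) (IH (fun j js => H j (or_intror js))).
by apply: ultraS => x [Ai As] j [<-|/As].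
Qed.

Lemma ultra_fin (I : finType) (A : I -> set T) :
  (forall i, U (A i)) -> U [set x | forall i, A i x].
Proof.
move=> H; have := @ultra_In I (enum I) A (fun i _ => H i).
by apply: ultraS => x Hx i; apply: Hx; apply/In_mem; rewrite mem_enum.
Qed.

End Ultra.

Lemma finite_setE T (F : set T) :
  finite_set F <-> exists s : seq T, F = [set x | List.In x s].
Proof.
split=> [/(@finite_seqP {classic T})[s ->]|[s ->]].
  by exists s; apply/seteqP; split=> x; rewrite /= -(@In_mem {classic T}).
apply/(@finite_seqP {classic T}); exists s.
by apply/seteqP; split=> x; rewrite /= -(@In_mem {classic T}).
Qed.

Section Monster.
Variables (L : language) (K : Type) (M : structure L).

Lemma dfn0_formula V (P : (V -> M) -> Prop) : dfn set0 P ->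
  exists phi : formula L V, forall e, P e <-> sat phi e.
Proof.
move=> [phi H].
exists (fren (fun u : V + {x : M | set0 x} => match u with inl v => v
  | inr a => False_rect V (svalP a) end) phi) => e.
rewrite sat_fren H; set e1 := (X in sat _ X <-> _); set e2 := (X in _ <-> sat _ X).
by suff -> : e1 = e2 by []; apply: funext => -[//|[]].
Qed.

Lemma formula_dfn A V (phi : formula L V) : dfn A (fun e : V -> M => sat phi e).
Proof. by exists (fren (@inl _ _) phi) => e; rewrite sat_fren. Qed.

Lemma dfn_formula A V (P : (V -> M) -> Prop) : dfn A P ->
  exists m (d : 'I_m -> M) (phi : formula L (V + 'I_m)),
    (forall i, A (d i)) /\ forall e, P e <-> sat phi (env e d).
Proof.
rewrite -[A]set0U => /dfn_split[m [d [Q [Ad HQ E]]]].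
have [phi Hphi] := dfn0_formula HQ.
exists m, d, phi; split=> [i|e]; last by rewrite E.
by rewrite set0U; exact: Ad.
Qed.

Lemma dfn_pf n A (P : ('I_n -> M) -> Prop) : dfn A P ->
  exists2 phi : pformula M n, Defs.over A phi & forall a, P a <-> psat a phi.
Proof.
move=> /dfn_formula [m [d [phi [Ad H]]]].
by exists (PFormula phi d).
Qed.

Lemma pf_dfn n A (phi : pformula M n) : Defs.over A phi ->
  dfn A (fun a : 'I_n -> M => psat a phi).
Proof.
by move=> Aphi; apply: (dfn_subst (d := pf_par phi)) Aphi; exact: formula_dfn.
Qed.

Hypothesis mon : monster K M.

Let slK : strong_limit K. Proof. by case: mon. Qed.
Let natK : small K [set: nat]. Proof. by case: mon => _ []. Qed.

(** [saturated] speaks of complete types only; an ultrafilter on points completes the given finitely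
    satisfiable family. *)
Lemma realize n (A : set M) (S : set (('I_n -> M) -> Prop)) : small K A ->
  (forall P, S P -> dfn A P) ->
  (forall s, (forall P, List.In P s -> S P) -> exists a, forall P, List.In P s -> P a) ->
  exists a, forall P, S P -> P a.
Proof.
move=> sA SA /ultra_exists [U UU SU].
have sat_M : saturated K M by case: mon.
have [|a Ha] := sat_M A n [set phi | Defs.over A phi /\ U (fun a => psat a phi)] sA.
  split; first split.
  - by move=> phi [].
  - move=> F /finite_setE[s ->] sF.
    have [x Hx] : exists x, forall phi, List.In phi s -> psat x phi.
      by apply: (ultra_ex UU); apply: (ultra_In UU) => phi /sF [].
    by exists x.
  - move=> phi Aphi; have [H|H] := ultraVC UU (fun a => psat a phi); first by left.
    by right.
exists a => P SP; have [phi Aphi H] := dfn_pf (SA _ SP).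
by apply/H/Ha; split=> //; apply: (ultraS UU) (SU _ SP) => x /H.
Qed.

Lemma In_cat T (s t : seq T) x : List.In x (s ++ t) <-> List.In x s \/ List.In x t.
Proof. exact: List.in_app_iff. Qed.

Lemma dfn_supports A V (s : seq ((V -> M) -> Prop)) :
  (forall P, List.In P s -> dfn A P) ->
  exists l : seq V, forall e e' : V -> M,
    (forall v, List.In v l -> e v = e' v) ->
    (forall P, List.In P s -> P e -> P e').
Proof.
elim: s => [|P s IH] H; first by exists [::].
have [l1 H1] := dfn_support (H P (or_introl erefl)).
have [|l2 H2] := IH; first by move=> Q Qs; apply: H; right.
exists (l1 ++ l2) => e e' E Q [<-|Qs].
  by have [|H0 _] := H1 e e'; first by move=> v vl; apply: E; rewrite In_cat; left.
by apply: H2 Qs => v vl; apply: E; rewrite In_cat; right.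
Qed.

(* Zorn's lemma on partial assignments; saturation is only used in the
   extension step, for the type of a single element. *)
Lemma compactness V (A : set M) (S : set ((V -> M) -> Prop)) :
  smT K V -> small K A -> (forall P, S P -> dfn A P) ->
  (forall s, (forall P, List.In P s -> S P) -> exists e, forall P, List.In P s -> P e) ->
  exists e, forall P, S P -> P e.
Proof.
move=> sV sA SA fip.
pose extends (e : V -> M) (G : set (V * M)) := forall v a, G (v, a) -> e v = a.
pose good (G : set (V * M)) := forall s, (forall P, List.In P s -> S P) ->
  exists2 e, extends e G & forall P, List.In P s -> P e.
have goodf G v a b : good G -> G (v, a) -> G (v, b) -> a = b.
  by move=> /(_ [::])[//|e eG _] /eG <- /eG <-.
have [F Fgood Ftot|G [Ggood Gmax]] := @Zorn_bigcup _ good.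
  pose U := \bigcup_(G in F) G.
  have Uf v a b : U (v, a) -> U (v, b) -> a = b.
    move=> [G FG Ga] [H FH Hb].
    have [GH|HG] := Ftot _ _ FG FH.
      exact: goodf (Fgood _ FH) (GH _ Ga) Hb.
    exact: goodf (Fgood _ FG) Ga (HG _ Hb).
  move=> s sS.
  have [l Hl] := dfn_supports (fun P Ps => SA P (sS P Ps)).
  have [e el es] : exists2 e : V -> M, (forall v a, List.In v l -> U (v, a) -> e v = a) &
      forall P, List.In P s -> P e.
    have [[G0 FG0]|F0] := pselect (F !=set0); last first.
      have [e es] := fip s sS; exists e => // v a _ [G FG _].
      by case: F0; exists G.
    (* [l] is finite, so one member of the chain already contains every value that the union assigns
       on [l]. *)
    have [G FG GU] : exists2 G, F G & forall v a, List.In v l -> U (v, a) -> G (v, a).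
      elim: l {Hl} => [|v l [G FG HG]]; first by exists G0.
      have [[a Ua]|nU] := pselect (exists a, U (v, a)); last first.
        exists G => // w a [E Ua|]; last exact: HG.
        by subst w; case: nU; exists a.
      have [H FH Ha] := Ua.
      have [GH|HG'] := Ftot _ _ FG FH.
        exists H => // w b [E Ub|wl Ub]; last exact/GH/HG.
        by subst w; rewrite (Uf _ _ _ Ub Ua).
      exists G => // w b [E Ub|wl Ub]; last exact: HG.
      by subst w; rewrite (Uf _ _ _ Ub Ua); exact: HG'.
    have [e eG es] := Fgood _ FG s sS.
    by exists e => // v a vl Ua; apply: eG; exact: GU.
  exists (fun v => if pselect (exists a, U (v, a)) is left H then projT1 (cid H) else e v).
    move=> v a Ua; case: pselect => [H|[]]; last by exists a.
    by apply: Uf Ua; exact: (projT2 (cid H)).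
  move=> P Ps; apply: Hl Ps (es _ Ps) => v vl.
  case: pselect => // H; apply: el => //; exact: (projT2 (cid H)).
suff tot v : exists a, G (v, a).
  have [e He] := choice tot; exists e => P SP.
  have [|e' e'G e'P] := Ggood [:: P]; first by move=> Q [<-|].
  have <- : e' = e by apply: funext => v; exact: e'G.
  by apply: e'P; left.
apply: contrapT => /forallNP nv.
pose d (u : {u | exists a, G (u, a)}) : M := projT1 (cid (svalP u)).
have dG u : G (sval u, d u) by exact: (projT2 (cid (svalP u))).
pose A' := A `|` range d.
pose R (s : seq ((V -> M) -> Prop)) (x : 'I_1 -> M) :=
  exists e, [/\ extends e G, e v = x ord0 & forall P, List.In P s -> P e].
have RA s : (forall P, List.In P s -> S P) -> dfn A' (R s).
  move=> sS; have [l Hl] := dfn_supports (fun P Ps => SA P (sS P Ps)).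
  pose idx (u : V) : 'I_(size l).+1 := inord (index (u : {classic V}) l).
  have idxP (u : V) : List.In u l -> nth v l (idx u) = u.
    move=> /(@In_mem {classic V}) ul; rewrite /idx inordK; last by rewrite ltnS index_size.
    exact: (@nth_index {classic V}).
  (* A variable in the domain of [G] becomes a parameter, [v] stays free, and the rest of the finite
     support is quantified. The last of the [(size l).+1] slots receives variables outside the
     support. *)
  pose f (u : V) : ('I_1 + 'I_(size l).+1) + {u | exists a, G (u, a)} :=
    match pselect (exists a, G (u, a)) with
    | left H => inr (exist _ u H)
    | right _ => if pselect (u = v) then inl (inl ord0) else inl (inr (idx u)) end.
  pose Q (x : 'I_1 -> M) (y : 'I_(size l).+1 -> M) :=
    forall P, List.In P s -> P (fun u => env (env x y) d (f u)).
  apply: (@dfn_ext _ _ _ _ (fun x => exists y, Q x y)).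
    move=> x; split=> [[y Qy]|[e [eG ev eP]]].
      exists (fun u => env (env x y) d (f u)); split=> //.
        move=> u a Ga; rewrite /f; case: pselect => [H|[]]; last by exists a.
        by apply: goodf Ggood _ Ga; exact: (dG (exist _ u H)).
      rewrite /f; case: pselect => [[a Ga]|_]; first by case: (nv a).
      by case: pselect.
    exists (fun i => e (nth v l i)) => P Ps; apply: Hl Ps (eP _ Ps) => u ul.
    rewrite /f; case: pselect => [H|H] /=.
      by apply: eG; exact: (dG (exist _ u H)).
    by case: pselect => /= [->//|_]; rewrite idxP.
  apply: dfn_ex.
  have : dfn A' (fun w : ('I_1 + 'I_(size l).+1) + {u | exists a, G (u, a)} -> M =>
      forall P, List.In P s -> P (fun u => w (f u))).
    apply: dfn_In => P Ps; apply: dfn_ren.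
    by apply: dfn_mono (SA _ (sS _ Ps)) => a; left.
  move=> /(dfn_subst (d := d)) H; apply: dfn_ext (H _) => [e|u]; last by right; exists u.
  rewrite /Q; suff -> : (fun u => env e d (f u)) =
    (fun u => env (env (fun v0 => e (inl v0)) (fun y => e (inr y))) d (f u)) by [].
  by apply: funext => u; case: (f u) => [[]|].
have [|P [s sS <-]|s sS|x Hx] := @realize 1 A'
   [set P | exists2 s, (forall P, List.In P s -> S P) & R s = P].
- apply: small_setU => //; apply: small_range => //.
  by apply: sm_le sV; exact: leT_sig.
- exact: RA.
- have [t tS tR] : exists2 t, (forall P, List.In P t -> S P) &
     forall P, List.In P s -> forall x, R t x -> P x.
    elim: s sS => [|P s IH] sS; first by exists [::].
    have [|t tS tR] := IH; first by move=> Q Qs; apply: sS; right.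
    have [t' t'S E] := sS P (or_introl erefl).
    exists (t' ++ t) => [Q /In_cat[/t'S|/tS]//|Q [<-|Qs] x [e [eG ev eP]]].
      by rewrite -E; exists e; split=> // Q' Q't; apply: eP; apply/In_cat; left.
    apply: tR Qs _ _; exists e; split=> // Q' Q't; apply: eP; apply/In_cat; by right.
  have [e eG eP] := Ggood t tS.
  by exists (fun=> e v) => P Ps; apply: tR Ps _ _; exists e.
case: (Gmax (G `|` [set (v, x ord0)])).
  split; first by left.
  by move=> /(_ (v, x ord0) (or_intror erefl)); exact: nv.
move=> s sS; have [|e [eG ev eP]] := Hx (R s); first by exists s.
exists e => // u a [/eG//|[-> ->]]; exact: ev.
Qed.

(** Realizes a filter while omitting an ideal. Closure under conjunction and disjunction reduces
    finite satisfiability to one member of each. *)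
Lemma compactness_avoid V (A : set M) (S N : set ((V -> M) -> Prop)) :
  smT K V -> small K A -> (forall P, S P -> dfn A P) -> (forall P, N P -> dfn A P) ->
  (exists P, S P) -> (exists P, N P) ->
  (forall P Q, S P -> S Q -> S (fun e => P e /\ Q e)) ->
  (forall P Q, N P -> N Q -> N (fun e => P e \/ Q e)) ->
  (forall P Q, S P -> N Q -> exists e, P e /\ ~ Q e) ->
  exists e, (forall P, S P -> P e) /\ (forall Q, N Q -> ~ Q e).
Proof.
move=> sV sA SA NA [P0 SP0] [Q0 NQ0] SI NU H.
have [P|s sS|e He] := @compactness V A (S `|` [set R | exists2 Q, N Q & R = (fun e => ~ Q e)]) sV sA.
- by move=> [/SA//|[Q /NA ? ->]]; exact: dfn_not.
- have [P [Q [SP NQ PQ]]] : exists P Q, [/\ S P, N Q & forall e, P e -> ~ Q e ->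
     forall R, List.In R s -> R e].
    elim: s sS => [|R s IH] sS; first by exists P0, Q0.
    have [|P [Q [SP NQ PQ]]] := IH; first by move=> Q Qs; apply: sS; right.
    have [SR|[Q' NQ' E]] := sS R (or_introl erefl).
      exists (fun e => R e /\ P e), Q; split=> //; first exact: SI.
      by move=> e [Re Pe] nQ R' [<-//|]; exact: PQ.
    exists P, (fun e => Q' e \/ Q e); split=> //; first exact: NU.
    move=> e Pe /not_orP[nQ' nQ] R' [<-|]; first by rewrite E.
    exact: PQ.
  have [e [Pe nQ]] := H P Q SP NQ.
  by exists e; exact: PQ.
- exists e; split=> [P SP|Q NQ]; first by apply: He; left.
  by apply: (He (fun e => ~ Q e)); right; exists Q.
Qed.
End Monster.

(** * Types, finite satisfiability and dividing *)

Section Types.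
Variables (L : language) (M : structure L).
Implicit Types A B C D : set M.

Definition eqv A V (e e' : V -> M) := forall P, dfn A P -> P e -> P e'.

(* [fs A B C]: the type of [C] over [B] is finitely satisfiable in [A]. *)
Definition fs A B C := forall V (e : V -> M) (P : (V -> M) -> Prop),
  (forall v, C (e v)) -> dfn B P -> P e -> exists2 a, (forall v, A (a v)) & P a.

(** The Tarski-Vaught test: [A] is the universe of an elementary substructure. *)
Definition model_set A := fs A A setT.

Lemma eqv_refl A V (e : V -> M) : eqv A e e.
Proof. by []. Qed.

Lemma eqv_iff A V (e e' : V -> M) P : eqv A e e' -> dfn A P -> (P e <-> P e').
Proof.
move=> E HP; split; first exact: E.
by move=> Pe'; apply: contrapT => /(E _ (dfn_not HP)).
Qed.

Lemma eqv_sym A V (e e' : V -> M) : eqv A e e' -> eqv A e' e.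
Proof. by move=> E P HP; apply: (eqv_iff E HP).2. Qed.

Lemma eqv_trans A V (e e' e'' : V -> M) : eqv A e e' -> eqv A e' e'' -> eqv A e e''.
Proof. by move=> E E' P HP /(E _ HP); exact: E'. Qed.

Lemma eqv_mono A B V (e e' : V -> M) : A `<=` B -> eqv B e e' -> eqv A e e'.
Proof. by move=> AB E P /(dfn_mono AB); exact: E. Qed.

Lemma eqv_ren A V W (f : W -> V) (e e' : V -> M) : eqv A e e' ->
  eqv A (fun w => e (f w)) (fun w => e' (f w)).
Proof. by move=> E P /(dfn_ren f); exact: E. Qed.

Lemma eqv_eq A V (e e' : V -> M) v a : eqv A e e' -> A a -> e v = a -> e' v = a.
Proof. by move=> E Aa; apply: (E (fun e => e v = a)); exact: dfn_eqa. Qed.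

Lemma dfn_subst_l A V W (P : (V + W -> M) -> Prop) (d : V -> M) :
  dfn A P -> (forall w, A (d w)) -> dfn A (fun e : W -> M => P (env d e)).
Proof.
move=> HP Ad.
have := dfn_subst (d := d)
  (dfn_ren (fun u => match u with inl v => inr v | inr w => inl w end) HP) Ad.
apply: dfn_ext => e; set e1 := (X in P X <-> _); suff -> : e1 = env d e by [].
by apply: funext => -[].
Qed.

Lemma fs_range A B V (c : V -> M) :
  (forall P, dfn B P -> P c -> exists2 a, (forall v, A (a v)) & P a) ->
  fs A B (range c).
Proof.
move=> H W e P cE HP Pe.
have {cE}/choice[f fE] : forall w, exists v, c v = e w by move=> w; have [v _ E] := cE w; exists v.
have [|a Aa Pa] := H _ (dfn_ren f HP).
  by congr P: Pe; apply: funext => w.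
by exists (fun w => a (f w)).
Qed.

Lemma fs_mono A B C B' C' : B' `<=` B -> C' `<=` C -> fs A B C -> fs A B' C'.
Proof.
move=> BB CC H V e P eC HP; apply: H; first by move=> v; exact: CC.
exact: dfn_mono HP.
Qed.

(** The coordinates outside [C] are moved into [A] first, with those in [C] as parameters; then the
    coordinates in [C] are moved, with the new points of [A] as parameters, which [A <= B]
    allows. *)
Lemma fs_trans A B C D : A `<=` B ->
  fs A B C -> fs A (B `|` C) D -> fs A B (C `|` D).
Proof.
move=> AB HC HD V e P eCD HP Pe.
pose V1 := {v | C (e v)}; pose V2 := {v | ~ C (e v)}.
pose h v : V2 + V1 := match pselect (C (e v)) with
  | left H => inr (exist _ v H) | right H => inl (exist _ v H) end.
pose e1 (v : V1) := e (sval v); pose e2 (v : V2) := e (sval v).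
have he : (fun v => env e2 e1 (h v)) = e.
  by apply: funext => v; rewrite /h; case: pselect.
have HPh := dfn_ren h HP.
have [|||a2 Aa2 Pa2] := HD V2 e2 (fun d => P (fun v => env d e1 (h v))).
- by move=> [v nC]; rewrite /e2 /=; case: (eCD v).
- by apply: (dfn_subst (dfn_mono _ HPh)) => [x Bx|[v Cv]]; [left|right].
- by rewrite he.
have [|||a1 Aa1 Pa1] := HC V1 e1 (fun d => P (fun v => env a2 d (h v))).
- by move=> [v Cv].
- by apply: (dfn_subst_l HPh) => v; exact: AB.
- by [].
by exists (fun v => env a2 a1 (h v)) => // v; case: (h v).
Qed.

(** Coheirs are invariant: if [c] separated [e] from [e'], finite satisfiability would give a tuple
    of [A] separating them, against [eqv A e e']. *)
Lemma fs_inv A B C V W (e e' : V -> M) (c : W -> M) : fs A B C -> A `<=` B ->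
  (forall v, B (e v)) -> (forall v, B (e' v)) -> (forall w, C (c w)) ->
  eqv A e e' -> eqv A (env e c) (env e' c).
Proof.
move=> H AB Be Be' Cc E P HP Pe; apply: contrapT => nPe.
have HPB := dfn_mono AB HP.
have [||a Aa [Pa nPa]] := H W c (fun y => P (env e y) /\ ~ P (env e' y)) Cc.
- by apply: dfn_and; [|apply: dfn_not]; exact: dfn_subst_l.
- by [].
- exact/nPa/(E _ (dfn_subst HP Aa)).
Qed.

(** * Inconsistent rows and finitary dividing *)

Section Dividing.
Variables X W : finType.
Implicit Types (R : (X -> M) -> (W -> M) -> Prop) (P Q : (W -> M) -> Prop).

Definition row k R l (y : nat -> W -> M) := forall s : seq nat, uniq s ->
  size s = k -> (forall i, i \in s -> i < l) -> ~ exists x, forall i, i \in s -> R x (y i).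

Definition hasrow k R l P := exists2 y, (forall i, i < l -> P (y i)) & row k R l y.

(* Finitary form of "[R(x, b)] divides over [B]": every [B]-definable set
   containing [b] contains arbitrarily long [k]-inconsistent rows. *)
Definition fdiv k R B (b : W -> M) :=
  forall P, dfn B P -> P b -> forall l, hasrow k R l P.

Lemma row_sub k R l l' y (h : nat -> nat) : row k R l y ->
  (forall i, i < l' -> h i < l) ->
  (forall i j, i < l' -> j < l' -> h i = h j -> i = j) ->
  row k R l' (fun i => y (h i)).
Proof.
move=> Hy hl hinj s us ss sl [x Hx]; apply: (Hy [seq h i | i <- s]).
- by rewrite map_inj_in_uniq // => i j /sl ? /sl ?; exact: hinj.
- by rewrite size_map.
- by move=> i /mapP[j /sl/hl ? ->].
- by exists x => i /mapP[j js ->]; exact: Hx.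
Qed.

Lemma hasrow_sub k R l P (s : seq nat) y l' : row k R l' y -> uniq s ->
  (forall i, i \in s -> i < l' /\ P (y i)) -> l <= size s -> hasrow k R l P.
Proof.
move=> Hy us sP ls; exists (fun i => y (nth 0 s i)).
  by move=> i il; apply: (sP _ _).2; apply: mem_nth; exact: leq_trans il ls.
apply: row_sub Hy _ _ => [i il|i j il jl /eqP].
  by apply: (sP _ _).1; apply: mem_nth; exact: leq_trans il ls.
by rewrite nth_uniq ?(leq_trans _ ls) // => /eqP.
Qed.

(** Pigeonhole on the entries of a row. This is why the sets bounding the length of their rows form
    an ideal. *)
Lemma hasrow_or k R l1 l2 P Q : hasrow k R (l1 + l2) (fun y => P y \/ Q y) ->
  hasrow k R l1 P \/ hasrow k R l2 Q.
Proof.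
move=> [y yPQ Hy].
pose a i := `[< P (y i) >].
have us : uniq (iota 0 (l1 + l2)) := iota_uniq _ _.
have [le1|lt1] := leqP l1 (count a (iota 0 (l1 + l2))).
  left; apply: (hasrow_sub (s := [seq i <- iota 0 (l1 + l2) | a i]) Hy).
  - exact: filter_uniq.
  - by move=> i; rewrite mem_filter mem_iota add0n => /andP[/asboolP ? /andP[]].
  - by rewrite size_filter.
right; apply: (hasrow_sub (s := [seq i <- iota 0 (l1 + l2) | ~~ a i]) Hy).
- exact: filter_uniq.
- move=> i; rewrite mem_filter mem_iota add0n => /andP[/asboolPn nP /andP[_ il]].
  by split=> //; case: (yPQ i il).
- rewrite size_filter; have := count_predC a (iota 0 (l1 + l2)).
  rewrite size_iota -/(predC a) => E.
  by rewrite -(leq_add2l (count a (iota 0 (l1 + l2)))) E leq_add2r ltnW.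
Qed.

Lemma hasrow_mono k R l l' P Q : l <= l' -> (forall y, P y -> Q y) ->
  hasrow k R l' P -> hasrow k R l Q.
Proof.
move=> ll PQ [y yP Hy]; exists y => [i il|s us ss sl].
  by apply/PQ/yP; exact: leq_trans ll.
by apply: Hy => // i /sl il; exact: leq_trans ll.
Qed.

Lemma fdiv_eqv k R A b b' : eqv A b b' -> fdiv k R A b -> fdiv k R A b'.
Proof. by move=> /eqv_sym E H P HP /(E _ HP); exact: H. Qed.

(** Only the finitely many duplicate-free [k]-tuples of indices below [l] have to be tested. *)
Lemma row_dfn A k R l V (y : nat -> W -> V) : dfn2 A R ->
  dfn A (fun e : V -> M => row k R l (fun i w => e (y i w))).
Proof.
move=> HR.
pose C := [seq s <- [seq map val t | t : k.-tuple 'I_l] | uniq s].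
apply: (@dfn_ext _ _ _ _ (fun e => forall s, s \in C ->
    ~ exists x : X -> M, forall i, i \in s -> R x (fun w => e (y i w)))).
  move=> e; split=> [H s us ss sl|H s].
    apply: H; rewrite mem_filter us /=.
    have E : map val (pmap insub s : seq 'I_l) = s.
      rewrite (pmap_filter (insubK _)); apply/all_filterP/allP => i /sl il.
      by rewrite /= (insubT (fun i => i < l) il).
    have sz : size (pmap insub s : seq 'I_l) == k by rewrite -(size_map val) E ss.
    by apply/mapP; exists (Tuple sz); rewrite ?mem_enum //= E.
  rewrite mem_filter => /andP[us /mapP[t _ st]]; apply: H => //.
    by rewrite st size_map size_tuple.
  by move=> i; rewrite st => /mapP[j _ ->]; exact: ltn_ord.
apply: dfn_mem => s _; apply/dfn_not/dfn_ex/dfn_mem => i _.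
exact: (dfn_binary (fun x => inr x) (fun w => inl (y i w)) HR).
Qed.

Lemma hasrow_dfn A k R l V (P : (V -> M) -> (W -> M) -> Prop) : dfn2 A R -> dfn2 A P ->
  dfn A (fun e => hasrow k R l (P e)).
Proof.
move=> HR HP.
have [a0] := carrier_inhabited M.
apply: (@dfn_ext _ _ _ _ (fun e => exists y : 'I_l * W -> M,
  (forall i : 'I_l, P e (fun w => y (i, w))) /\
  row k R l (fun i w => if insub i is Some j then y (j, w) else a0))).
  move=> e; split=> [[y [Py Hy]]|[y Py Hy]].
    exists (fun i w => if insub i is Some j then y (j, w) else a0) => //.
    by move=> i il; rewrite (insubT (fun i => i < l) il) /=; exact: Py.
  exists (fun p : 'I_l * W => y (val p.1) p.2); split=> [i|s us ss sl [x Hx]].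
    by apply: Py; exact: ltn_ord.
  apply: (Hy s us ss sl); exists x => i si; have := Hx i si.
  by rewrite (insubT (fun i => i < l) (sl i si)).
(* With [l = 0] there is no index to serve as default. The only list to test is then the empty one,
   so the row condition says [0 < k]. *)
have [l0|l0] := posnP l.
  subst l; apply: dfn_ex; apply: dfn_and; first by apply: dfn_fin => -[].
  apply: dfn_ext (dfn_const _ _ (0 < k)) => u; split=> [k0 s us ss sl|H].
    by case: s us ss sl k0 => [|i s] _ /= <- // sl; have := sl i (mem_head _ _).
  rewrite lt0n; apply/eqP => k0; apply: (H [::]) => //.
  by exists (fun=> a0).
apply: dfn_ex; apply: dfn_and.
  apply: dfn_fin => i.
  exact: (dfn_binary (fun v => inl v) (fun w => inr (i, w)) HP).
have := row_dfn k l (fun i w => (inr (insubd (Ordinal l0) i, w)) : V + 'I_l * W) HR.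
apply: dfn_ext => u; split=> H s us ss sl [x Hx]; apply: (H s us ss sl); exists x => i si;
  by have := Hx i si; rewrite /insubd (insubT (fun i => i < l) (sl i si)).
Qed.

End Dividing.

(** * Automorphisms fixing a set pointwise *)

Definition aut A (g : M -> M) := automorphism g /\ forall a, A a -> g a = a.

Lemma eval_aut (g : M -> M) V (t : term L V) (e : V -> M) : automorphism g ->
  eval (fun v => g (e v)) t = g (eval e t).
Proof.
move=> [_ gf _]; elim: t => [v|f ts IH] //=.
by rewrite gf; congr finterp; apply: funext => i.
Qed.

Lemma sat_aut (g : M -> M) V (phi : formula L V) (e : V -> M) : automorphism g ->
  (sat phi e <-> sat phi (fun v => g (e v))).
Proof.
move=> ag; elim: phi e => {V}[V t u|V r ts|V psi IH|V psi IH1 chi IH2|V psi IH] e /=.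
- rewrite !eval_aut //; split=> [->//|]; apply: bij_inj; by case: ag.
- case: (ag) => _ _ gr; rewrite gr.
  suff -> : (fun i => eval (fun v => g (e v)) (ts i)) = (fun i => g (eval e (ts i))) by [].
  by apply: funext => i; rewrite eval_aut.
- by rewrite IH.
- by rewrite IH1 IH2.
- have E a : extend (fun v => g (e v)) (g a) = (fun v => g (extend e a v)).
    by apply: funext => -[].
  split=> -[a Ha]; first by exists (g a); rewrite E -IH.
  have [g' gK g'K] : bijective g by case: ag.
  by exists (g' a); apply/IH; rewrite -E g'K.
Qed.

Lemma aut_dfn A g V (P : (V -> M) -> Prop) (e : V -> M) : aut A g -> dfn A P ->
  (P e <-> P (fun v => g (e v))).
Proof.
move=> [ag gA] [phi H]; rewrite !H (sat_aut phi (env e (@elt _ _ A)) ag).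
suff -> : (fun v => g (env e (@elt _ _ A) v)) = env (fun v => g (e v)) (@elt _ _ A) by [].
by apply: funext => -[v|[a Aa]] //=; exact: gA.
Qed.

Lemma aut_eqv A g V (e : V -> M) : aut A g -> eqv A e (fun v => g (e v)).
Proof. by move=> ag P HP Pe; apply/(aut_dfn e ag HP). Qed.

Lemma aut_inv A g : aut A g -> exists g', [/\ aut A g', cancel g g' & cancel g' g].
Proof.
move=> [[[g' gK g'K] gf gr] gA]; exists g'; split=> //; split; last first.
  by move=> a Aa; rewrite -[in LHS](gA a Aa) gK.
split; first by exists g.
- move=> f a; rewrite -[RHS]gK gf; congr (g' (finterp _)).
  by apply: funext => i; rewrite g'K.
- move=> r a; rewrite (gr r (fun i => g' (a i))).
  suff -> : (fun i => g (g' (a i))) = a by [].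
  by apply: funext => i; rewrite g'K.
Qed.

End Types.

Arguments fs {L M} A B C.

(** * Conjugacy, coheir extensions and small models in the monster *)

Section MonsterTypes.
Variables (L : language) (K : Type) (M : structure L).
Hypothesis mon : monster K M.
Implicit Types A B C D : set M.

Let slK : strong_limit K. Proof. by case: mon. Qed.
Let natK : small K [set: nat]. Proof. by case: mon => _ []. Qed.
Let smT_fsym : smT K (Defs.fsym L).
Proof. by case: mon => _ [_ H _] _ _; apply/small_setT. Qed.
Let smT_rsym : smT K (rsym L).
Proof. by case: mon => _ [_ _ H] _ _; apply/small_setT. Qed.

(** Strong homogeneity concerns maps on subsets of [M]. The map sending [e] to [e'] and fixing [A]
    is well defined because equalities between entries, or with points of [A], belong to the type
    over [A]. *)
Lemma homogeneity A V (e e' : V -> M) : small K A -> smT K V -> eqv A e e' ->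
  exists2 g, aut A g & forall v, g (e v) = e' v.
Proof.
move=> sA sV E.
have hom : strongly_homogeneous K M by case: mon.
pose h (x : M) : M := if pselect (exists v, e v = x) is left H then e' (projT1 (cid H)) else x.
have he v : h (e v) = e' v.
  rewrite /h; case: pselect => [H|[]]; last by exists v.
  case: (cid H) => w /= wv.
  exact: (E _ (dfn_eq A w v)).
have hA a : A a -> h a = a.
  move=> Aa; rewrite /h; case: pselect => // H; case: (cid H) => v /= va.
  exact: eqv_eq E Aa va.
have [|k phi a aA|g ag gh] := hom (A `|` range e) h.
- by apply: small_setU => //; exact: small_range.
- have H i : exists u : V + {x | A x}, a i = env e (@elt _ _ A) u.
    by case: (aA i) => [Ai|[v _ <-]]; [exists (inr (exist _ (a i) Ai))|exists (inl v)].
  have [f fE] := choice H.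
  have H1 : a = fun i => env e (@elt _ _ A) (f i) by exact: funext.
  have H2 : (fun i => h (a i)) = fun i => env e' (@elt _ _ A) (f i).
    apply: funext => i; rewrite H1; case: (f i) => [v|[x Ax]] /=; first exact: he.
    exact: hA.
  rewrite H2 H1 -!sat_fren.
  by apply: (eqv_iff (P := fun e => sat (fren f phi) (env e (@elt _ _ A))) E);
     exists (fren f phi).
exists g; last by move=> v; rewrite gh ?he //; right; exists v.
by split=> // a Aa; rewrite gh ?hA //; left.
Qed.

(** The ideal to omit consists of the definable sets over [B0] and [B] without points in [A]; no set
    in the type of [c] over [B0] lies in it, by the hypothesis on [c]. *)
Lemma coheir_extension A B0 B V (c : V -> M) : smT K V -> small K B0 -> small K B ->
  fs A B0 (range c) ->
  exists2 c', eqv B0 c c' & fs A (B0 `|` B) (range c').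
Proof.
move=> sV sB0 sB H.
have [|P [hP _]|P []|||||P Q [HP Pc] [HQ nQ]|c' [H1 H2]] :=
  @compactness_avoid L K M mon V (B0 `|` B) [set P | dfn B0 P /\ P c]
  [set P | dfn (B0 `|` B) P /\ forall a, (forall v, A (a v)) -> ~ P a] sV.
- exact: small_setU.
- by apply: dfn_mono hP => x; left.
- by [].
- by exists (fun=> True); split; [exact: dfn_true|by []].
- by exists (fun=> False); split; [exact: dfn_false|move=> a _ []].
- by move=> P Q [? ?] [? ?]; split=> //; exact: dfn_and.
- move=> P Q [? nP] [? nQ]; split; first exact: dfn_or.
  by move=> a Aa [|]; [exact: nP|exact: nQ].
- have [|a Aa Pa] := H V c P _ HP Pc; first by move=> v; exists v.
  by exists a; split=> //; exact: nQ.
exists c'; first by move=> P HP Pc; exact: H1.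
apply: fs_range => P HP Pc'; apply: contrapT => nP; apply: (H2 P _ Pc').
by split=> // a Aa Pa; apply: nP; exists a.
Qed.

(* Close off under choice functions for types over [range iota] and finitely
   many elements. *)
Lemma closure J (iota : J -> M) (C : set M) : smT K J -> small K C ->
  exists A, [/\ small K A, C `<=` A, range iota `<=` A, model_set A &
    forall (m : nat -> M) l (a : 'I_l -> M), (forall i, A (a i)) ->
      exists2 m', (forall i, A (m' i)) & eqv (range iota) (env m a) (env m' a)].
Proof.
move=> sJ sC.
have [d] := carrier_inhabited M.
pose F := formula L (nat + nat + J).
pose th (m a : nat -> M) : set F := [set phi | sat phi (env (env m a) iota)].
pose O := (set F * nat)%type.
(* One Skolem-like operation for each complete theory [o.1] and each coordinate [o.2] of a sequence
   realizing it over the list [s]. A theory is a set of formulas in the variables of the sequence,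
   of the list and of [iota]. *)
pose op (o : O) (s : seq M) : M :=
  if pselect (exists m, th m (nth d s) = o.1) is left H
  then projT1 (cid H) o.2 else d.
pose Lab := ({x | C x} + J + O)%type.
pose fix ev (t : GenTree.tree Lab) : M := match t with
  | GenTree.Leaf (inl (inl x)) => sval x
  | GenTree.Leaf (inl (inr j)) => iota j
  | GenTree.Leaf (inr _) => d
  | GenTree.Node _ ts =>
      if ts is GenTree.Leaf (inr o) :: _ then op o (behead (map ev ts)) else d
  end.
pose A := range ev.
have sn := sm_nat natK.
have sO : smT K O.
  apply: sm_prod => //; apply: sm_set => //; apply: sm_formula => //.
  by apply: sm_sum => //; apply: sm_sum.
have sA : small K A.
  apply: small_range => //; apply: sm_tree => //; apply: sm_sum => //.
  by apply: sm_sum => //; apply/small_smT.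
have Ad : A d by exists (GenTree.Node 0 [::]).
have Aop o s : (forall x, List.In x s -> A x) -> A (op o s).
  move=> sA'; have [ts E] : exists ts, map ev ts = s.
    elim: s sA' => [|x s IH] H; first by exists [::].
    have [|ts <-] := IH; first by move=> y ys; apply: H; right.
    by have [t _ <-] := H x (or_introl erefl); exists (t :: ts).
  by exists (GenTree.Node 0 (GenTree.Leaf (inr o) :: ts)) => //=; rewrite E.
have sat_A (m : nat -> M) l (a : 'I_l -> M) : (forall i, A (a i)) ->
      exists2 m', (forall i, A (m' i)) & eqv (range iota) (env m a) (env m' a).
  move=> Aa; pose s := [seq a i | i <- enum 'I_l].
  have as_ i : a i = nth d s i.
    by rewrite (nth_map i) ?size_enum_ord // nth_ord_enum.
  have H : exists m0, th m0 (nth d s) = th m (nth d s) by exists m.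
  exists (fun j => op (th m (nth d s), j) s).
    move=> j; apply: Aop => x; rewrite /s; elim: (enum _) => //= i r IH [<-//|]; exact: IH.
  rewrite /op /=; case: pselect => // H'; case: (cid H') => m' /= Hm'.
  move=> P [phi Hphi].
  have H1 (x : {x | range iota x}) : exists j, iota j = sval x.
    by case: x => x [j jT E]; exists j.
  have [f fE] := choice H1.
  pose h (u : nat + 'I_l + {x | range iota x}) : nat + nat + J := match u with
    | inl (inl i) => inl (inl i) | inl (inr i) => inl (inr (val i)) | inr x => inr (f x) end.
  have E m1 : P (env m1 a) <-> th m1 (nth d s) (fren h phi).
    rewrite Hphi /th /= sat_fren; set e1 := (X in sat _ X <-> _); set e2 := (X in _ <-> sat _ X).
    suff -> : e1 = e2 by [].
    by apply: funext => -[[i|i]|x]; rewrite /e1 /e2 /h /= ?as_ ?fE.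
  by rewrite !E Hm'.
exists A; split=> //.
- by move=> x Cx; exists (GenTree.Leaf (inl (inl (exist _ x Cx)))).
- by move=> _ [j _ <-]; exists (GenTree.Leaf (inl (inr j))).
(* Tarski-Vaught follows from the realization property: [e] enters as the sequence of its values on
   the finite support of [P], and the parameters of [P] as the tuple [a]. *)
- move=> V e P _ HP Pe.
  have [l Hl] := dfn_support HP.
  have [k [a [phi [Aa Hphi]]]] := dfn_formula HP.
  have [[v0]|nV] := pselect (inhabited V); last by exists e => // v; case: nV.
  pose m i := e (nth v0 l i).
  have [m' Am' Em] := sat_A m k a Aa.
  pose ix (v : V) := index (v : {classic V}) l.
  have ixP v : List.In v l -> nth v0 l (ix v) = v.
    by move=> /(@In_mem {classic V}) vl; exact: (@nth_index {classic V}).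
  exists (fun v => m' (ix v)) => //; apply/Hphi.
  pose h (u : V + 'I_k) : nat + 'I_k := match u with inl v => inl (ix v) | inr i => inr i end.
  have E m1 : sat phi (env (fun v => m1 (ix v)) a) <-> sat (fren h phi) (env m1 a).
    rewrite sat_fren; set e1 := (X in sat _ X <-> _); set e2 := (X in _ <-> sat _ X).
    by suff -> : e1 = e2 by []; apply: funext => -[].
  apply/E; apply: Em; first exact: formula_dfn.
  apply/E/Hphi; apply: (Hl e _ _).1 Pe => v vl.
  by rewrite /m ixP.
Qed.

End MonsterTypes.

(** * Arrays *)

Section Ramsey.

Definition nonprincipal (U : set (set nat)) := ultra U /\ forall i, U [set j | i < j].

Lemma nonprincipal_exists : exists U, nonprincipal U.
Proof.
have [s sF|U UU HU] := @ultra_exists nat [set A | exists i, A = [set j | i < j]].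
  suff [N HN] : exists N, forall A, List.In A s -> A N by exists N.
  suff [N HN] : exists N, forall A, List.In A s -> forall j, N <= j -> A j.
    by exists N => A As; exact: HN.
  elim: s sF => [|A s IH] sF; first by exists 0.
  have [|N HN] := IH; first by move=> B Bs; apply: sF; right.
  have [i ->] := sF A (or_introl erefl).
  exists (maxn i.+1 N) => B [<-|Bs] j; rewrite geq_max => /andP[// ? ?]; exact: HN.
by exists U; split=> // i; apply: HU; exists i.
Qed.

Variable U : set (set nat).
Hypothesis nU : nonprincipal U.
Let UU : ultra U := nU.1.

(** Each new term comes from a [U]-large set: above all earlier terms, an [F]-successor of each of
    them, and itself having [U]-many [F]-successors. *)
Lemma ultra_greedy (F : nat -> nat -> Prop) m : U [set i | U [set j | F i j]] ->
  exists h : nat -> nat, forall i j, i < j -> j < m -> h i < h j /\ F (h i) (h j).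
Proof.
move=> UF.
suff [h [H1 H2]] : exists h : nat -> nat, (forall i, i < m -> U [set j | F (h i) j]) /\
    forall i j, i < j -> j < m -> h i < h j /\ F (h i) (h j) by exists h.
elim: m => [|m [h [H1 H2]]]; first by exists id.
have [j [Fj [hj Uj]]] : exists j, (forall i : 'I_m, F (h i) j) /\
    (forall i : 'I_m, h i < j) /\ U [set l | F j l].
  apply: (ultra_ex UU); apply: (ultraI UU (A := fun j => forall i : 'I_m, F (h i) j)).
    by apply: (ultra_fin UU) => i; exact: H1.
  apply: (ultraI UU (A := fun j => forall i : 'I_m, h i < j)) UF.
  by apply: (ultra_fin UU) => i; exact: nU.2.
exists (fun i => if i < m then h i else j); split=> [i|i l il].
  by rewrite ltnS leq_eqVlt => /orP[/eqP->|im]; [rewrite ltnn|rewrite im; exact: H1].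
rewrite ltnS leq_eqVlt => /orP[/eqP E|lm].
  by subst l; rewrite il ltnn; split; [exact: (hj (Ordinal il))|exact: (Fj (Ordinal il))].
by rewrite lm (ltn_trans il lm); exact: H2.
Qed.

Definition depends T (E : (nat -> nat * nat) -> Prop) :=
  forall p p', (forall t, t < T -> p t = p' t) -> E p -> E p'.

Definition valid T m (p : nat -> nat * nat) :=
  forall t, t < T -> (p t).1 < (p t).2 /\ (p t).2 < m.

Definition along (g : nat -> nat -> nat) (p : nat -> nat * nat) t :=
  (g t (p t).1, g t (p t).2).

Definition scons I (c : I) (p : nat -> I) t := if t is t'.+1 then p t' else c.

(** Up to what [depends] can see there are only finitely many valid choices of pairs, so the
    quantifier over them commutes with [U]. *)
Lemma ultra_valid T m (g : nat -> nat -> nat) (Q : (nat -> nat * nat) -> Prop) :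
  depends T.+1 Q ->
  (forall p, valid T m p -> U [set i | U [set j | Q (scons (i, j) (along g p))]]) ->
  U [set i | U [set j | forall p, valid T m p -> Q (scons (i, j) (along g p))]].
Proof.
move=> dQ H.
pose ext (q : {ffun 'I_T -> 'I_m.+1 * 'I_m.+1}) t : nat * nat :=
  if insub t is Some i then (val (q i).1, val (q i).2) else (0, 0).
have H' (q : {ffun 'I_T -> 'I_m.+1 * 'I_m.+1}) :
    U [set i | U [set j | valid T m (ext q) -> Q (scons (i, j) (along g (ext q)))]].
  have [v|nv] := pselect (valid T m (ext q)).
    by apply: (ultraS UU) (H _ v) => i; apply: (ultraS UU) => j Qj _.
  by apply: (ultraS UU) (ultraT UU) => i _; apply: (ultraS UU) (ultraT UU) => j _ /nv.
apply: (ultraS UU) (ultra_fin UU H') => i Hi.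
apply: (ultraS UU) (ultra_fin UU Hi) => j Hj p vp.
pose q : {ffun 'I_T -> 'I_m.+1 * 'I_m.+1} := [ffun t : 'I_T => (inord (p t).1, inord (p t).2)].
have Eq t : t < T -> ext q t = p t.
  move=> tT; rewrite /ext (insubT (fun t => t < T) tT) ffunE /=.
  have [p12 p2] := vp t tT.
  rewrite !inordK ?ltnS; [by case: (p t)|exact: ltnW|].
  exact: ltnW (ltn_trans p12 p2).
apply: dQ (Hj q _) => [[|t]|t] tT //; last by rewrite Eq //; exact: vp.
by rewrite /= /along Eq.
Qed.

(** Induction on the number of rows. Row 0 is first integrated out by the ultrafilter, giving the
    colouring [E'] of the other rows; once these are homogeneous for [E'], the greedy lemma chooses
    the columns of row 0. *)
Lemma product_ramsey T m (E : (nat -> nat * nat) -> Prop) : depends T E ->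
  exists g : nat -> nat -> nat,
    (forall t i j, t < T -> i < j -> j < m -> g t i < g t j) /\
    ((forall p, valid T m p -> E (along g p)) \/
     (forall p, valid T m p -> ~ E (along g p))).
Proof.
elim: T E => [|T IH] E dE.
  exists (fun=> id); split=> //.
  have [e|ne] := pselect (E (fun=> (0, 0))); [left|right] => p _; first exact: dE e.
  by apply: contra_not ne; exact: dE.
pose E' p := U [set i | U [set j | E (scons (i, j) p)]].
have [g [gm Hg]] : exists g : nat -> nat -> nat,
    (forall t i j, t < T -> i < j -> j < m -> g t i < g t j) /\
    ((forall p, valid T m p -> E' (along g p)) \/
     (forall p, valid T m p -> ~ E' (along g p))).
  apply: IH => p p' pp; apply: (ultraS UU) => i; apply: (ultraS UU) => j.
  by apply: dE => -[|t] //= /pp.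
have step Q : depends T.+1 Q -> (forall p, valid T m p ->
     U [set i | U [set j | Q (scons (i, j) (along g p))]]) ->
   exists h : nat -> nat, (forall i j, i < j -> j < m -> h i < h j) /\
     forall p, valid T.+1 m p -> Q (along (scons h g) p).
  move=> dQ /(ultra_valid dQ) /ultra_greedy - /(_ m) [h Hh].
  exists h; split=> [i j ij jm|p vp]; first by have [] := Hh i j ij jm.
  have [p01 p0m] := vp 0 (ltn0Sn _).
  have [_ /(_ (fun t => p t.+1))] := Hh _ _ p01 p0m.
  have v' : valid T m (fun t => p t.+1) by move=> t tT; exact: vp.
  by move=> /(_ v'); apply: dQ => -[|t].
have [Hp|Hn] := Hg.
  have [h [hm HE]] := step E dE Hp.
  by exists (scons h g); split; [case=> [|t] i j; [move=> _; exact: hm|exact: gm]|left].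
have [||h [hm HE]] := step (fun p => ~ E p).
- move=> p p' pp; apply: contra_not; apply: dE => t tT; by rewrite pp.
- move=> p vp; have /(ultra_not UU) := Hn p vp; apply: (ultraS UU) => i /(ultra_not UU).
  by apply: (ultraS UU).
by exists (scons h g); split; [case=> [|t] i j; [move=> _; exact: hm|exact: gm]|right].
Qed.

End Ramsey.

Section Arrays.
Variables (L : language) (K : Type) (M : structure L).
Hypothesis mon : monster K M.

Let slK : strong_limit K. Proof. by case: mon. Qed.
Let natK : small K [set: nat]. Proof. by case: mon => _ []. Qed.

Section Def.
Variables X W : finType.
Implicit Types (R : (X -> M) -> (W -> M) -> Prop).

Definition rowI k R (y : nat -> W -> M) := forall s : seq nat, uniq s ->
  size s = k -> ~ exists x, forall i, i \in s -> R x (y i).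

(* TP_2 with [k]-inconsistent instead of 2-inconsistent rows, for [T] rows of
   length [N] and for an infinite array. *)
Definition arr k R T N := exists r : nat -> nat -> W -> M,
  (forall t, t < T -> row k R N (r t)) /\
  forall f : nat -> nat, (forall t, f t < N) ->
    exists x, forall t, t < T -> R x (r t (f t)).

Definition arrI k R := exists r : nat -> nat -> W -> M,
  (forall t, rowI k R (r t)) /\
  forall (f : nat -> nat) T, exists x, forall t, t < T -> R x (r t (f t)).

Lemma rowI_row k R y : rowI k R y <-> forall l, row k R l y.
Proof.
split=> [H l s us ss _|H s us ss]; first exact: H.
apply: (H (\max_(i <- s) i).+1) => // i si.
by rewrite ltnS; apply: (@leq_bigmax_seq _ s xpredT id).
Qed.

Lemma arr_arrI A k R : small K A -> dfn2 A R -> (forall T N, arr k R T N) -> arrI k R.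
Proof.
move=> sA HR H.
pose row_ t N (e : nat * nat * W -> M) := row k R N (fun i w => e (t, i, w)).
pose path_ T (f : nat -> nat) (e : nat * nat * W -> M) :=
  exists x, forall t, t \in iota 0 T -> R x (fun w => e (t, f t, w)).
have [|P [[t [N ->]]|[T [f ->]]]|s sS|e He] := @compactness L K M mon (nat * nat * W) A
  [set P | (exists t N, P = row_ t N) \/ (exists T f, P = path_ T f)] _ sA.
- by do ?apply: sm_prod => //; try exact: sm_fin; exact: sm_nat.
- exact: (row_dfn k N (fun i w => (t, i, w)) HR).
- apply: dfn_ex; apply: dfn_mem => t _.
  exact: (dfn_binary (fun x => inr x) (fun w => inl (t, f t, w)) HR).
(* Finitely many conditions involve a bounded part of the array. [N0] is positive so that column 0
   can serve as default when a path is cut down to [N0] columns. *)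
- have [T0 [N0 [N0p HTN]]] : exists T0 N0, 0 < N0 /\ forall P, List.In P s ->
      (exists t N, [/\ P = row_ t N, t < T0 & N <= N0]) \/
      (exists T f, [/\ P = path_ T f, T <= T0 & forall t, t < T -> f t < N0]).
    elim: s sS => [|P s IH] sS; first by exists 0, 1.
    have [|T0 [N0 [N0p HTN]]] := IH; first by move=> Q Qs; apply: sS; right.
    have up T1 N1 : T0 <= T1 -> N0 <= N1 -> forall Q, List.In Q s ->
      (exists t N, [/\ Q = row_ t N, t < T1 & N <= N1]) \/
      (exists T f, [/\ Q = path_ T f, T <= T1 & forall t, t < T -> f t < N1]).
      move=> T01 N01 Q Qs; have [[t [N [-> ? ?]]]|[T [f [-> ? Hf]]]] := HTN Q Qs.
        left; exists t, N; split=> //; [exact: leq_trans T01|exact: leq_trans N01].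
      right; exists T, f; split=> //; first exact: leq_trans T01.
      by move=> t /Hf H'; exact: leq_trans N01.
    have [[t [N E]]|[T [f E]]] := sS P (or_introl erefl).
      exists (maxn T0 t.+1), (maxn N0 N); split; first by rewrite leq_max N0p.
      move=> Q [<-|Qs]; last by apply: up Qs; exact: leq_maxl.
      by left; exists t, N; split=> //; exact: leq_maxr.
    exists (maxn T0 T), (maxn N0 (\max_(t < T) f t).+1); split; first by rewrite leq_max N0p.
    move=> Q [<-|Qs]; last by apply: up Qs; exact: leq_maxl.
    right; exists T, f; split=> //; first exact: leq_maxr.
    move=> t tT; rewrite leq_max ltnS orbC; apply/orP; left.
    exact: (@leq_bigmax _ (fun t : 'I_T => f t) (Ordinal tT)).
  have [r [Hr Hf]] := H T0 N0.
  exists (fun u => r u.1.1 u.1.2 u.2) => P /HTN [[t [N [-> tT NN]]]|[T [f [-> TT fN]]]].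
    by move=> s' us ss sl; apply: Hr => // i /sl il; exact: leq_trans NN.
  have [|x Hx] := Hf (fun t => if f t < N0 then f t else 0).
    by move=> t; case: ifP.
  exists x => t; rewrite mem_iota add0n => /andP[_ tT].
  by have := Hx t (leq_trans tT TT); rewrite fN.
exists (fun t i w => e (t, i, w)); split=> [t|f T].
  by apply/rowI_row => l; apply: (He (row_ t l)); left; exists t, l.
have [|x Hx] := He (path_ T f); first by right; exists T, f.
by exists x => t tT; apply: Hx; rewrite mem_iota.
Qed.

Lemma rowI_weak k k' R y : k <= k' -> rowI k R y -> rowI k' R y.
Proof.
move=> kk H s us ss [x Hx]; apply: (H (take k s)); first exact: take_uniq.
  by rewrite size_take ss; case: ltngtP kk.
by exists x => i /mem_take; exact: Hx.
Qed.

End Def.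

Definition pair_rel X W (R : (X -> M) -> (W -> M) -> Prop) x (y : W + W -> M) :=
  R x (fun w => y (inl w)) /\ R x (fun w => y (inr w)).

Definition pow_rel T X W (R : (X -> M) -> (W -> M) -> Prop) x (y : 'I_T * W -> M) :=
  forall t, R x (fun w => y (t, w)).

(* Either pairs of consecutive entries still form an array, with a smaller
   inconsistency degree, or some fixed number of rows can be merged into one
   whose entries are pairwise inconsistent. *)
Lemma arrI_two A k (X W : finType) (R : (X -> M) -> (W -> M) -> Prop) :
  small K A -> dfn2 A R -> arrI k R ->
  exists (W' : finType) (R' : (X -> M) -> (W' -> M) -> Prop), dfn2 A R' /\ arrI 2 R'.
Proof.
move=> sA; have [n kn] := ubnP k; elim: n k kn W R => // n IH k kn W R HR HA.
have [k2|k3] := leqP k 2.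
  exists W, R; split=> //; have [r [Hr Hf]] := HA; exists r; split=> // t.
  exact: rowI_weak (Hr t).
have HR2 : dfn2 A (pair_rel R).
  apply: dfn_and.
    exact: (dfn_binary (fun x => inl x) (fun w => inr (inl w)) HR).
  exact: (dfn_binary (fun x => inl x) (fun w => inr (inr w)) HR).
have kh : uphalf k < n.
  apply: (@leq_trans k) => //; rewrite uphalf_half.
  rewrite -[X in _ < X]odd_double_half ltn_add2l -addnn -[X in X < _]addn0 ltn_add2l.
  by rewrite half_gt0 ltnW.
have [all_arr|] := pselect (forall T N, arr (uphalf k) (pair_rel R) T N).
  apply: (IH _ kh _ (pair_rel R) HR2); exact: arr_arrI sA HR2 all_arr.
move=> /existsNP[T0 /existsNP[N0 nA]].
have HR3 : dfn2 A (@pow_rel T0 X W R).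
  by apply: dfn_fin => t; exact: (dfn_binary (fun x => inl x) (fun w => inr (t, w)) HR).
exists ('I_T0 * W)%type, (@pow_rel T0 X W R); split=> //.
apply: arr_arrI sA HR3 _ => T N.
have [r [Hr Hf]] := HA.
have [U nU] := nonprincipal_exists.
(* Pairing columns [2i] and [2i+1] for [i < N0] uses [N0.*2] columns, and the merged rows need [N].
   The rows are cut into blocks of [T0]; [E b] says that one point realizes both entries of the
   given pair in every row of block [b]. *)
pose m := maxn N0.*2 N.
pose E b (p : nat -> nat * nat) := exists x, forall t, t < T0 ->
  R x (r (b * T0 + t) (p t).1) /\ R x (r (b * T0 + t) (p t).2).
have dE b : depends T0 (E b).
  by move=> p p' pp [x Hx]; exists x => t tT; rewrite -pp //; exact: Hx.
have [g Hg] := choice (fun b => product_ramsey nU m (dE b)).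
(* If [E b] held throughout the subgrid, its paired columns would form an array for [pair_rel R] of
   size [T0] by [N0], because [uphalf k] pairs occupy at least [k] columns. This is what [nA]
   excludes. *)
have gE b : forall p, valid T0 m p -> ~ E b (along (g b) p).
  have [gm [Hp|//]] := Hg b; case: nA.
  exists (fun t i => env (r (b * T0 + t) (g b t i.*2)) (r (b * T0 + t) (g b t i.*2.+1))).
  split=> [t tT s us ss sl [x Hx]|f fN].
    have ginj i j : i < m -> j < m -> g b t i = g b t j -> i = j.
      move=> im jm gij; case: (ltngtP i j) => // ij.
        by have := gm t i j tT ij jm; rewrite gij ltnn.
      by have := gm t j i tT ij im; rewrite gij ltnn.
    have sm i : i \in s -> i.*2 < m /\ i.*2.+1 < m.
      move=> /sl il; suff H : i.*2.+1 < m by split=> //; exact: ltnW.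
      by rewrite leq_max -doubleS leq_double il.
    pose s2 := [seq g b t j | j <- [seq i.*2 | i <- s] ++ [seq i.*2.+1 | i <- s]].
    have Hr' : rowI (size s2) R (r (b * T0 + t)).
      apply: rowI_weak (Hr _); rewrite size_map size_cat !size_map ss uphalfE addnn.
      by rewrite -uphalfE -{1}[k]odd_double_half uphalf_half doubleD leq_add2r; case: (odd k).
    apply: (Hr' s2) => //.
      rewrite map_inj_in_uniq.
        rewrite cat_uniq !map_inj_uniq ?us ?andbT /=; last first.
          - by move=> i j /double_inj.
          - by move=> i j [] /double_inj.
        apply/hasPn => _ /mapP[j _ ->]; apply/mapP => -[i _ /(congr1 odd)].
        by rewrite /= !odd_double.
      move=> i j; rewrite !mem_cat => /orP[/mapP[i' /sm[? ?] ->]|/mapP[i' /sm[? ?] ->]]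
        /orP[/mapP[j' /sm[? ?] ->]|/mapP[j' /sm[? ?] ->]]; exact: ginj.
    exists x => _ /mapP[j + ->]; rewrite mem_cat => /orP[] /mapP[i si ->].
      by have [] := Hx i si.
    by have [] := Hx i si.
  have [|x Hx] := Hp (fun t => ((f t).*2, (f t).*2.+1)).
    by move=> t _ /=; split=> //; rewrite leq_max -doubleS leq_double fN.
  by exists x => t /Hx.
(* Entry [i] of the merged row [b] collects column [i] of all rows in block [b]. A point realizing
   entries [i < j] would satisfy [E b] at the constant pair [(i, j)], so merged rows are
   2-inconsistent. *)
exists (fun b i (u : 'I_T0 * W) => r (b * T0 + val u.1) (g b (val u.1) i) u.2); split=> [b bT s us ss sl [x Hx]|f fN].
  have bad i j : i < j -> j < N -> i \in s -> j \in s -> False.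
    move=> ij jN si sj; apply: (gE b (fun=> (i, j))).
      by move=> t _; split=> //=; rewrite leq_max jN orbT.
    exists x => t tT /=.
    by split; [exact: (Hx i si (Ordinal tT))|exact: (Hx j sj (Ordinal tT))].
  case: s us ss sl bad {Hx} => [|i [|j [|]]] //= us _ sl bad.
  have iN : i < N by apply: sl; rewrite mem_head.
  have jN : j < N by apply: sl; rewrite !inE eqxx orbT.
  case: (ltngtP i j) us => [ij|ji|->]; rewrite ?inE ?eqxx // => _.
    by apply: (bad i j) => //; rewrite !inE eqxx ?orbT.
  by apply: (bad j i) => //; rewrite !inE eqxx ?orbT.
have [x Hx] := Hf (fun t => g (t %/ T0) (t %% T0) (f (t %/ T0))) (T * T0).
exists x => b bT t; have T0p : 0 < T0 by case: t => t tT /=; exact: leq_ltn_trans tT.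
have /= := Hx (b * T0 + t).
rewrite divnMDl // divn_small // addn0 modnMDl modn_small //; apply.
by apply: (@leq_trans (b.+1 * T0)); [rewrite mulSn addnC ltn_add2r|rewrite leq_mul2r bT orbT].
Qed.

(** [tp2] wants a formula without parameters, so the parameters defining [R] are appended to every
    tuple of the array. *)
Lemma arrI_ntp2 A (X W : finType) (R : (X -> M) -> (W -> M) -> Prop) :
  ntp2 M -> dfn2 A R -> ~ arrI 2 R.
Proof.
move=> nt HR [r [Hr Hf]].
have [m [d [phi [Ad Hphi]]]] := dfn_formula HR.
pose h (u : X + W + 'I_m) : 'I_#|X| + 'I_#|{: W + 'I_m}| := match u with
  | inl (inl x) => inl (enum_rank x) | inl (inr w) => inr (enum_rank (inl w : W + 'I_m))
  | inr i => inr (enum_rank (inr i : W + 'I_m)) end.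
pose a al i (j : 'I_#|{: W + 'I_m}|) := env (r al i) d (enum_val j).
have Hs x al i : psat x (PFormula (fren h phi) (a al i)) <-> R (fun v => x (enum_rank v)) (r al i).
  have := Hphi (env (fun v => x (enum_rank v)) (r al i)) => /= ->.
  rewrite /psat /= sat_fren; set e1 := (X in sat _ X <-> _); set e2 := (X in _ <-> sat _ X).
  suff -> : e1 = e2 by [].
  by apply: funext => -[[v|w]|i']; rewrite /e1 /e2 /h /a /= ?enum_rankK.
apply: (nt _ _ (fren h phi)); exists a; split.
  move=> al s us ss [x Hx]; apply: (Hr al s us ss).
  by exists (fun v => x (enum_rank v)) => i si; apply/Hs; exact: Hx.
move=> f F /finite_setE[s ->] sF.
have [T HT] : exists T, forall phi0, List.In phi0 s ->
    exists2 al, al < T & phi0 = PFormula (fren h phi) (a al (f al)).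
  elim: s sF => [|q s IH] sF; first by exists 0.
  have [|T HT] := IH; first by move=> q' qs; apply: sF; right.
  have [al _ <-] := sF q (or_introl erefl).
  exists (maxn T al.+1) => q' [<-|/HT[be beT ->]].
    by exists al => //; exact: leq_maxr.
  by exists be => //; rewrite leq_max beT.
have [x Hx] := Hf f T.
exists (fun j => x (enum_val j)) => q /HT[al alT ->]; apply/Hs.
suff -> : (fun v => x (enum_val (enum_rank v))) = x by exact: Hx.
by apply: funext => v; rewrite enum_rankK.
Qed.

Lemma ntp2_arr k (X W : finType) (R : (X -> M) -> (W -> M) -> Prop) :
  ntp2 M -> dfn2 setT R -> ~ forall T N, arr k R T N.
Proof.
move=> nt HR H.
have [m [d [phi [_ Hphi]]]] := dfn_formula HR.
(* Compactness needs a small parameter set; the finitely many parameters of [R] suffice. *)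
have HR' : dfn2 (range d) R.
  apply: (@dfn_ext _ _ _ _ (fun u => sat phi (env u d))); first by move=> u; rewrite -Hphi.
  by apply: dfn_subst => [|i]; [exact: formula_dfn|exists i].
have sd : small K (range d) by apply: small_range; exact: sm_fin.
have [W' [R' [HR2 HA]]] := arrI_two sd HR' (arr_arrI sd HR' H).
exact: arrI_ntp2 nt HR2 HA.
Qed.

End Arrays.

(** * Forking and dividing *)

Section Forking.
Variables (L : language) (K : Type) (M : structure L).
Hypotheses (mon : monster K M) (nt : ntp2 M).
Implicit Types A B C D : set M.

Let slK : strong_limit K. Proof. by case: mon. Qed.
Let natK : small K [set: nat]. Proof. by case: mon => _ []. Qed.

Lemma eqv_env_l A V W (e e' : V -> M) (d : W -> M) : (forall w, A (d w)) ->
  eqv A e e' -> eqv A (env d e) (env d e').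
Proof. by move=> Ad E P HP; exact: E (dfn_subst_l HP Ad). Qed.

(** Compactness turns arbitrarily long finite rows in every definable neighbourhood of [b] into one
    infinite row of realizations of the type of [b] over [B]. *)
Lemma fdiv_row (X W : finType) k A B (R : (X -> M) -> (W -> M) -> Prop) b :
  small K B -> A `<=` B -> dfn2 A R -> fdiv k R B b ->
  exists y : nat -> W -> M, (forall l, eqv B b (y l)) /\ rowI k R y.
Proof.
move=> sB AB HR Hb.
pose S1 (P : (W -> M) -> Prop) l (e : nat * W -> M) := P (fun w => e (l, w)).
pose S2 N (e : nat * W -> M) := row k R N (fun i w => e (i, w)).
have [|P [[P' [l [HP _ ->]]]|[N ->]]|s sS|e He] := @compactness L K M mon (nat * W) B
  [set P | (exists P' l, [/\ dfn B P', P' b & P = S1 P' l]) \/ exists N, P = S2 N] _ sB.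
- by apply: sm_prod => //; [exact: sm_nat|exact: sm_fin].
- exact: (dfn_ren (fun w => (l, w)) HP).
- exact: dfn_mono AB (row_dfn k N (fun i w => (i, w)) HR).
- have [P [l0 [HP Pb Hs]]] : exists P l0, [/\ dfn B P, P b & forall Q, List.In Q s ->
     forall y : nat -> W -> M, (forall i, i < l0 -> P (y i)) -> row k R l0 y -> Q (fun u => y u.1 u.2)].
    elim: s sS => [|Q s IH] sS.
      by exists (fun=> True), 0; split=> //; exact: dfn_true.
    have [|P [l0 [HP Pb Hs]]] := IH; first by move=> Q' Q's; apply: sS; right.
    have [[P' [l [HP' P'b E]]]|[N E]] := sS Q (or_introl erefl).
      exists (fun e => P e /\ P' e), (maxn l0 l.+1); split=> //; first exact: dfn_and.
      move=> Q' Q's y Hy ry.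
      have H1 i : i < l0 -> P (y i) by move=> il; apply: (Hy i _).1; rewrite leq_max il.
      case: Q's => [<-|Q's].
        by rewrite E /S1; apply: (Hy l _).2; rewrite leq_max ltnSn orbT.
      apply: (Hs _ Q's y) => // s' us ss sl; apply: ry => // i /sl il; by rewrite leq_max il.
    exists P, (maxn l0 N); split=> // Q' Q's y Hy ry.
    case: Q's => [<-|Q's].
      rewrite E /S2 => s' us ss sl; apply: ry => // i /sl il; by rewrite leq_max il orbT.
    apply: (Hs _ Q's y) => // [i il|s' us ss sl]; first by apply: Hy; rewrite leq_max il.
    by apply: ry => // i /sl il; rewrite leq_max il.
  have [y yP ry] := Hb P HP Pb l0.
  by exists (fun u => y u.1 u.2) => Q Qs; exact: (Hs Q Qs y).
exists (fun l w => e (l, w)); split=> [l P HP Pb|].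
  by apply: (He (S1 P l)); left; exists P, l.
by apply/rowI_row => N; apply: (He (S2 N)); right; exists N.
Qed.

(* If each step [Q B b] makes [b] finitely satisfiable in [A] over [B] while
   [R i (x, b)] still divides over [B], then the dividing rows of successive
   steps form an array all of whose paths are conjugate over [A]. *)
Lemma array_sequence (X W : finType) n (R : nat -> (X -> M) -> (W -> M) -> Prop)
    (k : nat -> nat) A a0 (Q : set M -> (W -> M) -> Prop) :
  small K A -> A a0 -> (forall i, i < n -> dfn2 A (R i)) ->
  (forall B, small K B -> exists b, Q B b) ->
  (forall B b, Q B b -> fs A (A `|` B) (range b) /\
     forall i, i < n -> fdiv (k i) (R i) (A `|` B) b) ->
  exists (b : nat -> W -> M) (Bs : nat -> set M),
    [/\ forall t, Q (Bs t) (b t), forall s t, s < t -> range (b s) `<=` Bs t &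
      forall i, i < n -> exists T, forall s : seq nat, uniq s -> size s = T ->
        ~ exists x, forall t, t \in s -> R i x (b t)].
Proof.
move=> sA Aa0 HR Qex QP.
pose rows B (p : (W -> M) * (nat -> nat -> W -> M)) := Q B p.1 /\ forall i, i < n ->
    (forall l, eqv (A `|` B) p.1 (p.2 i l)) /\ rowI (k i) (R i) (p.2 i).
have /choice[F HF] : forall B, exists p, small K B -> rows B p.
  move=> B; have [sB|nsB] := pselect (small K B); last by exists (fun=> a0, fun _ _ _ => a0).
  have [b Qb] := Qex B sB; have [_ fb] := QP B b Qb.
  have H i : exists y : nat -> W -> M,
      i < n -> (forall l, eqv (A `|` B) b (y l)) /\ rowI (k i) (R i) y.
    have [lt_in|] := boolP (i < n); last by exists (fun _ _ => a0).
    have [||y Hy] := fdiv_row _ _ (HR i lt_in) (fb i lt_in).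
    - exact: small_setU.
    - by move=> x; left.
    - by exists y.
  by have [y Hy] := choice H; exists (b, y) => _; split.
pose next B := B `|` range (F B).1 `|` range (fun u : nat * nat * W => (F B).2 u.1.1 u.1.2 u.2).
pose Bs t := iter t next set0.
have sBs t : small K (Bs t).
  elim: t => [|t IH]; first exact: small_set0.
  apply: small_setU => //; first apply: small_setU => //.
    by apply: small_range; exact: sm_fin.
  by apply: small_range; do ?apply: sm_prod => //; try exact: sm_fin; exact: sm_nat.
pose b t := (F (Bs t)).1; pose r t := (F (Bs t)).2.
have HF' t : rows (Bs t) (F (Bs t)) := HF _ (sBs t).
have BsS t : Bs t `<=` Bs t.+1 by move=> x Bx; left; left.
have Bs_mono s t : s <= t -> Bs s `<=` Bs t.
  move=> /subnK <-; elim: (t - s) => // d IH x /IH; rewrite addSn; exact: BsS.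
have bB s t : s < t -> range (b s) `<=` Bs t.
  by move=> st x bx; apply: (Bs_mono _ _ st); left; right.
have rB s t i l : s < t -> range (r s i l) `<=` Bs t.
  move=> st _ [w _ <-]; apply: (Bs_mono _ _ st); right; by exists (i, l, w).
exists b, Bs; split=> [t|//|i lt_in]; first by have [] := HF' t.
apply: contrapT => /forallNP nT.
(* [Some l] selects entry [l] of the dividing row at step [t], and [None] the original [b t]. Past
   [N] the assignment [u] takes the value [a0], so that all its values lie in [A] or [Bs N]. *)
pose c (f : nat -> option nat) t := if f t is Some l then r t i l else b t.
pose u f N (v : nat * W) := if v.1 < N then c f v.1 v.2 else a0.
have uB f N v : (A `|` Bs N) (u f N v).
  rewrite /u; case: ifP => [lt|_]; last by left.
  rewrite /c; case: (f v.1) => [l|]; right; first by apply: (rB _ _ i l lt); exists v.2.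
  by apply: (bB _ _ lt); exists v.2.
(* At step [N] the earlier part of the path is exchanged first, since the type of [b N] over [A] and
   [Bs N] is [A]-invariant; then [b N] is replaced by an entry of its row, which has the same type
   over [A] and [Bs N]. *)
have path f N : eqv A (u (fun=> None) N) (u f N).
  elim: N => [|N IH]; first by [].
  pose h (v : nat * W) : nat * W + W := if v.1 == N then inr v.2 else inl v.
  have uS g v : u g N.+1 v = env (u g N) (c g N) (h v).
    rewrite /u /h ltnS leq_eqVlt; case: eqP => [-> //|_] /=; by [].
  have -> : u (fun=> None) N.+1 = fun v => env (u (fun=> None) N) (b N) (h v).
    by apply: funext => v; rewrite uS.
  have -> : u f N.+1 = fun v => env (u f N) (c f N) (h v) by apply: funext.
  apply: eqv_ren; have [/QP[fsb _] HN] := HF' N.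
  apply: (@eqv_trans _ _ _ _ _ (env (u f N) (b N))).
    apply: fs_inv fsb _ _ _ _ IH => [x|||w]; [by left|exact: uB|exact: uB|by exists w].
  rewrite /c; case: (f N) => [l|//].
  apply: (@eqv_mono _ _ _ (A `|` Bs N)); first by move=> x; left.
  by apply: eqv_env_l; [exact: uB|have [H _] := HN i lt_in; exact: H].
apply: (ntp2_arr mon (k := k i) (R := R i) nt).
  by apply: dfn_mono (HR i lt_in).
move=> T N; have [s us [ss [x Hx]]] : exists2 s : seq nat, uniq s & size s = T /\
     exists x, forall t, t \in s -> R i x (b t).
  apply: contrapT => H; apply: (nT T) => s us ss Hx; apply: H; by exists s.
exists (fun t => r (nth 0 s t) i); split=> [t _|f _].
  by apply: (rowI_row _ _ _).1; have [_ /(_ i lt_in)[]] := HF' (nth 0 s t).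
pose f' t := if t \in s then Some (f (index t s)) else None.
pose P (e : nat * W -> M) := exists x, forall t, t \in s -> R i x (fun w => e (t, w)).
pose N0 := (\max_(t <- s) t).+1.
have sN t : t \in s -> t < N0 by move=> ts; rewrite ltnS; exact: (@leq_bigmax_seq _ s xpredT id).
have [||x' Hx'] := path f' N0 P.
- apply: dfn_ex; apply: dfn_mem => t _.
  exact: (dfn_binary (fun x => inr x) (fun w => inl (t, w)) (HR i lt_in)).
- by exists x => t ts; rewrite /u /c /= sN //; exact: Hx.
- exists x' => t tT; have ts : nth 0 s t \in s by rewrite mem_nth // ss.
  by have := Hx' _ ts; rewrite /u /c /f' /= sN // ts index_uniq // ss.
Qed.

Lemma model_inh A : model_set A -> exists a, A a.
Proof.
move=> mA; have [a0] := carrier_inhabited M.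
have [a Aa _] := mA unit (fun=> a0) (fun=> True) (fun=> I) (dfn_true _ _) I.
by exists (a tt).
Qed.

(** The ideal to omit consists of the sets whose points in [A] bound the length of rows. A set in
    the type of [b] over [A] contains long rows, and these can be moved into the model [A]. Rows of
    length 1 give finite satisfiability. *)
Lemma fdiv_coheir (X W : finType) k A B (R : (X -> M) -> (W -> M) -> Prop) b :
  small K A -> small K B -> model_set A -> dfn2 A R -> fdiv k R A b ->
  exists b', [/\ eqv A b b', fs A (A `|` B) (range b') & fdiv k R (A `|` B) b'].
Proof.
move=> sA sB mA HR Hb.
pose inA (y : W -> M) := forall w, A (y w).
have [||P [HP _]|P []|||P Q [HP Pb] [HQ Qb]|P Q [HP [l1 n1]] [HQ [l2 n2]]|
   P Q [HP Pb] [HQ [l nl]]|b' [H1 H2]] :=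
  @compactness_avoid L K M mon W (A `|` B) [set P | dfn A P /\ P b]
  [set P | dfn (A `|` B) P /\ exists l, ~ hasrow k R l (fun y => P y /\ inA y)].
- exact: sm_fin.
- exact: small_setU.
- by apply: dfn_mono HP => x; left.
- by [].
- by exists (fun=> True); split; [exact: dfn_true|].
- exists (fun=> False); split; first exact: dfn_false.
  by exists 1 => -[y /(_ 0)[]].
- by split=> //; exact: dfn_and.
- split; first exact: dfn_or.
  exists (l1 + l2) => H; suff [] : hasrow k R l1 (fun y => P y /\ inA y) \/
     hasrow k R l2 (fun y => Q y /\ inA y) by [].
  by apply: hasrow_or; apply: hasrow_mono H => // y [[]]; [left|right].
- pose S (e : nat * W -> M) := (forall i, i \in iota 0 l -> P (fun w => e (i, w))) /\
    row k R l (fun i w => e (i, w)).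
  have [y yP ry] := Hb P HP Pb l.
  have [||e Ae [eP re]] := mA _ (fun u => y u.1 u.2) S (fun=> I).
  + apply: dfn_and; last exact: (row_dfn k l (fun i w => (i, w)) HR).
    by apply: dfn_mem => i _; exact: (dfn_ren (fun w => (i, w)) HP).
  + by split=> // i; rewrite mem_iota add0n => /andP[_]; exact: yP.
  apply: contrapT => /forallNP H; apply: nl; exists (fun i w => e (i, w)) => // i il.
  split; last by move=> w.
  by apply: contrapT => nQ; apply: (H (fun w => e (i, w))); split=> //; apply: eP; rewrite mem_iota.
exists b'; split.
- by move=> P HP Pb; exact: H1.
- apply: fs_range => P HP Pb'; apply: contrapT => nA; apply: (H2 P _ Pb'); split=> //.
  by exists 1 => -[y /(_ 0)[//|Py Ay] _]; apply: nA; exists (y 0).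
- move=> P HP Pb' l; apply: contrapT => nl; apply: (H2 P _ Pb'); split=> //.
  by exists l => H; apply: nl; apply: hasrow_mono H => // y [].
Qed.

Lemma fs0 A B : fs A B set0.
Proof. by move=> V e P e0 _ Pe; exists e => // v; case: (e0 v). Qed.

(** Transitivity of finite satisfiability, iterated along the terms after [b j]. *)
Lemma fs_chain (W : finType) A (b : nat -> W -> M) (Bs : nat -> set M) j m :
  (forall t, fs A (A `|` Bs t) (range (b t))) ->
  (forall s t, s < t -> range (b s) `<=` Bs t) ->
  fs A (A `|` range (b j)) [set x | exists2 t, j < t < j + m.+1 & range (b t) x].
Proof.
move=> Hb HB; elim: m => [|m IH].
  apply: fs_mono (@fs0 A (A `|` range (b j))) => // x [t]; rewrite addn1 => /andP[j1 j2].
  by move: (leq_trans j1 j2); rewrite ltnn.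
have H : fs A (A `|` range (b j) `|` [set x | exists2 t, j < t < j + m.+1 & range (b t) x])
   (range (b (j + m.+1))).
  apply: fs_mono (Hb (j + m.+1)) => // x [[Ax|bx]|[t /andP[_ tj] bx]]; first by left.
    by right; apply: (HB j) bx; rewrite addnS ltnS leq_addr.
  by right; apply: (HB t) bx.
have AB : A `<=` A `|` range (b j) by move=> x; left.
apply: fs_mono (fs_trans AB IH H) => // x [t].
rewrite addnS ltnS => /andP[jt]; rewrite leq_eqVlt => /orP[/eqP->|tj bx]; first by right.
by left; exists t; rewrite ?jt.
Qed.

(** * The broom lemma and its consequence that forking is dividing *)

Definition equivariant A (X Y : Type) (S : (X -> M) -> (Y -> M) -> Prop) :=
  forall g x c, aut A g -> S x c -> S (fun v => g (x v)) (fun v => g (c v)).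

Lemma dfn_equivariant A (X W : Type) (R : (X -> M) -> (W -> M) -> Prop) :
  dfn2 A R -> equivariant A R.
Proof. by move=> HR g x y ag; apply: (aut_dfn (env x y) ag HR).1. Qed.

(* The broom lemma: an [Aut(M/A)]-invariant filter [G] cannot contain a finite
   union of sets dividing over [A] without containing the empty set.  The last
   dividing set is traded for several conjugates of the remaining ones, spread
   along a coheir sequence killing it; these are then removed one at a time, the
   later ones being absorbed in the context [S]. *)
Lemma broom (X W : finType) n (R : nat -> (X -> M) -> (W -> M) -> Prop)
    (k : nat -> nat) A (G : set (set (X -> M))) :
  small K A -> model_set A -> (forall i, i < n -> dfn2 A (R i)) ->
  (forall S S', S `<=` S' -> G S -> G S') ->
  G setT -> (forall S S', G S -> G S' -> G (S `&` S')) ->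
  (forall g S S', aut A g -> (forall x, S x -> S' (fun v => g (x v))) -> G S -> G S') ->
  forall (C : Type) (S : (X -> M) -> (C -> M) -> Prop) c b, smT K C ->
  equivariant A S -> (forall i, i < n -> fdiv (k i) (R i) A b) ->
  fs A (A `|` range b) (range c) ->
  G (fun x => S x c \/ exists2 i, i < n & R i x b) -> G (fun x => S x c).
Proof.
move=> sA mA; elim: n => [|n IH] HR Gup GT GI Ginv C S c b sC eS Hb fsc GS.
  by apply: (@Gup _ _ _) GS => x [//|[]].
have {}IH := IH (fun i lt_in => HR i (ltnW lt_in)) Gup GT GI Ginv.
have [a0 Aa0] := model_inh mA.
have HRn := HR n (ltnSn n).
have [|||bt [Bs [Qbt HBs HT]]] := @array_sequence X W 1 (fun=> R n) (fun=> k n) A a0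
  (fun B b' => [/\ eqv A b b', fs A (A `|` B) (range b') & fdiv (k n) (R n) (A `|` B) b'])
  sA Aa0.
- by [].
- by move=> B sB; apply: fdiv_coheir => //; exact: Hb.
- by move=> B b' [].
have [T HTn] := HT 0 isT.
pose D := range (fun u : nat * W => bt u.1 u.2).
have sD : small K D.
  by apply: small_range; apply: sm_prod => //; [exact: sm_nat|exact: sm_fin].
have sAb : small K (A `|` range b).
  by apply: small_setU => //; apply: small_range; exact: sm_fin.
have [c' Ec fsc'] := coheir_extension mon sC sAb sD fsc.
have btD t : range (bt t) `<=` D by move=> _ [w _ <-]; exists (t, w).
(* [c'] is a coheir over a set containing [b] and every [bt t], so it cannot distinguish these
   conjugates: a single [c'] serves for the whole sequence. *)
have conj_t t : exists2 g, aut A g & forall v, g (env b c v) = env (bt t) c' v.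
  apply: (homogeneity mon) => //; first by apply: sm_sum => //; exact: sm_fin.
  have [Eb _ _] := Qbt t.
  apply: (@eqv_trans _ _ _ _ _ (env b c')).
    apply: (@eqv_mono _ _ _ (A `|` range b)); first by move=> x; left.
    by apply: eqv_env_l => // w; right; exists w.
  apply: fs_inv fsc' _ _ _ _ Eb => [x Ax|v|v|w]; first by do 2!left.
  - by left; right; exists v.
  - by right; exists (t, v).
  - by exists w.
have Gt t : G (fun x => S x c' \/ exists2 i, i < n.+1 & R i x (bt t)).
  have [g ag gE] := conj_t t.
  apply: (Ginv g _ _ ag) GS => x [Sx|[i il Rx]].
    left; have := eS _ _ _ ag Sx; congr (S _ _).
    by apply: funext => v; exact: (gE (inr v)).
  right; exists i => //; have := dfn_equivariant (HR i il) ag Rx.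
  by congr (R i _ _); apply: funext => v; exact: (gE (inl v)).
have GT' m : G (fun x => forall t, t < m -> S x c' \/ exists2 i, i < n.+1 & R i x (bt t)).
  elim: m => [|m IHm]; first by apply: (@Gup _ _ _) GT.
  apply: (@Gup _ _ _) (GI _ _ IHm (Gt m)) => x [Hx Hm] t.
  by rewrite ltnS leq_eqVlt => /orP[/eqP->|/Hx].
(* A point lying in [R n] of [bt t] for all [t < T] is impossible by the choice of [T], which
   settles [j = 0]. Passing from [j] to [j.+1] removes the sets at [bt j] by the induction
   hypothesis, with the sets at later terms placed in the context. *)
have Gj j : j <= T -> G (fun x => S x c' \/ exists2 t, j <= t < T &
    exists2 i, i < n & R i x (bt t)).
  elim: j => [|j IHj] jT.
    apply: (@Gup _ _ _) (GT' T) => x Hx; apply: contrapT => /not_orP[nS nR].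
    apply: (HTn (iota 0 T)); rewrite ?iota_uniq ?size_iota //; exists x => t.
    rewrite mem_iota add0n => /andP[_ tT]; have [//|[i]] := Hx t tT.
    rewrite ltnS leq_eqVlt => /orP[/eqP->//|il Rx].
    by case: nR; exists t => //; exists i.
  (* The index is capped at [j.+1 + T], which keeps the context inside a finite segment of the
     sequence, where [fs_chain] applies; terms with [t < T] are not affected. *)
  pose cj (u : nat * W) := bt (j.+1 + minn (u.1 - j.+1) T) u.2.
  pose S' x (e : C + nat * W -> M) := S x (fun v => e (inl v)) \/
    exists2 t, j < t < T & exists2 i, i < n & R i x (fun w => e (inr (t, w))).
  have cjE t : j < t < T -> (fun w => cj (t, w)) = bt t.
    move=> /andP[jt tT]; apply: funext => w; rewrite /cj /=.
    rewrite (minn_idPl _) ?subnKC //.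
    by apply: leq_trans (leq_subr _ _) _; exact: ltnW.
  apply: (@Gup _ _ _) (IH _ S' (env c' cj) (bt j) _ _ _ _ _).
  - by move=> x [Sx|[t jt [i il]]]; [left|rewrite /= cjE // => Rx; right; exists t => //; exists i].
  - by apply: sm_sum => //; apply: sm_prod => //; [exact: sm_nat|exact: sm_fin].
  - move=> g x e ag [Sx|[t jt [i il Rx]]]; first by left; exact: eS Sx.
    by right; exists t => //; exists i => //; apply: dfn_equivariant ag Rx; apply: HR; exact: ltnW.
  - move=> i il; apply: fdiv_eqv (Hb i (ltnW il)); by have [] := Qbt j.
  - pose E := [set x | exists2 t, j < t < j + T.+2 & range (bt t) x].
    have fsE : fs A (A `|` range (bt j)) E.
      by apply: fs_chain HBs => t; have [] := Qbt t.
    have fsE' : fs A (A `|` range (bt j) `|` E) (range c').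
      apply: fs_mono fsc' => // x [[Ax|bx]|[t _ bx]]; first by do 2!left.
        by right; exact: btD bx.
      by right; exact: btD bx.
    have AB : A `<=` A `|` range (bt j) by move=> x; left.
    apply: fs_mono (fs_trans AB fsE fsE') => // _ [[v|[t w]] _ <-]; first by right; exists v.
    left; exists (j.+1 + minn (t - j.+1) T); last by exists w.
    by rewrite addSn ltnS leq_addr /= addnS ltnS addnS ltnS leq_add2l geq_minr.
  - apply: (@Gup _ _ _) (IHj (ltnW jT)) => x [Sx|[t /andP[jt tT] [i il Rx]]]; first by left; left.
    case: (ltngtP j t) jt => // [jt _|E _].
      left; right; exists t; rewrite ?jt //; exists i => //=.
      by rewrite cjE // jt.
    by subst t; right; exists i.
have Gc' : G (fun x => S x c').
  by apply: (@Gup _ _ _) (Gj T (leqnn T)) => x [//|[t /andP[Tt tT]]]; move: (leq_trans tT Tt); rewrite ltnn.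
have [|g ag gE] := homogeneity mon sA sC (e := c') (e' := c).
  by apply: eqv_sym; apply: eqv_mono Ec => x; left.
apply: (Ginv g _ _ ag) Gc' => x /(eS _ _ _ ag).
by congr (S _ _); apply: funext => v.
Qed.

Lemma dfn_split_seq A B V n (P : nat -> (V -> M) -> Prop) :
  (forall i, i < n -> dfn (A `|` B) (P i)) ->
  exists (Z : finType) (d : Z -> M) (Q : nat -> (V -> M) -> (Z -> M) -> Prop),
    (forall z, B (d z)) /\ forall i, i < n -> dfn2 A (Q i) /\ forall e, P i e <-> Q i e d.
Proof.
elim: n => [|n IH] HP.
  by exists void, (fun z : void => match z with end), (fun _ _ _ => True); split=> [[]|].
have [|Z [d [Q [dB HQ]]]] := IH; first by move=> i il; apply: HP; exact: ltnW.
have [m [d' [Q' [d'B HQ' E]]]] := dfn_split (HP n (ltnSn n)).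
exists (Z + 'I_m)%type, (env d d'), (fun i e z => if i == n then Q' (env e (fun j => z (inr j)))
   else Q i e (fun j => z (inl j))); split=> [[z|j]|i]; first exact: dB.
  exact: d'B.
case: (i =P n) => [->|ne] il.
  split; last by move=> e; exact: E.
  have := dfn_ren (fun u : V + 'I_m => match u with inl v => inl v | inr j => inr (inr j) end
    : V + (Z + 'I_m)) HQ'.
  apply: dfn_ext => u; set e1 := (X in Q' X <-> _); set e2 := (X in _ <-> Q' X).
  by suff -> : e1 = e2 by []; apply: funext => -[].
have {}il : i < n by rewrite ltn_neqAle -ltnS il andbT; apply/eqP.
have [H1 H2] := HQ i il; split=> //.
exact: (dfn_binary (fun v => inl v) (fun z => inr (inl z)) H1).
Qed.

(* If compactness failed, a formula [beta(z, b)] would fork over [A]; by the broom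
   lemma finitely many conjugates of it would be inconsistent, although a coheir
   of their joint parameters over [B] makes them all true at [d]. *)
Lemma fdiv_coheir_all (X W : finType) n (R : nat -> (X -> M) -> (W -> M) -> Prop)
    (k : nat -> nat) A B b :
  small K A -> small K B -> model_set A -> (forall i, i < n -> dfn2 A (R i)) ->
  (forall i, i < n -> fdiv (k i) (R i) A b) ->
  exists b', [/\ eqv A b b', fs A (A `|` B) (range b') &
    forall i, i < n -> fdiv (k i) (R i) (A `|` B) b'].
Proof.
move=> sA sB mA HR Hb.
(* The ideal generated jointly: [P] is covered by [n] pieces, the [i]-th bounding rows of [R i], and
   a last piece [N n] without points in [A]. Bounds are written [(l i).+1] to keep them positive. *)
pose bad (P : (W -> M) -> Prop) := exists (N : nat -> (W -> M) -> Prop) (l : nat -> nat),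
  [/\ forall i, i < n.+1 -> dfn (A `|` B) (N i),
      forall a, (forall w, A (a w)) -> ~ N n a,
      forall i, i < n -> ~ hasrow (k i) (R i) (l i).+1 (N i) &
      forall y, P y -> exists2 i, i < n.+1 & N i y].
have [||P [HP _]|P []|||P Q [HP Pb] [HQ Qb]|P Q [HP [N1 [l1 [D1 E1 F1 G1]]]] [HQ [N2 [l2 [D2 E2 F2 G2]]]]|
   P Q [HP Pb] [HQ [N [l [DN E F GN]]]]|b' [H1 H2]] :=
  @compactness_avoid L K M mon W (A `|` B) [set P | dfn A P /\ P b]
  [set P | dfn (A `|` B) P /\ bad P].
- exact: sm_fin.
- exact: small_setU.
- by apply: dfn_mono HP => x; left.
- by [].
- by exists (fun=> True); split; [exact: dfn_true|].
- exists (fun=> False); split; first exact: dfn_false.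
  exists (fun _ _ => False), (fun=> 0); split.
  + by move=> i _; exact: dfn_false.
  + by move=> a Aa.
  + by move=> i _ [y /(_ 0 isT)].
  + by [].
- by split=> //; exact: dfn_and.
- split; first exact: dfn_or.
  exists (fun i y => N1 i y \/ N2 i y), (fun i => l1 i + (l2 i).+1); split.
  + by move=> i il; apply: dfn_or; [exact: D1|exact: D2].
  + by move=> a Aa [|]; [exact: E1|exact: E2].
  + by move=> i il; rewrite -addSn => /hasrow_or[]; [exact: F1|exact: F2].
  + by move=> y [/G1|/G2] [i il Ni]; exists i => //; [left|right].
- apply: contrapT => /forallNP nPQ.
  have PN y : P y -> exists2 i, i < n.+1 & N i y.
    by move=> Py; apply: GN; apply: contrapT => nQ; apply: (nPQ y).
  have [Z [d [Nz [dB HNz]]]] := dfn_split_seq DN.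
  (* The parameters from [B] in the cover are made variable: [nu z] says that [z] yields such a
     cover of [P], and [beta z y] adds that [y] avoids the last piece, hence lies in a thin one when
     [P y] holds. *)
  pose nu (z : Z -> M) := (forall y, P y -> exists i : 'I_n.+1, Nz i y z) /\
    forall i : 'I_n, ~ hasrow (k i) (R i) (l i).+1 (fun y => Nz i y z).
  pose beta (z : Z -> M) (y : W -> M) := nu z /\ ~ Nz n y z.
  have HNz' i : i < n.+1 -> dfn2 A (fun z y => Nz i y z).
    by move=> il; exact: (dfn_binary (fun v => inr v) (fun z => inl z) (HNz i il).1).
  have Hnu : dfn A nu.
    apply: dfn_and.
      apply: dfn_all; apply: dfn_imp; first exact: (dfn_ren (fun w => inr w) HP).
      apply: dfn_finE => i.
      exact: (dfn_binary (fun v => inl v) (fun w => inr w) (HNz' i (ltn_ord i))).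
    apply: dfn_fin => i; apply: dfn_not; apply: hasrow_dfn; first exact: HR.
    by apply: HNz'; exact: (ltnW (ltn_ord i)).
  have Hbeta : dfn2 A beta.
    apply: dfn_and; first exact: (dfn_ren (fun z => inl z) Hnu).
    by apply: dfn_not; apply: HNz'.
  (* The invariant filter for the broom: generated by the conjugates over [A] of the set of [z] with
     [beta z b]. *)
  pose G (S : set (Z -> M)) := exists (I : finType) (E : I -> W -> M),
    (forall u, eqv A b (E u)) /\ forall z, (forall u, beta z (E u)) -> S z.
  pose Xi i (z : Z -> M) (y : W -> M) :=
    Nz i y z /\ ~ hasrow (k i) (R i) (l i).+1 (fun y => Nz i y z).
  have [I [Eu [HE nE]]] : G (fun=> False).
    apply: (@broom Z W n Xi (fun i => (l i).+1) A G sA mA _ _ _ _ _ void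
       (fun _ _ => False) (fun v : void => match v with end) b) => //.
    + move=> i il; apply: dfn_and; first exact: HNz' (ltnW il).
      apply: dfn_not; apply: hasrow_dfn; first exact: HR.
      exact: (dfn_binary (fun z => inl (inl z)) (fun w => inr w) (HNz' i (ltnW il))).
    + by move=> S S' SS [I [Eu [HE HS]]]; exists I, Eu; split=> // z /HS; exact: SS.
    + by exists void, (fun v : void => match v with end); split=> // -[].
    + move=> S S' [I [Eu [HE HS]]] [I' [Eu' [HE' HS']]].
      exists (I + I')%type, (fun u => match u with inl u => Eu u | inr u => Eu' u end).
      split=> [[u|u] //|z Hz].
      by split; [apply: HS => u; exact: (Hz (inl u))|apply: HS' => u; exact: (Hz (inr u))].
    + move=> g S S' ag SS [I [Eu [HE HS]]]; exists I, (fun u w => g (Eu u w)); split.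
        by move=> u; apply: eqv_trans (HE u) _; exact: aut_eqv.
      move=> z Hz; have [g' [ag' gK g'K]] := aut_inv ag.
      have := SS (fun v => g' (z v)); rewrite (_ : (fun v => g (g' (z v))) = z); last first.
        by apply: funext => v; rewrite g'K.
      apply; apply: HS => u; have := dfn_equivariant Hbeta ag' (Hz u).
      by congr (beta _ _); apply: funext => w; rewrite gK.
    + exact: sm_fin.
    (* The roles are exchanged: a row of [R i] is a row for [Xi i]. A [z] common to [(l i).+1] of
       its entries would place that many entries, still a row of [R i], inside [Nz i], against the
       bound included in [Xi i]. *)
    + move=> i il P' HP' P'b l'; have [y yP ry] := Hb i il P' HP' P'b l'.
      exists y => // s us ss sl [z Hz].
      have [|_] := Hz (nth 0 s 0); first by rewrite mem_nth // ss.
      apply; apply: hasrow_sub ry us _ _; last by rewrite ss.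
      by move=> j js; split; [exact: sl|have [] := Hz j js].
    + by apply: fs_mono (@fs0 A (A `|` range b)) => // x [[]].
    + exists unit, (fun=> b); split; first by move=> _; exact: eqv_refl.
      move=> z /(_ tt)[[nu1 nu2] nN]; right.
      have [i Ni] := nu1 b Pb.
      have il : i < n.
        rewrite ltn_neqAle -ltnS ltn_ord andbT; apply/eqP => E'.
        by apply: nN; rewrite -E'.
      by exists i => //; split=> //; exact: (nu2 (Ordinal il)).
  (* The original parameters [d] refute this inconsistency. Replace the conjugates by a coheir over
     [B]: none of them meets the piece without points in [A], so [d] satisfies [beta] with all of
     them, and consistency passes back to [Eu] over [A]. *)
  pose c (u : I * W) := Eu u.1 u.2.
  have [|c' Ec fsc] := @coheir_extension L K M mon A A B (I * W)%type c (sm_fin natK _) sA sB.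
    exact: fs_mono mA.
  have [||z Hz] := (eqv_sym Ec) (fun e => exists z, forall u : I, beta z (fun w => e (u, w))).
  + apply: dfn_ex; apply: dfn_fin => u.
    exact: (dfn_binary (fun z => inr z) (fun w => inl (u, w)) Hbeta).
  + exists d => u; split.
      split=> [y /PN [i il /(HNz i il).2 Ni]|i]; first by exists (Ordinal il).
      move=> H; apply: (F i (ltn_ord i)); apply: hasrow_mono H => // y.
      by move=> /(HNz i (ltnW (ltn_ord i))).2.
    move=> /(HNz n (ltnSn n)).2 Nc.
    have [|a Aa] := fsc _ (fun w => c' (u, w)) _ _ (DN n (ltnSn n)) Nc.
      by move=> w; exists (u, w).
    exact: E.
  + exact: (nE z).
exists b'; split.
- by move=> P HP Pb; exact: H1.
- apply: fs_range => P HP Pb'; apply: contrapT => nA; apply: (H2 P _ Pb'); split=> //.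
  exists (fun i => if i == n then P else fun=> False), (fun=> 0); split.
  + by move=> i _; case: eqP => // _; exact: dfn_false.
  + by move=> a Aa; rewrite eqxx => Pa; apply: nA; exists a.
  + by move=> i il [y /(_ 0 isT)]; rewrite (ltn_eqF il).
  + by move=> y Py; exists n; rewrite ?eqxx.
- move=> i il P HP Pb' l; apply: contrapT => nl; apply: (H2 P _ Pb'); split=> //.
  exists (fun j => if j == i then P else fun=> False), (fun=> l); split.
  + by move=> j _; case: eqP => // _; exact: dfn_false.
  + by move=> a Aa; rewrite gtn_eqF.
  + move=> j jl; case: eqP => [->|_ [y /(_ 0 isT)]//].
    by move=> H; apply: nl; apply: hasrow_mono H.
  + by move=> y Py; exists i; rewrite ?eqxx // ltnW.
Qed.

(* Along a sequence of coheirs of [b] killing every [R i], a realization of many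
   conjugates of [S(x, b)] would realize too many conjugates of a single [R i]. *)
Lemma fork_fdiv (X W : finType) n (R : nat -> (X -> M) -> (W -> M) -> Prop)
    (k : nat -> nat) A b (S : (X -> M) -> (W -> M) -> Prop) :
  small K A -> model_set A -> (forall i, i < n -> dfn2 A (R i)) -> dfn2 A S ->
  (forall i, i < n -> fdiv (k i) (R i) A b) ->
  (forall x, S x b -> exists2 i, i < n & R i x b) ->
  exists q, fdiv q S A b.
Proof.
move=> sA mA HR HS Hb cov; apply: contrapT => /forallNP nq.
have [a0 Aa0] := model_inh mA.
have [||bt [Bs [Qbt HBs HT]]] := @array_sequence X W n R k A a0
  (fun B b' => [/\ eqv A b b', fs A (A `|` B) (range b') &
     forall i, i < n -> fdiv (k i) (R i) (A `|` B) b']) sA Aa0 HR.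
- by move=> B sB; exact: fdiv_coheir_all.
- by move=> B b' [].
have [T HTT] : exists T, forall i, i < n -> forall s : seq nat, uniq s -> T <= size s ->
     ~ exists x, forall t, t \in s -> R i x (bt t).
  have H i : exists T, i < n -> forall s : seq nat, uniq s -> T <= size s ->
     ~ exists x, forall t, t \in s -> R i x (bt t).
    have [il|] := boolP (i < n); last by exists 0.
    have [T HTi] := HT i il; exists T => _ s us Ts [x Hx].
    apply: (HTi (take T s)); rewrite ?take_uniq ?size_takel //.
    by exists x => t /mem_take; exact: Hx.
  have [Tf HTf] := choice H; exists (\max_(i < n) Tf i) => i il s us Ts.
  apply: HTf => //; apply: leq_trans Ts.
  exact: (@leq_bigmax _ (fun i : 'I_n => Tf i) (Ordinal il)).
(* More than [n * T] indices shared among [n] formulas force more than [T] of them onto a single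
   [R i]. *)
pose q := (n * T).+1.
(* All [bt t] lie in a set [P] without [q]-inconsistent rows of length [l], so some [q] of the
   conjugates of [S] have a common point. *)
have [P [HP [Pb [l nl]]]] : exists P, dfn A P /\ P b /\ exists l, ~ hasrow q S l P.
  apply: contrapT => H; apply: (nq q) => P HP Pb l; apply: contrapT => nl.
  by apply: H; exists P; split=> //; split=> //; exists l.
have [s us [ss [x Hx]]] : exists2 s : seq nat, uniq s & size s = q /\
    exists x, forall t, t \in s -> S x (bt t).
  apply: contrapT => H; apply: nl; exists bt.
    by move=> t _; have [Eb _ _] := Qbt t; exact: Eb.
  by move=> s us ss _ Hx; apply: H; exists s.
have /choice[f Hf] : forall t, exists i, t \in s -> i < n /\ R i x (bt t).
  move=> t; have [ts|] := boolP (t \in s); last by exists 0.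
  have [Eb _ _] := Qbt t.
  have [||i Ri] := Eb (fun y => forall x, S x y -> exists i : 'I_n, R i x y) _ _ x (Hx t ts).
  - apply: dfn_all; apply: dfn_imp.
      exact: (dfn_binary (fun x => inr x) (fun w => inl w) HS).
    by apply: dfn_finE => i; exact: (dfn_binary (fun x => inr x) (fun w => inl w) (HR i (ltn_ord i))).
  - by move=> x' /cov[i il Ri]; exists (Ordinal il).
  - by exists i.
have few i : i < n -> size [seq t <- s | f t == i] < T.+1.
  move=> il; rewrite ltnS leqNgt; apply/negP => Ts.
  apply: (HTT i il [seq t <- s | f t == i]); [exact: filter_uniq|exact: ltnW|].
  exists x => t; rewrite mem_filter => /andP[/eqP <- ts]; by have [] := Hf t ts.
suff : size s <= n * T by rewrite ss ltnn.
have -> : size s = \sum_(i < n) size [seq t <- s | f t == i].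
  have sf t : t \in s -> f t < n by move=> /Hf [].
  elim: s sf {us ss Hx Hf few} => [|t s IHs] sf; first by rewrite big1.
  have ft := sf t (mem_head _ _).
  rewrite /= IHs; last by move=> t' t's; apply: sf; rewrite inE t's orbT.
  rewrite (bigD1 (Ordinal ft)) //= [in RHS](bigD1 (Ordinal ft)) //= eqxx /=.
  rewrite addSn; congr (_ + _).+1; apply: eq_bigr => i ine.
  by case: eqP => // E; case/eqP: ine; apply: val_inj.
by rewrite -[X in _ <= X * T]card_ord -sum_nat_const; apply: leq_sum => i _; exact: few.
Qed.

End Forking.

(** * Average types and Morley sequences *)

Section Average.
Variables (L : language) (K : Type) (M : structure L).
Hypotheses (mon : monster K M).
Implicit Types A B C D : set M.

Let slK : strong_limit K. Proof. by case: mon. Qed.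
Let natK : small K [set: nat]. Proof. by case: mon => _ []. Qed.

Variables (J : Type) (U : set (set J)) (Y : finType) (beta : J -> Y -> M).
Hypothesis UU : ultra U.

Definition avg B (c : Y -> M) := forall P, dfn B P -> P c -> U [set j | P (beta j)].

Lemma avg_iff B c P : avg B c -> dfn B P -> (P c <-> U [set j | P (beta j)]).
Proof.
move=> Hc HP; split; first exact: Hc.
move=> UP; apply: contrapT => /(Hc _ (dfn_not HP)) /(ultra_not UU); exact.
Qed.

Lemma avg_mono B B' c : B `<=` B' -> avg B' c -> avg B c.
Proof. by move=> BB Hc P /(dfn_mono BB); exact: Hc. Qed.

Lemma avg_exists B : small K B -> exists c, avg B c.
Proof.
move=> sB.
have [|P []|s sS|c Hc] := @compactness L K M mon Y B
  [set P | dfn B P /\ U [set j | P (beta j)]] _ sB; try by [].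
- exact: sm_fin.
- have [j Hj] := ultra_ex UU (ultra_In UU (fun P Ps => (sS P Ps).2)).
  by exists (beta j).
exists c => P HP Pc; apply: contrapT => /(ultra_not UU) nP.
by apply: (Hc (fun y => ~ P y)) Pc; split=> //; exact: dfn_not.
Qed.

Definition base := range (fun u : J * Y => beta u.1 u.2).

Lemma baseP j y : base (beta j y). Proof. by exists (j, y). Qed.

Lemma avg_fs B c : avg B c -> fs base B (range c).
Proof.
move=> Hc; apply: fs_range => P HP /(Hc _ HP) /(ultra_ex UU) [j Pj].
by exists (beta j) => // y; exact: baseP.
Qed.

Definition before (c : nat -> Y -> M) t := [set x | exists2 s, s < t & range (c s) x].

Definition morley B (c : nat -> Y -> M) := forall t, avg (B `|` before c t) (c t).

Lemma morley_mono B B' c : B `<=` B' -> morley B' c -> morley B c.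
Proof. by move=> BB Hc t; apply: avg_mono (Hc t) => x [/BB|]; [left|right]. Qed.

Lemma morley_exists B : small K B -> exists c, morley B c.
Proof.
move=> sB.
have /choice[F HF] : forall B', exists c, small K B' -> avg B' c.
  move=> B'; have [/avg_exists[c Hc]|ns] := pselect (small K B'); first by exists c.
  by have [j _] := ultra_ex UU (ultraT UU); exists (beta j).
pose Bs t := iter t (fun B' => B' `|` range (F B')) B.
have sBs t : small K (Bs t).
  by elim: t => //= t IH; apply: small_setU => //; apply: small_range; exact: sm_fin.
have BBs t : B `<=` Bs t by elim: t => //= t IH x /IH; left.
exists (fun t => F (Bs t)) => t; apply: avg_mono (HF _ (sBs t)) => x [/BBs//|[s st xs]].
elim: t st => //= t IH; rewrite ltnS leq_eqVlt => /orP[/eqP <-|/IH]; by [right|left].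
Qed.

Lemma morley_sub B c (h : nat -> nat) : (forall i j, i < j -> h i < h j) ->
  morley B c -> morley B (fun t => c (h t)).
Proof.
move=> hm Hc t; apply: avg_mono (Hc (h t)) => x [|[s st xs]]; first by left.
by right; exists (h s) => //; exact: hm.
Qed.

Lemma morley_fs B c N : base `<=` B -> morley B c -> fs base B (before c N).
Proof.
move=> IB Hc; elim: N => [|N IH]; first by move=> V e P e0 _ Pe; exists e => // v; case: (e0 v).
apply: fs_mono (fs_trans IB IH (avg_fs (Hc N))) => // x [s].
by rewrite ltnS leq_eqVlt => /orP[/eqP->|sN xs]; [right|left; exists s].
Qed.

Definition at_row N (u : nat * Y) : Y + nat * Y := if u.1 == N then inl u.2 else inr u.

Lemma dfn_at_row B N (P : (nat * Y -> M) -> Prop) d : dfn B P -> (forall u, B (d u)) ->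
  dfn B (fun y : Y -> M => P (fun u => env y d (at_row N u))).
Proof.
move=> HP Bd; exact: (dfn_subst (dfn_ren (at_row N) HP) Bd).
Qed.

(** By induction on the length: a property of the last term is decided by [U]-many [beta j], and for
    each [j] the induction hypothesis exchanges the earlier terms. Combined with [morley_sub] this
    is indiscernibility over [B]. *)
Lemma morley_eqv B c c' : base `<=` B -> morley B c -> morley B c' ->
  eqv B (fun u : nat * Y => c u.1 u.2) (fun u => c' u.1 u.2).
Proof.
move=> IB Hc Hc'; have [j0 _] := ultra_ex UU (ultraT UU).
pose trunc N (c : nat -> Y -> M) (u : nat * Y) := if u.1 < N then c u.1 u.2 else beta j0 u.2.
have truncB N c0 u : (B `|` before c0 N) (trunc N c0 u).
  rewrite /trunc; case: ifP => [lt|_]; last by left; apply/IB/baseP.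
  by right; exists u.1 => //; exists u.2.
have truncS N c0 : trunc N.+1 c0 = fun u => env (c0 N) (trunc N c0) (at_row N u).
  apply: funext => -[t y]; rewrite /trunc /at_row /= ltnS leq_eqVlt.
  by case: eqP => [->|_].
have H N P : dfn B P -> (P (trunc N c) <-> P (trunc N c')).
  elim: N P => [|N IH] P HP; first by [].
  rewrite !truncS.
  have step c0 : morley B c0 -> (P (fun u => env (c0 N) (trunc N c0) (at_row N u)) <->
     U [set j | P (fun u => env (beta j) (trunc N c0) (at_row N u))]).
    move=> Hc0; apply: (avg_iff (P := fun y => P (fun u => env y (trunc N c0) (at_row N u))) (Hc0 N)).
    apply: dfn_at_row (truncB N c0).
    by apply: dfn_mono HP => x; left.
  have Pj j : P (fun u => env (beta j) (trunc N c) (at_row N u)) <->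
      P (fun u => env (beta j) (trunc N c') (at_row N u)).
    apply: (IH (fun e => P (fun u => env (beta j) e (at_row N u)))).
    by apply: (dfn_subst_l (dfn_ren (at_row N) HP)) => y; apply/IB/baseP.
  by rewrite (step c Hc) (step c' Hc'); split; apply: (ultraS UU) => j /Pj.
move=> P HP; have [l Hl] := dfn_support HP.
have [N HN] : exists N, forall u, List.In u l -> u.1 < N.
  elim: (l) => [|u s [N HN]]; first by exists 0.
  exists (maxn N u.1.+1) => u' [<-|/HN lt]; first exact: leq_maxr.
  by rewrite leq_max lt.
have T c0 : P (fun u => c0 u.1 u.2) <-> P (trunc N c0).
  by apply: Hl => u ul; rewrite /trunc HN.
by rewrite !T H.
Qed.

End Average.

(** * Kim's lemma for average types *)

Section Generic.
Variables (L : language) (K : Type) (M : structure L).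
Hypotheses (mon : monster K M) (nt : ntp2 M).
Variables (U : set (set nat)) (Y : finType) (beta : nat -> Y -> M).
Hypothesis nU : nonprincipal U.
Let UU : ultra U := nU.1.

Let slK : strong_limit K. Proof. by case: mon. Qed.
Let natK : small K [set: nat]. Proof. by case: mon => _ []. Qed.

(** The terms of [c] are replaced one by one, from the last, by [beta j] for [U]-many [j].
    Non-principality allows [j] above all indices in use, so the indices stay distinct. *)
Lemma morley_generic B c N (P : (nat * Y -> M) -> Prop) : base beta `<=` B ->
  morley U beta B c -> dfn B P ->
  (forall e e', (forall u, u.1 < N -> e u = e' u) -> P e -> P e') ->
  (forall h : nat -> nat, {in gtn N &, injective h} -> P (fun u => beta (h u.1) u.2)) ->
  P (fun u => c u.1 u.2).
Proof.
move=> IB Hc HP dP Hh.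
pose mix n (h : nat -> nat) (u : nat * Y) := if u.1 < n then c u.1 u.2 else beta (h u.1) u.2.
have mixB n h u : (B `|` before c n) (mix n h u).
  rewrite /mix; case: ifP => [lt|_]; last by left; apply/IB/baseP.
  by right; exists u.1 => //; exists u.2.
suff H n h : n <= N -> {in gtn N &, injective h} -> P (mix n h).
  by apply: dP (H N id (leqnn N) _) => // u uN; rewrite /mix uN.
elim: n h => [|n IH] h nN hinj; first exact: Hh.
have mixS : mix n.+1 h = fun u => env (c n) (mix n h) (at_row n u).
  apply: funext => -[t y]; rewrite /mix /at_row /= ltnS leq_eqVlt.
  by case: eqP => [->|_].
rewrite mixS; apply/(avg_iff UU (Hc n) (P := fun y => P (fun u => env y (mix n h) (at_row n u)))).
  by apply: dfn_at_row (mixB n h); apply: dfn_mono HP => x; left.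
have Uj : U [set j | forall t : 'I_N, h t < j] by apply: (ultra_fin UU) => t; exact: nU.2.
apply: (ultraS UU) Uj => j hj.
pose h' t := if t == n then j else h t.
have h'inj : {in gtn N &, injective h'}.
  move=> s t; rewrite /h' !inE => sN tN.
  case: (eqVneq s n) => [->|sn]; case: (eqVneq t n) => [->|tn] //.
  - by move=> E; have := hj (Ordinal tN); rewrite /= -E ltnn.
  - by move=> E; have := hj (Ordinal sN); rewrite /= E ltnn.
  - exact: hinj.
have := IH h' (ltnW nN) h'inj; congr P; apply: funext => -[t y].
rewrite /mix /at_row /h' /=; case: (ltngtP t n) => //= lt; rewrite ?lt //.
by rewrite ltnNge (ltnW lt).
Qed.

(* [D] is the set of parameters over which heirs are controlled: [A] realizes
   every type over [D] and finitely many elements of [A]. *)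
Lemma kim_average (X : finType) N (R : (X -> M) -> ('I_N.+1 * Y -> M) -> Prop) A D c k :
  small K A -> model_set A -> base beta `<=` D -> D `<=` A ->
  (forall (m : nat -> M) l (a : 'I_l -> M), (forall i, A (a i)) ->
      exists2 m', (forall i, A (m' i)) & eqv D (env m a) (env m' a)) ->
  dfn2 D R -> morley U beta A c ->
  (forall c', morley U beta A c' -> forall T, exists x, forall t, t < T ->
     R x (fun w => c' (t * N.+1 + val w.1) w.2)) ->
  ~ fdiv k R A (fun w => c (val w.1) w.2).
Proof.
move=> sA mA ID DA satA HR Hc con Hk.
have [a0 Aa0] := model_inh mA.
have IA : base beta `<=` A by move=> x /ID/DA.
have HRA : dfn2 A R := dfn_mono DA HR.
pose blk (c : nat -> Y -> M) (w : 'I_N.+1 * Y) := c (val w.1) w.2.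
have blk_eqv c' : morley U beta A c' -> eqv A (blk c) (blk c').
  move=> Hc'; have := eqv_ren (f := fun w : 'I_N.+1 * Y => (val w.1, w.2)) (morley_eqv UU IA Hc Hc').
  exact.
have [||| b [Bs [Qb HBs HT]]] := @array_sequence L K M mon nt X _ 1 (fun=> R) (fun=> k) A a0
  (fun B w => exists2 c', morley U beta (A `|` B) c' & w = blk c') sA Aa0.
- by [].
- move=> B sB; have [|c' Hc'] := @morley_exists L K M mon nat U Y beta UU (A `|` B).
    exact: small_setU.
  by exists (blk c'), c'.
- move=> B w [c' Hc' ->].
  have AB : A `<=` A `|` B by move=> x; left.
  have IAB : base beta `<=` A `|` B by move=> x /IA; left.
  have fsI : fs (base beta) (A `|` B) (range (blk c')).
    apply: fs_mono (morley_fs UU (N := N.+1) IAB Hc') => // _ [[t y] _ <-].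
    by exists (val t); [exact: ltn_ord|exists y].
  split; first by move=> V e P eC HP Pe; have [a Ia Pa] := fsI V e P eC HP Pe; exists a => // v; exact: IA.
  (* The heir argument. If a set over [A] and [B] contained the block but no long row, its
     parameters from [B] could be replaced by elements of [A] of the same type over [D] and [a]. The
     block, a coheir of [D], does not notice the change, and the resulting set over [A] contradicts
     [Hk]. *)
  move=> _ _ P HP Pw l; apply: contrapT => nl.
  have [m [d [Q [dB HQ PQ]]]] := dfn_split HP.
  have [la [a [phi [Aa Hphi]]]] := dfn_formula HQ.
  pose d' i := if insub i is Some j then d j else a0.
  have [m' Am' Em] := satA d' la a Aa.
  pose E (z : nat + 'I_la -> M) (w : 'I_N.+1 * Y -> M) :=
    sat phi (env (env w (fun i : 'I_m => z (inl (val i)))) (fun i => z (inr i))).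
  have HE : dfn2 D E.
    have := dfn_ren (A := D) (fun u : ('I_N.+1 * Y) + 'I_m + 'I_la => match u with
      | inl (inl w) => inr w | inl (inr i) => inl (inl (val i)) | inr i => inl (inr i) end
      : (nat + 'I_la) + ('I_N.+1 * Y)) (formula_dfn D phi).
    apply: dfn_ext => u; rewrite /E; set e1 := (X in sat _ X <-> _); set e2 := (X in _ <-> sat _ X).
    by suff -> : e1 = e2 by []; apply: funext => -[[]|].
  have EP e : E (env d' a) e <-> P e.
    rewrite PQ Hphi /E; set e1 := (X in sat _ X <-> _); set e2 := (X in _ <-> sat _ X).
    suff -> : e1 = e2 by [].
    apply: funext => -[[w'|i]|i] //=; rewrite /d'.
    by rewrite (insubT (fun i => i < m) (ltn_ord i)) /=; congr d; exact: val_inj.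
  pose G (z : nat + 'I_la -> M) (w : 'I_N.+1 * Y -> M) := E z w /\ ~ hasrow k R l (E z).
  have HG : dfn2 D G.
    apply: dfn_and => //; apply: dfn_not; apply: hasrow_dfn => //.
    exact: (dfn_binary (fun z => inl (inl z)) (fun w => inr w) HE).
  have fsD : fs D (A `|` B) (range (blk c')).
    by move=> V e P' eC HP' Pe; have [a' Ia Pa] := fsI V e P' eC HP' Pe; exists a' => // v; exact: ID.
  have DAB : D `<=` A `|` B by move=> x /DA; left.
  have ABd i : (A `|` B) (env d' a i).
    case: i => [i|i]; last by left; exact: Aa.
    by rewrite /= /d'; case: (insub i) => [j|]; [right; exact: dB|left].
  have ABm i : (A `|` B) (env m' a i) by case: i => i; left; [exact: Am'|exact: Aa].
  have Cw w' : range (blk c') (blk c' w') by exists w'.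
  have [|E' nE'] := fs_inv fsD DAB ABd ABm Cw Em HG.
    split; first exact/EP.
    by move=> H; apply: nl; apply: hasrow_mono H => // y /EP.
  have HEm : dfn A (E (env m' a)).
    by have := dfn_subst_l (d := env m' a) (dfn_mono DA HE); apply=> -[].
  apply: nE'; apply: (Hk _ HEm).
  exact: (eqv_sym (blk_eqv c' (morley_mono AB Hc'))) HEm E'.
have [T HTT] := HT 0 isT.
have /choice[cs Hcs] : forall t, exists c', morley U beta (A `|` Bs t) c' /\ b t = blk c'.
  by move=> t; have [c' ? ?] := Qb t; exists c'.
(* Concatenation of the blocks. Block [t] is Morley over [A] and [Bs t], which contains the earlier
   blocks, so the whole is Morley over [A]. *)
pose cc tau := cs (tau %/ N.+1) (tau %% N.+1).
have Mcc : morley U beta A cc.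
  move=> tau; apply: avg_mono ((Hcs _).1 _) => x [Ax|[s stau [y _ <-]]]; first by left; left.
  rewrite /cc; have := leq_div2r N.+1 (ltnW stau); rewrite leq_eqVlt => /orP[/eqP E|lt].
    right; exists (s %% N.+1); last by rewrite -E; exists y.
    by move: stau; rewrite {1}(divn_eq s N.+1) {1}(divn_eq tau N.+1) E ltn_add2l.
  left; right; apply: (HBs _ _ lt); rewrite (Hcs _).2.
  by exists (Ordinal (ltn_pmod s (ltn0Sn N)), y).
have [x Hx] := con cc Mcc T.
apply: (HTT (iota 0 T)); rewrite ?iota_uniq ?size_iota //; exists x => t.
rewrite mem_iota add0n => /andP[_ tT]; have := Hx t tT; congr (R _ _).
apply: funext => -[i y]; rewrite /cc /= divnMDl // modnMDl divn_small // modn_small //.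
by rewrite addn0 (Hcs t).2.
Qed.

End Generic.

(** * Bounded non-forking implies NIP *)

Lemma total_order_exists (T : eqType) :
  exists le : rel T, [/\ total le, transitive le & antisymmetric le].
Proof.
have [R wo] := wochoice.well_ordering_principle T.
have woT : wochoice.wo_chain R predT := wochoice.withinW wo.
have anti : antisymmetric R.
  by move=> x y; apply: (wochoice.wo_chain_antisymmetric woT).
exists R; split=> //; first by move=> x y; exact: (wochoice.wo_chainW woT).
move=> y x z Rxy Ryz.
have [|m [[mA mlb] _]] := wo (mem [:: x; y; z]); first by exists x; rewrite inE eqxx.
have /and4P[mx my mz _] : all (R m) [:: x; y; z] by apply/allP => v; exact: mlb.
move: mA mx my mz; rewrite !inE => /or3P[] /eqP -> // Rx Ry Rz.
  by have -> : x = y by apply: anti; rewrite Rxy.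
by have <- : y = z by apply: anti; rewrite Ryz.
Qed.

Section Bounded.
Variables (L : language) (K : Type) (M : structure L) (n : nat).
Hypotheses (mon : monster K M) (nt : ntp2 M).
Implicit Types A B C D : set M.

Notation point := ('I_n -> M).

(** Forking over [A] for an arbitrary set of points, since a pattern is not given as a single
    [pformula]. *)
Definition covered A (S : set point) := exists m (psi : 'I_m -> pformula M n),
  (forall i, divides A (psi i)) /\ forall x, S x -> exists i, psat x (psi i).

Lemma covered_sub A (S S' : set point) : S' `<=` S -> covered A S -> covered A S'.
Proof. by move=> SS [m [psi [H1 H2]]]; exists m, psi; split=> // x /SS /H2. Qed.

Lemma covered_or A (S1 S2 S : set point) : (forall x, S x -> S1 x \/ S2 x) ->
  covered A S1 -> covered A S2 -> covered A S.
Proof.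
move=> SS [m1 [psi1 [H1 K1]]] [m2 [psi2 [H2 K2]]].
exists (m1 + m2), (fun i => match fintype.split i with inl i => psi1 i | inr i => psi2 i end).
split=> [i|x /SS [/K1|/K2] [i Hi]]; first by case: (fintype.split i).
  by exists (unsplit (inl i)); rewrite unsplitK.
by exists (unsplit (inr i)); rewrite unsplitK.
Qed.

Lemma divides_aut A g (phi : pformula M n) : aut A g -> divides A phi ->
  divides A (PFormula (pf_form phi) (fun j => g (pf_par phi j))).
Proof.
move=> ag [k [b [Hb kb]]]; exists k, b; split=> // i psi Apsi.
rewrite (Hb i psi Apsi) /=; exact: aut_dfn ag (pf_dfn Apsi).
Qed.

Lemma covered_aut A g (S S' : set point) : aut A g ->
  (forall x, S' (fun v => g (x v)) -> S x) -> covered A S -> covered A S'.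
Proof.
move=> ag SS [m [psi [H1 H2]]].
exists m, (fun i => PFormula (pf_form (psi i)) (fun j => g (pf_par (psi i) j))).
split=> [i|x S'x]; first exact: divides_aut.
have [g' [ag' gK g'K]] := aut_inv ag.
have [|i Hi] := H2 (fun v => g' (x v)).
  by apply: SS; congr S': S'x; apply: funext => v; rewrite g'K.
exists i; move: Hi; rewrite /psat (sat_aut _ _ ag.1) /=.
set e1 := (X in sat _ X -> _); set e2 := (X in _ -> sat _ X).
by suff -> : e1 = e2 by []; apply: funext => -[v|j] //; rewrite /e1 /e2 /= g'K.
Qed.

Lemma divides_fdiv A (phi : pformula M n) : divides A phi ->
  exists k, fdiv k (fun x y => sat (pf_form phi) (env x y)) A (pf_par phi).
Proof.
move=> [k [b [Hb kb]]]; exists k => P HP Pphi l; exists b => [i _|s us ss _].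
  have [psi Apsi E] := dfn_pf HP.
  by apply/E/(Hb i psi Apsi)/E.
exact: kb.
Qed.

Section Patterns.
Variables (k : nat) (phi : formula L ('I_n + 'I_k)).

Definition pattern (s : seq (pformula M n)) (eta : nat -> Prop) N (c : nat -> 'I_k -> M) :
    set point :=
  [set x | (forall q, List.In q s -> psat x q) /\
     forall i, i < N -> (sat phi (env x (c i)) <-> eta i)].

(** A covered pattern would divide over [A] by [fork_fdiv]. But its copies on successive blocks of a
    Morley sequence are jointly consistent, by genericity and the hypothesis [free], which
    [kim_average] excludes. *)
Lemma pattern_not_covered U (beta : nat -> 'I_k -> M) A D c s eta N :
  nonprincipal U -> small K A -> model_set A -> base beta `<=` D -> D `<=` A ->
  (forall (m : nat -> M) l (a : 'I_l -> M), (forall i, A (a i)) ->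
      exists2 m', (forall i, A (m' i)) & eqv D (env m a) (env m' a)) ->
  (forall q, List.In q s -> Defs.over D q) ->
  (forall N eta, exists x, pattern s eta N beta x) ->
  morley U beta A c -> ~ covered A (pattern s eta N c).
Proof.
move=> nU sA mA ID DA satA Ds free Hc cov.
(* One more condition only shrinks the pattern and makes its block nonempty, as the division into
   blocks of length [N.+1] requires. *)
have {cov} [m [psi [Hpsi cov]]] : covered A (pattern s eta N.+1 c).
  by apply: covered_sub cov => x [H1 H2]; split=> // i iN; apply: H2; exact: ltnW.
pose R (x : point) (y : 'I_N.+1 * 'I_k -> M) := (forall q, List.In q s -> psat x q) /\
  forall i : 'I_N.+1, sat phi (env x (fun j => y (i, j))) <-> eta i.
have HR : dfn2 D R.
  apply: dfn_and; first by apply: dfn_In => q /Ds /pf_dfn; exact: dfn_ren.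
  apply: dfn_fin => i; apply: dfn_iff; last exact: dfn_const.
  have := dfn_ren (A := D) (fun u : 'I_n + 'I_k => match u with inl v => inl v
     | inr j => inr (i, j) end : 'I_n + ('I_N.+1 * 'I_k)) (formula_dfn D phi).
  apply: dfn_ext => u; set e1 := (X in sat _ X <-> _); set e2 := (X in _ <-> sat _ X).
  by suff -> : e1 = e2 by []; apply: funext => -[].
pose Z := {i : 'I_m & 'I_(pf_len (psi i))}.
pose W := ('I_N.+1 * 'I_k + Z)%type.
pose b : W -> M := env (fun w => c (val w.1) w.2) (fun z => pf_par (psi (tag z)) (tagged z)).
pose R1 i (x : point) (y : W -> M) := if insub i is Some i0 then
   sat (pf_form (psi i0)) (env x (fun j => y (inr (Tagged (fun i => 'I_(pf_len (psi i))) j)))) else False.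
have [k1 Hk1] := choice (fun i => divides_fdiv (Hpsi i)).
pose k2 i := if insub i is Some i0 then k1 i0 else 0.
have [q Hq] : exists q, fdiv q (fun x (y : W -> M) => R x (fun w => y (inl w))) A b.
  apply: (@fork_fdiv L K M mon nt _ W m R1 k2 A b) => //.
  - move=> i im; rewrite /R1 (insubT (fun i => i < m) im) /=.
    have := dfn_ren (A := A) (fun u : 'I_n + 'I_(pf_len (psi (Ordinal im))) => match u with inl v => inl v
      | inr j => inr (inr (Tagged (fun i => 'I_(pf_len (psi i))) j)) end : 'I_n + W)
      (formula_dfn A (pf_form (psi (Ordinal im)))).
    apply: dfn_ext => u; set e1 := (X in sat _ X <-> _); set e2 := (X in _ <-> sat _ X).
    by suff -> : e1 = e2 by []; apply: funext => -[].
  - exact: (dfn_binary (fun v => inl v) (fun w => inr (inl w)) (dfn_mono DA HR)).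
  - move=> i im P HP Pb l.
    rewrite /R1 /k2 (insubT (fun i => i < m) im) /=.
    pose P' (y : 'I_(pf_len (psi (Ordinal im))) -> M) := exists y' : W -> M,
      P y' /\ forall j, y' (inr (Tagged (fun i => 'I_(pf_len (psi i))) j)) = y j.
    have HP' : dfn A P'.
      apply: dfn_ex; apply: dfn_and; first exact: (dfn_ren (fun w => inr w) HP).
      by apply: dfn_fin => j; exact: dfn_eq.
    have [|y yP ry] := Hk1 (Ordinal im) P' HP' _ l; first by exists b.
    have /choice[y' Hy'] : forall i, exists y', i < l -> P y' /\
        forall j, y' (inr (Tagged (fun i => 'I_(pf_len (psi i))) j)) = y i j.
      move=> i0; have [il|] := boolP (i0 < l); last by exists b.
      by have [y' Hy'] := yP i0 il; exists y'.
    exists y' => [i0 il|s' us ss sl [x Hx]]; first by have [] := Hy' i0 il.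
    apply: (ry s' us ss sl); exists x => i0 si; have := Hx i0 si; congr (sat _ (env _ _)).
    by apply: funext => j; have [_ ->] := Hy' i0 (sl i0 si).
  - move=> x [x1 x2]; have [|i Hi] := cov x.
      by split=> // i iN; exact: (x2 (Ordinal iN)).
    by exists i => //; rewrite /R1 (insubT (fun i => i < m) (ltn_ord i)) /=;
      move: Hi; rewrite (_ : Sub _ _ = i) //; apply: val_inj.
apply: (@kim_average L K M mon nt U _ beta nU _ N R A D c q) => //; last first.
  move=> P HP Pc l.
  have [y yP ry] := Hq (fun y => P (fun w => y (inl w))) (dfn_ren (fun w => inl w) HP) Pc l.
  by exists (fun i w => y i (inl w)).
move=> c' Hc' T.
pose P (e : nat * 'I_k -> M) := exists x : point, (forall q, List.In q s -> psat x q) /\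
  forall t, t \in iota 0 (T * N.+1) -> (sat phi (env x (fun j => e (t, j))) <-> eta (t %% N.+1)).
have IA : base beta `<=` A by move=> x /ID/DA.
have [||h hinj|x [x1 x2]] := @morley_generic L M U _ beta nU A c' (T * N.+1) P IA Hc'.
- apply: dfn_ex; apply: dfn_and.
    by apply: dfn_In => q0 /Ds /pf_dfn /(dfn_mono DA); exact: dfn_ren.
  apply: dfn_mem => t _; apply: dfn_iff; last exact: dfn_const.
  have := dfn_ren (A := A) (fun u : 'I_n + 'I_k => match u with inl v => inr v
     | inr j => inl (t, j) end : (nat * 'I_k) + 'I_n) (formula_dfn A phi).
  apply: dfn_ext => u; set e1 := (X in sat _ X <-> _); set e2 := (X in _ <-> sat _ X).
  by suff -> : e1 = e2 by []; apply: funext => -[].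
- move=> e e' ee [x [x1 x2]]; exists x; split=> // t tT.
  rewrite -x2 // (_ : (fun j => e' (t, j)) = (fun j => e (t, j))) //.
  by apply: funext => j; rewrite ee //; move: tT; rewrite mem_iota.
(* The periodic pattern on [T * N.+1] terms is transported to the distinct [beta (h t)]; injectivity
   of [h] prevents conflicting demands. *)
- pose eta' i := exists2 t, t < T * N.+1 & h t = i /\ eta (t %% N.+1).
  have [x [x1 x2]] := free (\max_(t < T * N.+1) h t).+1 eta'.
  exists x; split=> // t; rewrite mem_iota add0n => /andP[_ tT].
  apply: (iff_trans (x2 (h t) _)); first by rewrite ltnS; exact: (@leq_bigmax _ (fun t : 'I_(T * N.+1) => h t) (Ordinal tT)).
  split=> [[t' t'T [E Ht']]|Ht]; last by exists t.
  by have <- : t' = t by apply: hinj.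
exists x => t tT; split=> // i; have := x2 (t * N.+1 + i).
rewrite mem_iota modnMDl modn_small //; apply=> /=.
rewrite add0n; apply: (@leq_trans (t.+1 * N.+1)); last by rewrite leq_mul2r tT orbT.
by rewrite mulSn addnC ltn_add2r.
Qed.

End Patterns.
End Bounded.

(** * Morley sequences along arbitrary linear orders *)

Section Indexed.
Variables (L : language) (K : Type) (M : structure L).
Hypotheses (mon : monster K M).
Implicit Types A B C D : set M.

(** Compactness: finitely many conditions mention finitely many indices, which are sorted and sent
    to an initial segment of [c]; indiscernibility makes all increasing tuples alike. *)
Lemma morley_indexed (T : eqType) (le : rel T) (t0 : T) J U (Y : finType)
    (beta : J -> Y -> M) A c :
  total le -> transitive le -> antisymmetric le -> smT K T ->
  ultra U -> small K A -> base beta `<=` A -> morley U beta A c ->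
  exists e : T -> Y -> M, forall l, sorted le l -> uniq l ->
    eqv A (fun u : 'I_(size l) * Y => c (val u.1) u.2) (fun u => e (nth t0 l (val u.1)) u.2).
Proof.
move=> le_total le_trans le_anti sT UU sA IA Hc.
have slK : strong_limit K by case: mon.
have natK : small K [set: nat] by case: mon => _ [].
pose S l (P : ('I_(size l) * Y -> M) -> Prop) (E : T * Y -> M) :=
  P (fun u => E (nth t0 l (val u.1), u.2)).
have [|Q [l [P [_ _ HP _ ->]]]|s sS|E HE] := @compactness L K M mon (T * Y) A
  [set Q | exists l P, [/\ sorted le l, uniq l, dfn A P,
     P (fun u : 'I_(size l) * Y => c (val u.1) u.2) & Q = S l P]] _ sA.
- by apply: sm_prod => //; exact: sm_fin.
- exact: (dfn_ren (fun u : 'I_(size l) * Y => (nth t0 l (val u.1), u.2)) HP).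
- have [b0 Hb0] : exists b0 : seq T, forall Q, List.In Q s -> exists l P,
      [/\ sorted le l, uniq l, dfn A P, P (fun u : 'I_(size l) * Y => c (val u.1) u.2) &
      Q = S l P] /\ {subset l <= b0}.
    elim: s sS => [|Q s IH] sS; first by exists [::].
    have [|b0 Hb0] := IH; first by move=> Q' Q's; apply: sS; right.
    have [l [P HP]] := sS Q (or_introl erefl).
    exists (l ++ b0) => Q' [<-|/Hb0 [l' [P' [HP' lb]]]].
      by exists l, P; split=> // x xl; rewrite mem_cat xl.
    by exists l', P'; split=> // x /lb xb; rewrite mem_cat xb orbT.
  pose b := sort le (undup b0).
  have sb : sorted le b := sort_sorted le_total _.
  exists (fun u => c (index u.1 b) u.2) => Q /Hb0 [l [P [[sl ul HP Pc ->] lb]]].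
  have {}lb t : t \in l -> t \in b by move=> /lb tb; rewrite mem_sort mem_undup.
  (* Positions in [l] go to positions in [b]; beyond [l] the values continue past [size b], because
     [morley_sub] wants a map increasing on all of [nat]. *)
  pose h t := if t < size l then index (nth t0 l t) b else size b + t.
  have hm i j : i < j -> h i < h j.
    move=> ij; rewrite /h; have [il|il] := ltnP i (size l); have [jl|jl] := ltnP j (size l).
    - have ib : nth t0 l i \in b by apply: lb; exact: mem_nth.
      have jb : nth t0 l j \in b by apply: lb; exact: mem_nth.
      have lij := sorted_ltn_nth le_trans t0 sl i j il jl ij.
      case: ltngtP => // [ji|E].
        have lji := sorted_ltn_index le_trans sb _ _ jb ib ji.
        have /eqP : nth t0 l i = nth t0 l j by apply: le_anti; rewrite lij lji.
        by rewrite nth_uniq // (ltn_eqF ij).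
      have /eqP : nth t0 l i = nth t0 l j by rewrite -(nth_index t0 ib) E nth_index.
      by rewrite nth_uniq // (ltn_eqF ij).
    - apply: (@leq_trans (size b)); last exact: leq_addr.
      by rewrite index_mem; apply: lb; exact: mem_nth.
    - by move: (leq_ltn_trans il (ltn_trans ij jl)); rewrite ltnn.
    - by rewrite ltn_add2l.
  have := eqv_ren (f := fun u : 'I_(size l) * Y => (val u.1, u.2))
    (morley_eqv UU IA Hc (morley_sub hm Hc)).
  move=> /(_ P HP Pc); rewrite /S /=.
  by congr P; apply: funext => -[i y]; rewrite /h /= ltn_ord.
exists (fun t y => E (t, y)) => l sl ul P HP Pc.
by apply: (HE (S l P)); exists l, P.
Qed.

End Indexed.

(** * The type p' and its many non-forking extensions *)

Section BoundedNip.
Variables (L : language) (K : Type) (M : structure L) (n : nat).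
Hypotheses (mon : monster K M) (nt : ntp2 M).
Implicit Types A B C D : set M.

Let slK : strong_limit K. Proof. by case: mon. Qed.
Let natK : small K [set: nat]. Proof. by case: mon => _ []. Qed.

Lemma ultra_global_type (V : set (set ('I_n -> M))) : ultra V ->
  complete_type setT [set q : pformula M n | V (fun x => psat x q)].
Proof.
move=> UV; split; first split.
- by [].
- move=> F /finite_setE[s ->] sF.
  have [x Hx] : exists x, forall q, List.In q s -> psat x q.
    by apply: (ultra_ex UV); apply: (ultra_In UV) => q /sF.
  by exists x.
- move=> q _; have [H|H] := ultraVC UV (fun x => psat x q); by [left|right].
Qed.

Lemma bounded_nip C (p : set (pformula M n)) : small K C -> partial_type C p ->
  (forall (D : set M) (p' : set (pformula M n)),
     small K D -> C `<=` D -> complete_type D p' -> p `<=` p' ->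
     small K [set q | global_nonforking_extension D p' q]) ->
  nip_type p.
Proof.
move=> sC [Cp _] bounded [k [phi [a [bs [Ha Hab]]]]].
(* dualize: [beta i] is shattered by realizations of [p], coded by bit strings *)
pose beta (i : nat) : 'I_k -> M :=
  bs [set j | nth false (odflt [::] (unpickle j : option (seq bool))) i].
have free eta N : exists x, realizes x p /\
    forall i, i < N -> (sat phi (env x (beta i)) <-> eta i).
  pose w := mkseq (fun i => `[< eta i >]) N.
  exists (a (pickle w)); split=> // i iN.
  have Ew : nth false (odflt [::] (unpickle (pickle w) : option (seq bool))) i = `[< eta i >].
    by rewrite pickleK [odflt _ _]/= nth_mkseq.
  apply: (iff_trans (Hab (pickle w) _)).
  change (nth false (odflt [::] (unpickle (pickle w) : option (seq bool))) i <-> eta i).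
  by rewrite Ew; split=> /asboolP.
have [U nU] := nonprincipal_exists.
have UU := nU.1.
pose iota : nat * 'I_k + {x | C x} -> M := env (fun u => beta u.1 u.2) (@elt _ _ C).
have [A [sA CA IA mA satA]] : exists A, [/\ small K A, C `<=` A, range iota `<=` A, model_set A &
    forall (m : nat -> M) l (a : 'I_l -> M), (forall i, A (a i)) ->
      exists2 m', (forall i, A (m' i)) & eqv (range iota) (env m a) (env m' a)].
  apply: (closure mon) => //; apply: sm_sum => //; last exact/small_smT.
  by apply: sm_prod => //; [exact: sm_nat|exact: sm_fin].
have ID : base beta `<=` range iota by move=> _ [u _ <-]; exists (inl u).
have CD : C `<=` range iota by move=> x Cx; exists (inr (exist _ x Cx)).
have bA : base beta `<=` A by move=> x /ID/IA.
have [c Hc] := @morley_exists L K M mon nat U _ beta UU A sA.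
have NF s eta N : (forall q, List.In q s -> p q) -> ~ covered A (pattern phi s eta N c).
  move=> sp; apply: (pattern_not_covered mon nt nU sA mA ID IA satA _ _ Hc).
    by move=> q /sp /Cp Cq j; exact/CD/Cq.
  move=> N' eta'; have [x [xp Hx]] := free eta' N'.
  by exists x; split=> // q /sp; exact: xp.
(* Compatibility with all finite patterns along [c], in the strong sense that none of the resulting
   sets is covered by dividing formulas. *)
pose good (H : set (pformula M n)) := H `<=` @Defs.over L M n A /\
  forall s eta N, (forall q, List.In q s -> p q \/ H q) -> ~ covered A (pattern phi s eta N c).
have [F Fgood Ftot|H [[HA Hgood] Hmax]] := @Zorn_bigcup _ good.
  split=> [q [G FG Gq]|s eta N Hs]; first exact: (Fgood _ FG).1 _ Gq.
  have [[G0 FG0]|F0] := pselect (F !=set0); last first.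
    apply: NF => q /Hs [//|[G FG _]]; by case: F0; exists G.
  have [G FG GU] : exists2 G, F G & forall q, List.In q s -> p q \/ G q.
    elim: s Hs => [|q s IH] Hs; first by exists G0.
    have [|G FG GU] := IH; first by move=> q' q's; apply: Hs; right.
    have [pq|[G' FG' Gq]] := Hs q (or_introl erefl).
      by exists G => // q' [<-|/GU//]; left.
    have [GG|GG] := Ftot _ _ FG FG'.
      by exists G' => // q' [<-|/GU [|/GG]]; [right|left|right].
    by exists G => // q' [<-|/GU//]; right; exact: GG.
  exact: (Fgood _ FG).2.
pose p' := p `|` H.
have p'A : p' `<=` @Defs.over L M n A.
  by move=> q [/Cp Cq j|/HA//]; exact/CA/Cq.
have p'good s eta N : (forall q, List.In q s -> p' q) -> ~ covered A (pattern phi s eta N c).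
  by move=> Hs; exact: Hgood.
have p'compl : complete_type A p'.
  split; first split=> //.
    move=> F' /finite_setE[s ->] sF.
    apply: contrapT => nx; apply: (p'good s (fun=> True) 0 sF).
    exists 0, (fun i : 'I_0 => match notF (ltn_ord i) with end); split=> [[]//|x [Hx _]].
    by case: nx; exists x.
  (* If neither [q] nor its negation can be added, each is obstructed by a pattern. An automorphism
     over [A] shifts the second pattern past the first [N1] terms of [c]; the two together form one
     pattern, covered by cases on [q], against [p'good]. *)
  move=> q Aq; apply: contrapT => /not_orP[nq nnq].
  have notgood r : Defs.over A r -> ~ p' r -> exists s eta N,
      (forall q, List.In q s -> p' q) /\
      covered A [set x | pattern phi s eta N c x /\ psat x r].
    move=> Ar nr; apply: contrapT => none.
    apply: (Hmax (H `|` [set r])).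
      split; first by move=> r'; left.
      by move=> /(_ r (or_intror erefl)) Hr; apply: nr; right.
    split=> [r' [/HA//|->//]|s eta N Hs cov]; apply: none.
    have [t tp' ts] : exists2 t, (forall q, List.In q t -> p' q) &
        forall x, (forall q, List.In q t -> psat x q) -> psat x r -> forall q, List.In q s -> psat x q.
      elim: s Hs {cov} => [|r' s IH] Hs; first by exists [::].
      have [|t tp' ts] := IH; first by move=> q' q's; apply: Hs; right.
      have [r'E|r'p] : r' = r \/ p' r'.
        by have [?|[?|?]] := Hs r' (or_introl erefl); [right; left|right; right|left].
        exists t => // x Hx rx q' [<-|q's]; [by rewrite r'E|exact: ts].
      exists (r' :: t) => [q' [<-//|/tp'//]|x Hx rx q' [<-|q's]]; first by apply: Hx; left.
      by apply: (ts x _ rx q' q's) => q'' q''t; apply: Hx; right.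
    exists t, eta, N; split=> //; apply: covered_sub cov => x [[x1 x2] xr].
    by split=> //; exact: ts.
  have [s1 [eta1 [N1 [sp1 cov1]]]] := notgood q Aq nq.
  have [s2 [eta2 [N2 [sp2 cov2]]]] := notgood (pneg q) Aq nnq.
  pose eta i := if i < N1 then eta1 i else eta2 (i - N1).
  apply: (p'good (s1 ++ s2) eta (N1 + N2)); first by move=> r /In_cat[/sp1|/sp2].
  have [g ag gE] : exists2 g, aut A g & forall u : nat * 'I_k, g (c u.1 u.2) = c (N1 + u.1) u.2.
    apply: (homogeneity mon sA).
      by apply: sm_prod => //; [exact: sm_nat|exact: sm_fin].
    have hm i j : i < j -> N1 + i < N1 + j by rewrite ltn_add2l.
    exact: (morley_eqv UU bA Hc (morley_sub hm Hc)).
  have [g' [ag' gK g'K]] := aut_inv ag.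
  pose S2 : set ('I_n -> M) := [set x | pattern phi s2 eta2 N2 (fun t => c (N1 + t)) x /\ psat x (pneg q)].
  have cov2' : covered A S2.
    apply: (covered_aut ag) cov2 => x [[x1 x2] xq]; split; last first.
      exact: (aut_dfn x ag (pf_dfn (phi := pneg q) Aq)).2.
    split=> [r rs|i iN].
      by apply/(aut_dfn x ag (pf_dfn (p'A _ (sp2 _ rs)))); exact: x1.
    rewrite -(x2 i iN) (sat_aut _ _ ag.1); set e1 := (X in sat _ X <-> _);
      set e2 := (X in _ <-> sat _ X); suff -> : e1 = e2 by [].
    by apply: funext => -[v|j]; rewrite /e1 /e2 //= (gE (i, j)).
  apply: covered_or cov1 cov2' => x [x1 x2].
  have [xq|nxq] := pselect (psat x q); [left|right].
    split=> //; split=> [r rs|i iN]; first by apply: x1; apply/In_cat; left.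
    by have := x2 i (ltn_addr _ iN); rewrite /eta iN.
  split=> //; split=> [r rs|i iN]; first by apply: x1; apply/In_cat; right.
  have := x2 (N1 + i); rewrite ltn_add2l /eta addKn.
  have -> : (N1 + i < N1) = false by rewrite ltnNge leq_addr.
  by move=> H'; exact: H'.
have pp' : p `<=` p' by move=> q; left.
have /small_smT sQ := bounded A p' sA CA p'compl pp'.
(* The index set is the set to be shown too large; the extra point provides the default [t0]. *)
pose T := ({q | global_nonforking_extension A p' q} + unit)%type.
have sT : smT K {classic T} := sm_sum slK sQ (sm_fin natK unit).
have [le [le_total le_trans le_anti]] := total_order_exists {classic T}.
pose t0 : {classic T} := inr tt.
have [e He] := @morley_indexed L K M mon _ le t0 nat U _ beta A c le_total le_trans le_anti sT UU sA bA Hc.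
have extend (s : {classic T} -> Prop) : exists q, global_nonforking_extension A p' q /\
    forall t, q (PFormula phi (e t)) <-> s t.
  pose St t : set ('I_n -> M) := fun x => sat phi (env x (e t)) <-> s t.
  (* Finite satisfiability says that a finite part of [p'] with finitely many conditions on the
     [e t] is not covered. Sorted, those [e t] are conjugate over [A] to an initial segment of [c],
     where [p'good] applies. Excluding all dividing formulas excludes forking, because an
     ultrafilter meets finite covers. *)
  have [S0 HS0|V UV HV] := @ultra_exists ('I_n -> M) [set S |
     (exists2 q, p' q & S = fun x => psat x q) \/ (exists t, S = St t) \/
     (exists2 q, divides A q & S = fun x => ~ psat x q)].
    have [s1 [l [m [psi [s1p' psiD HS]]]]] : exists s1 (l : seq {classic T}) m
       (psi : 'I_m -> pformula M n),
       [/\ forall q, List.In q s1 -> p' q, forall i, divides A (psi i) &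
        forall x, (forall q, List.In q s1 -> psat x q) -> (forall t, t \in l -> St t x) ->
          (forall i, ~ psat x (psi i)) -> forall S, List.In S S0 -> S x].
      elim: S0 HS0 => [|S S0 IH] HS0.
        exists [::], [::], 0, (fun i : 'I_0 => match notF (ltn_ord i) with end); split=> //; by case.
      have [|s1 [l [m [psi [s1p' psiD HS]]]]] := IH; first by move=> S' S'S; apply: HS0; right.
      have [[q p'q E]|[[t E]|[q Dq E]]] := HS0 S (or_introl erefl).
      - exists (q :: s1), l, m, psi; split=> // [q' [<-//|/s1p'//]|x x1 x2 x3 S' [<-|S'S]].
          by rewrite E; apply: x1; left.
        by apply: HS S'S => // q' q's; apply: x1; right.
      - exists s1, (t :: l), m, psi; split=> // x x1 x2 x3 S' [<-|S'S].
          by rewrite E; apply: x2; rewrite mem_head.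
        by apply: HS S'S => // t' t'l; apply: x2; rewrite inE t'l orbT.
      - exists s1, l, m.+1, (fun i => if unlift ord0 i is Some j then psi j else q).
        split=> // [i|x x1 x2 x3 S' [<-|S'S]]; first by case: unlift.
          by rewrite E; have := x3 ord0; rewrite unlift_none.
        by apply: HS S'S => // i; have := x3 (lift ord0 i); rewrite liftK.
    apply: contrapT => nx.
    pose b := sort le (undup l).
    have ub : uniq b by rewrite sort_uniq undup_uniq.
    have [g ag gE] := homogeneity mon sA (sm_fin natK _) (He b (sort_sorted le_total _) ub).
    have [g' [ag' gK g'K]] := aut_inv ag.
    apply: (p'good s1 (fun i => s (nth t0 b i)) (size b) s1p').
    apply: (covered_aut (S := [set x | (forall q, List.In q s1 -> psat x q) /\
        forall t, t \in l -> St t x]) ag').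
      move=> x [x1 x2]; split=> [r rs|t tl].
        by apply/(aut_dfn x ag' (pf_dfn (p'A _ (s1p' _ rs)))); exact: x1.
      have tb : t \in b by rewrite mem_sort mem_undup.
      have ib : index t b < size b by rewrite index_mem.
      have := x2 _ ib; rewrite nth_index // => H'; apply: iff_trans H'.
      rewrite (sat_aut _ _ ag'.1); set e1 := (X in sat _ X <-> _);
        set e2 := (X in _ <-> sat _ X); suff -> : e1 = e2 by [].
      apply: funext => -[v|j]; rewrite /e1 /e2 //=.
      by have := gE (Ordinal ib, j); rewrite /= nth_index // => <-; rewrite gK.
    exists m, psi; split=> // x [x1 x2].
    apply: contrapT => /forallNP nps; apply: nx; exists x; exact: HS.
  exists [set q | V (fun x => psat x q)]; split.
    split; first exact: ultra_global_type.
    - by move=> q p'q; apply: HV; left; exists q.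
    - move=> q Vq [m [psi [psiD cov]]].
      have Vn : V [set x | forall i, ~ psat x (psi i)].
        by apply: (ultra_fin UV) => i; apply: HV; right; right; exists (psi i).
      have [x [xq xn]] := ultra_ex UV (ultraI UV Vq Vn).
      by have [i] := cov x xq; exact: xn.
  move=> t; have VS : V (St t) by apply: HV; right; left; exists t.
  split=> [Vt|st].
    by have [x [x1 x2]] := ultra_ex UV (ultraI UV Vt VS); apply/x2.
  by apply: (ultraS UV) VS => x [_]; apply.
(* Cantor's diagonal: the extension prescribed by [diag] disagrees with every [q] at the index [q],
   in particular with itself. *)
pose diag (t : {classic T}) := match (t : T) with
  | inl q => ~ sval q (PFormula phi (e t)) | inr _ => True end.
have [q [Hq qe]] := extend diag.
have := qe (inl (exist _ q Hq) : T); rewrite /diag /=; tauto.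
Qed.

End BoundedNip.

(** * NIP implies bounded non-forking *)

Section NipBounded.
Variables (L : language) (K : Type) (M : structure L) (n : nat).
Hypothesis mon : monster K M.
Implicit Types A B C D : set M.

Let slK : strong_limit K. Proof. by case: mon. Qed.
Let natK : small K [set: nat]. Proof. by case: mon => _ []. Qed.
Let smT_fsym : smT K (Defs.fsym L).
Proof. by case: mon => _ [_ H _] _ _; apply/small_setT. Qed.
Let smT_rsym : smT K (rsym L).
Proof. by case: mon => _ [_ _ H] _ _; apply/small_setT. Qed.

Lemma complete_type_closed (q : set (pformula M n)) s r :
  complete_type setT q -> (forall r', List.In r' s -> q r') ->
  (forall x, (forall r', List.In r' s -> psat x r') -> psat x r) -> q r.
Proof.
move=> [[_ cons] compl] sq sr; have [//|nr] := compl r (fun=> I).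
have [||x Hx] := cons [set r' | List.In r' (pneg r :: s)].
- by apply/finite_setE; exists (pneg r :: s).
- by move=> r' [<-|/sq].
have xr : ~ psat x r by apply: (Hx (pneg r)); left.
by case: xr; apply: sr => r' r's; apply: Hx; right.
Qed.

Lemma complete_type_neg (q : set (pformula M n)) r :
  complete_type setT q -> q (pneg r) -> ~ q r.
Proof.
move=> [[_ cons] _] qn qr.
have [||x Hx] := cons [set r' | List.In r' [:: pneg r; r]].
- by apply/finite_setE; exists [:: pneg r; r].
- by move=> r' [<-|[<-|]].
have nr : ~ psat x r by apply: (Hx (pneg r)); left.
by apply: nr; apply: Hx; right; left.
Qed.

(* A family shattered by realizations of [p] dualizes: the realizations of [p]
   are shattered by parameters coding subsets of an initial segment. *)
Lemma shattered_not_nip C (p : set (pformula M n)) k (phi : formula L ('I_n + 'I_k)) c :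
  small K C -> p `<=` @Defs.over L M n C ->
  (forall s eta N, (forall q, List.In q s -> p q) -> exists x, pattern phi s eta N c x) ->
  ~ nip_type p.
Proof.
move=> sC pC free; apply.
pose V := (nat * 'I_n + set nat * 'I_k)%type.
pose S1 q i (E : V -> M) := psat (fun v => E (inl (i, v))) q.
pose S2 i S (E : V -> M) :=
  sat phi (env (fun v => E (inl (i, v))) (fun j => E (inr (S, j)))) <-> S i.
have [|P [[q [i [pq ->]]]|[i [S ->]]]|s sS|E HE] := @compactness L K M mon V C
  [set P | (exists q i, p q /\ P = S1 q i) \/ (exists i S, P = S2 i S)] _ sC.
- apply: sm_sum => //; apply: sm_prod => //; try exact: sm_fin.
    exact: sm_nat.
  by apply: sm_set => //; exact: sm_nat.
- exact: (dfn_ren (fun v => inl (i, v)) (pf_dfn (pC _ pq))).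
- apply: dfn_iff; last exact: dfn_const.
  have := dfn_ren (A := C) (fun u : 'I_n + 'I_k => match u with inl v => inl (i, v)
     | inr j => inr (S, j) end : V) (formula_dfn C phi).
  apply: dfn_ext => u; set e1 := (X in sat _ X <-> _); set e2 := (X in _ <-> sat _ X).
  by suff -> : e1 = e2 by []; apply: funext => -[].
- have [N [t [tp HN]]] : exists N t, (forall q, List.In q t -> p q) /\
      forall P, List.In P s -> (exists q i, List.In q t /\ i < N /\ P = S1 q i) \/
        (exists i S, i < N /\ P = S2 i S).
    elim: s sS => [|P s IH] sS; first by exists 0, [::].
    have [|N [t [tp HN]]] := IH; first by move=> Q Qs; apply: sS; right.
    have up N' t' : N <= N' -> (forall q, List.In q t -> List.In q t') -> forall Q, List.In Q s ->
      (exists q i, List.In q t' /\ i < N' /\ Q = S1 q i) \/ (exists i S, i < N' /\ Q = S2 i S).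
      move=> NN tt Q /HN [[q [i [qt [iN ->]]]]|[i [S [iN ->]]]].
        by left; exists q, i; split; [exact: tt|split=> //; exact: leq_trans NN].
      by right; exists i, S; split=> //; exact: leq_trans NN.
    have [[q [i [pq E]]]|[i [S E]]] := sS P (or_introl erefl).
      exists (maxn N i.+1), (q :: t); split=> [q' [<-//|/tp//]|Q [<-|Qs]].
        by left; exists q, i; split; [left|split=> //; exact: leq_maxr].
      by apply: up Qs; [exact: leq_maxl|move=> q' q't; right].
    exists (maxn N i.+1), t; split=> // Q [<-|Qs].
      by right; exists i, S; split=> //; exact: leq_maxr.
    by apply: up Qs => //; exact: leq_maxl.
  (* Only the trace of a subset on the first [N] indices matters. The parameter [c r] codes the
     trace of rank [r], and [x i] realizes the pattern listing the traces that contain [i]. *)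
  pose F := {ffun 'I_N -> bool}.
  pose code (S : set nat) : 'I_#|F| := enum_rank ([ffun i : 'I_N => `[< S i >]] : F).
  have /choice[x Hx] : forall i, exists x, pattern phi t
      (fun r => if (insub r : option 'I_#|F|) is Some r' then
         (if (insub i : option 'I_N) is Some i' then (enum_val r' : F) i' else false) = true
         else False) #|F| c x.
    by move=> i; exact: free.
  exists (fun v => match v with inl u => x u.1 u.2 | inr u => c (code u.1) u.2 end).
  move=> P /HN [[q [i [qt [iN ->]]]]|[i [S [iN ->]]]].
    by have [Hq _] := Hx i; exact: (Hq q qt).
  have [_ /(_ (code S) (ltn_ord _))] := Hx i; rewrite /S2 /= => H; apply: (iff_trans H).
  rewrite valK (insubT (fun i => i < N) iN) /code enum_rankK ffunE /=.
  by split=> /asboolP.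
exists k, phi, (fun i v => E (inl (i, v))), (fun S j => E (inr (S, j))); split.
  by move=> i q pq; apply: (HE (S1 q i)); left; exists q, i.
by move=> i S; apply: (HE (S2 i S)); right; exists i, S.
Qed.

Section Invariance.
Variables (C D A : set M) (p p' q : set (pformula M n)).
Hypotheses (sC : small K C) (pC : p `<=` @Defs.over L M n C) (nip : nip_type p).
Hypotheses (CD : C `<=` D) (DA : D `<=` A) (sA : small K A).
Hypotheses (pp' : p `<=` p') (qnf : global_nonforking_extension D p' q).

(* If [q] separated two terms of a Morley sequence over [A], non-dividing would
   yield realizations of [p] with arbitrary alternation along the sequence. *)
Lemma nonforking_morley J U k (beta : J -> 'I_k -> M) c phi :
  ultra U -> base beta `<=` A -> morley U beta A c ->
  q (PFormula phi (c 0)) -> q (PFormula phi (c 1)).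
Proof.
move=> UU IA Hc q0; apply: contrapT => nq1.
have [qc p'q nf] := qnf.
have q1 : q (pneg (PFormula phi (c 1))).
  by have [//|] := qc.2 (PFormula phi (c 1)) (fun=> I).
apply: (shattered_not_nip (phi := phi) (c := c) sC pC) nip => s eta N sp.
apply: contrapT => /forallNP nx.
have Hth : dfn C (fun x : 'I_n -> M => forall r, List.In r s -> psat x r).
  by apply: dfn_In => r /sp /pC; exact: pf_dfn.
have [m [d [psi [Cd Hpsi]]]] := dfn_formula Hth.
pose Y := ('I_m + ('I_k + 'I_k))%type.
pose G (u : 'I_n + Y -> M) := sat psi (env (fun v => u (inl v)) (fun i => u (inr (inl i)))) /\
  sat phi (env (fun v => u (inl v)) (fun i => u (inr (inr (inl i))))) /\
  ~ sat phi (env (fun v => u (inl v)) (fun i => u (inr (inr (inr i))))).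
have HG : dfn set0 G.
  have H l (chi : formula L ('I_n + 'I_l)) (f : 'I_l -> Y) :
      dfn set0 (fun u : 'I_n + Y -> M => sat chi (env (fun v => u (inl v)) (fun i => u (inr (f i))))).
    have := dfn_ren (fun u : 'I_n + 'I_l => match u with inl v => inl v
      | inr i => inr (f i) end : 'I_n + Y) (@formula_dfn L M set0 _ chi).
    apply: dfn_ext => u; set e1 := (X in sat _ X <-> _); set e2 := (X in _ <-> sat _ X).
    by suff -> : e1 = e2 by []; apply: funext => -[].
  apply: dfn_and; first exact: (H _ psi (fun i => inl i)).
  apply: dfn_and; first exact: (H _ phi (fun i => inr (inl i))).
  apply: dfn_not; exact: (H _ phi (fun i => inr (inr i))).
have [g Hg] := dfn0_formula HG.
pose g' : formula L ('I_n + 'I_#|{: Y}|) := fren (fun u : 'I_n + Y => match u with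
  | inl v => inl v | inr y => inr (enum_rank y) end) g.
pose par i j : 'I_#|{: Y}| -> M := fun r => env d (env (c i) (c j)) (enum_val r).
have g'E x i j : psat x (PFormula g' (par i j)) <->
    (forall r, List.In r s -> psat x r) /\ sat phi (env x (c i)) /\ ~ sat phi (env x (c j)).
  rewrite /psat /= sat_fren Hpsi; set e := (X in sat g X).
  suff -> : e = env x (env d (env (c i) (c j))) by rewrite -Hg.
  by apply: funext => -[v|y]; rewrite /e //= /par enum_rankK.
have qchi : q (PFormula g' (par 0 1)).
  apply: (@complete_type_closed q (PFormula phi (c 0) :: pneg (PFormula phi (c 1)) :: s)) => //.
    by move=> r [<-|[<-|/sp/pp'/p'q]].
  move=> x Hx; apply/g'E; split; first by move=> r rs; apply: Hx; right; right.
  by split; [apply: (Hx (PFormula phi (c 0))); left|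
    apply: (Hx (pneg (PFormula phi (c 1)))); right; left].
apply: (nf _ qchi); exists 1, (fun=> PFormula g' (par 0 1)); split=> [_|x Hx]; last by exists ord0.
(* The disjoint pairs of consecutive terms are conjugate over [D]. If any [N.+1] of them had a
   common realization, it would produce the missing pattern of length [N]; the additional pair
   ensures that [s] is realized even when [N = 0]. *)
exists N.+1, (fun i => par i.*2 i.*2.+1); split=> [i|s' us ss [x Hx]].
  suff E : eqv D (par i.*2 i.*2.+1) (par 0 1) by move=> r /pf_dfn; exact: (eqv_iff E).
  apply: (eqv_ren (f := enum_val)); apply: eqv_sym; apply: eqv_env_l => [w|]; first exact: CD.
  apply: (eqv_mono DA).
  pose h t := i.*2 + t.
  have hm a b : a < b -> h a < h b by rewrite ltn_add2l.
  have := eqv_ren (f := fun u : 'I_k + 'I_k => match u with inl v => (0, v) | inr v => (1, v) end)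
    (morley_eqv UU IA Hc (morley_sub hm Hc)).
  have E a b : env (c a) (c b) = fun w : 'I_k + 'I_k =>
     c (match w with inl _ => a | inr _ => b end) (match w with inl v => v | inr v => v end).
    by apply: funext => -[].
  rewrite !E /h; congr (eqv _ _ _); apply: funext => -[v|v] //=; by rewrite ?addn0 ?addn1.
pose l := sort leq s'.
have sl : sorted ltn l by rewrite ltn_sorted_uniq_leq sort_uniq us /= sort_sorted //; exact: leq_total.
have szl : size l = N.+1 by rewrite size_sort.
(* From pair [t] the left entry is taken when [eta t] holds and the right one otherwise; after that
   [h] continues above all the pairs, so that it is increasing everywhere. *)
pose h t := if t < N.+1 then (nth 0 l t).*2 + ~~ `[< eta t >] else (nth 0 l N).*2.+2 + t.
have lE a b : a < b -> b < N.+1 -> nth 0 l a < nth 0 l b.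
  by move=> ab bN; apply: (sorted_ltn_nth ltn_trans) => //; rewrite inE szl // (ltn_trans ab).
have le2 (a : nat) (e : bool) : a.*2 + e < a.*2.+2.
  by case: e; rewrite ?addn1 ?addn0.
have hm a b : a < b -> h a < h b.
  move=> ab; rewrite /h; have [bN|bN] := ltnP b N.+1.
    rewrite (ltn_trans ab bN); apply: leq_trans (leq_addr _ _).
    by apply: leq_trans (le2 _ _) _; rewrite -doubleS leq_double; exact: lE.
  have [aN|aN] := ltnP a N.+1; last by rewrite ltn_add2l.
  apply: leq_trans (leq_addr _ _); apply: leq_trans (le2 _ _) _.
  rewrite !ltnS leq_double; move: aN; rewrite ltnS leq_eqVlt => /orP[/eqP->//|aN].
  by apply: ltnW; exact: lE.
pose P (e : nat * 'I_k -> M) := exists x, (forall r, List.In r s -> psat x r) /\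
  forall i, i \in iota 0 N -> (sat phi (env x (fun j => e (i, j))) <-> eta i).
have HP : dfn A P.
  apply: dfn_ex; apply: dfn_and.
    apply: dfn_mono (DA) _; apply: dfn_mono (CD) _; exact: dfn_ren Hth.
  apply: dfn_mem => i _; apply: dfn_iff; last exact: dfn_const.
  have := dfn_ren (A := A) (fun u : 'I_n + 'I_k => match u with inl v => inr v
     | inr j => inl (i, j) end : (nat * 'I_k) + 'I_n) (formula_dfn A phi).
  apply: dfn_ext => u; set e1 := (X in sat _ X <-> _); set e2 := (X in _ <-> sat _ X).
  by suff -> : e1 = e2 by []; apply: funext => -[].
have [||y [y1 y2]] := morley_eqv UU IA (morley_sub hm Hc) Hc (P := P).
- exact: HP.
- have Hn i : i < N.+1 -> psat x (PFormula g' (par (nth 0 l i).*2 (nth 0 l i).*2.+1)).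
    by move=> iN; apply: Hx; rewrite -(mem_sort leq) mem_nth // szl.
  exists x; split; first by have /g'E[] := Hn 0 isT.
  move=> i; rewrite mem_iota add0n => /andP[_ iN].
  have /g'E [_ [x0 x1]] := Hn i (ltnW iN).
  rewrite /= /h ltnS (ltnW iN); case: asboolP => e; rewrite /= ?addn0 ?addn1; by split.
- by apply: (nx y); split=> // i iN; apply: y2; rewrite mem_iota.
Qed.

Hypothesis mA : model_set A.

(** Two tuples of equal type over [A] need not be consecutive in a Morley sequence, but both can
    precede a common one: for a coheir extending their type, [c] is Morley over [A], [a] and [b], so
    [a, c] and [b, c] are Morley over [A]. Hence [q] treats [a] and [b] alike through [c 0]. *)
Lemma nonforking_invariant k (phi : formula L ('I_n + 'I_k)) a b :
  eqv A a b -> q (PFormula phi a) -> q (PFormula phi b).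
Proof.
move=> Eab.
pose J := {e : 'I_k -> M | forall i, A (e i)}.
pose beta (j : J) : 'I_k -> M := sval j.
have [s sS|U UU HU] := @ultra_exists J [set S | exists P, [/\ dfn A P, P a &
    S = [set j | P (beta j)]]].
  have /choice[f Hf] : forall S, exists P : ('I_k -> M) -> Prop, List.In S s ->
      [/\ dfn A P, P a & S = [set j | P (beta j)]].
    move=> S; have [/sS [P HP]|] := pselect (List.In S s); first by exists P.
    by exists (fun=> True).
  have [|||a' Aa' Ha'] := @mA _ a (fun e => forall S, List.In S s -> f S e).
  - by [].
  - by apply: dfn_In => S /Hf [].
  - by move=> S /Hf [].
  exists (exist _ a' Aa') => S Ss; have [_ _ ->] := Hf S Ss; exact: Ha'.
have avgP d : eqv A a d -> avg U beta A d.
  move=> Ead P HP Pd; apply: HU; exists P; split=> //; exact: (eqv_sym Ead).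
have IA : base beta `<=` A by move=> _ [[j i] _ <-]; exact: (svalP j).
have [|c Hc] := @morley_exists L K M mon J U _ beta UU (A `|` range a `|` range b).
  by do 2?apply: small_setU => //; apply: small_range; exact: sm_fin.
have Mcons d : eqv A a d -> range d `<=` A `|` range a `|` range b ->
    morley U beta A (scons d c).
  move=> Ead dB [|t].
    by apply: avg_mono (avgP d Ead) => x [//|[]].
  apply: avg_mono (Hc t) => x [Ax|[[|s] st xs]]; first by do 3!left.
    by left; exact: dB.
  by right; exists s.
have [qc _ _] := qnf.
have to_c chi d : eqv A a d -> range d `<=` A `|` range a `|` range b ->
    q (PFormula chi d) -> q (PFormula chi (c 0)).
  by move=> Ead dB; exact: (nonforking_morley UU IA (Mcons d Ead dB)).
move=> qa; have [//|qnb] := qc.2 (PFormula phi b) (fun=> I).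
have qc0 := to_c phi a (eqv_refl (e := a)) (fun x ax => or_introl (or_intror ax)) qa.
by case: (complete_type_neg (r := PFormula phi (c 0)) qc (to_c (Neg phi) b Eab (fun x bx => or_intror bx) qnb) qc0).
Qed.

End Invariance.

Lemma nip_bounded C (p : set (pformula M n)) D p' :
  small K C -> p `<=` @Defs.over L M n C -> nip_type p ->
  small K D -> C `<=` D -> p `<=` p' ->
  small K [set q | global_nonforking_extension D p' q].
Proof.
move=> sC pC nip sD CD pp'.
have [A [sA DA _ mA _]] : exists A, [/\ small K A, D `<=` A, range (@elt _ _ D) `<=` A, model_set A &
    forall (m : nat -> M) l (a : 'I_l -> M), (forall i, A (a i)) ->
      exists2 m', (forall i, A (m' i)) & eqv (range (@elt _ _ D)) (env m a) (env m' a)].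
  by apply: (closure mon) => //; apply/small_smT.
have [a0 Aa0] := model_inh mA.
(* [pad] and [lift] bring tuples and formulas of every arity [k] into types independent of [k], so
   that all codes lie in one small type; the arity is recorded so that a code can be compared with
   formulas of the same [k]. *)
pose pad k (b : 'I_k -> M) (i : nat) := if insub i is Some j then b j else a0.
pose tp k (b : 'I_k -> M) : set (formula L (nat + {x | A x})) :=
  [set phi | sat phi (env (pad k b) (@elt _ _ A))].
pose lift k (phi : formula L ('I_n + 'I_k)) : formula L ('I_n + nat) :=
  fren (fun u => match u with inl v => inl v | inr j => inr (val j) end) phi.
have padE k (b : 'I_k -> M) j : pad k b (val j) = b j by rewrite /pad valK.
have tp_eqv k (b b' : 'I_k -> M) : tp k b = tp k b' -> eqv A b b'.
  move=> E P [phi HP].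
  pose phi' := fren (fun u => match u with inl j => inl (val j) | inr a => inr a end) phi
    : formula L (nat + {x | A x}).
  have HP' d : P d <-> tp k d phi'.
    rewrite HP /tp /= sat_fren; set e1 := (X in sat _ X <-> _); set e2 := (X in _ <-> sat _ X).
    by suff -> : e1 = e2 by []; apply: funext => -[j|a]; rewrite /e1 /e2 //= padE.
  by rewrite !HP' E.
have liftE k (phi psi : formula L ('I_n + 'I_k)) (x : 'I_n -> M) (b : 'I_k -> M) : lift k phi = lift k psi ->
    sat phi (env x b) -> sat psi (env x b).
  have H chi : sat chi (env x b) <-> sat (lift k chi) (env x (pad k b)).
    rewrite sat_fren; set e1 := (X in sat _ X <-> _); set e2 := (X in _ <-> sat _ X).
    by suff -> : e1 = e2 by []; apply: funext => -[v|j]; rewrite /e1 /e2 //= padE.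
  by move=> E /H; rewrite E => /H.
pose Code := (nat * formula L ('I_n + nat) * set (formula L (nat + {x | A x})))%type.
pose code (q : set (pformula M n)) : set Code := [set w | exists k (phi : formula L ('I_n + 'I_k)) b,
  q (PFormula phi b) /\ w = (k, lift k phi, tp k b)].
have sCode : smT K (set Code).
  have sn := sm_nat natK.
  apply: sm_set => //; apply: sm_prod => //; first apply: sm_prod => //.
    by apply: sm_formula => //; apply: sm_sum => //; exact: sm_fin.
  apply: sm_set => //; apply: sm_formula => //; apply: sm_sum => //; exact/small_smT.
apply/small_smT; apply: sm_le sCode; exists (fun q => code (sval q)).
suff sub q1 q2 : global_nonforking_extension D p' q1 -> global_nonforking_extension D p' q2 ->
    code q1 = code q2 -> q1 `<=` q2.
  move=> [q1 H1] [q2 H2] /= E; have E' : q1 = q2.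
    by apply/seteqP; split; apply: sub => //; rewrite E.
  by subst q2; congr exist; exact: Prop_irrelevance.
move=> H1 H2 E [k phi b] q1b.
have : code q1 (k, lift k phi, tp k b) by exists k, phi, b.
rewrite E => -[k' [phi' [b' [q2b' [kk']]]]]; subst k' => lE tE.
have [q2c _ _] := H2.
have q2b := nonforking_invariant sC pC nip CD DA sA pp' H2 mA (tp_eqv _ _ _ (esym tE)) q2b'.
apply: (complete_type_closed (s := [:: PFormula phi' b]) q2c) => [r [<-|]//|x Hx].
by have := Hx _ (or_introl erefl); exact: (liftE _ _ _ _ _ (esym lE)).
Qed.

End NipBounded.

Theorem theorem5p10 (L : language) (T : theory L) (K : Type) (M : structure L)
    (n : nat) (C : set M) (p : set (pformula M n)) :
  complete_theory T -> model T M -> monster K M -> ntp2 M ->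
  small K C -> partial_type C p ->
  (nip_type p <->
   forall (D : set M) (p' : set (pformula M n)),
     small K D -> C `<=` D -> complete_type D p' -> p `<=` p' ->
     small K [set q | global_nonforking_extension D p' q]).
Proof.
move=> _ _ mon nt sC pC; split; last exact: bounded_nip mon nt _ _ sC pC.
by move=> nip D p' sD CD _ pp'; exact: nip_bounded mon _ _ _ _ sC pC.1 nip sD CD pp'.
Qed.
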